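(* For every integer $n\ge 7$, the third order Turán number $\mathrm{ex}^{(3)}(n;P)$ and the family $\mathrm{Ex}^{(3)}(n;P)$ of 3-extremal 3-graphs (up to isomorphism) are as follows: $$ \mathrm{ex}^{(3)}(n;P)= \begin{cases} 3n-8 & \text{and } \mathrm{Ex}^{(3)}(n;P)=\{G_1(n),G_2(n)\} \text{ for } 7\le n\le 10,\\ 25 & \text{and } \mathrm{Ex}^{(3)}(n;P)=\{G_1(n),G_2(n),\mathrm{Co}(n)\} \text{ for } n=11,\\ 32 & \text{and } \mathrm{Ex}^{(3)}(n;P)=\{\mathrm{Co}(n)\} \text{ for } n=12,\\ 20+\binom{n-7}{2} & \text{and } \mathrm{Ex}^{(3)}(n;P)=\{K_6\cup S_{n-6}\} \text{ for } 13\le n\le 14,\\ 4+\binom{n-5}{2} & \text{and } \mathrm{Ex}^{(3)}(n;P)=\{K_4\cup S_{n-4}\} \text{ for } n\ge 15. \end{cases} $$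
   Context: A 3-graph is a 3-uniform hypergraph. For 3-graphs $F,H$, write $H\supseteq F$ (or $F\subseteq H$) if $H$ contains a (not necessarily induced) sub-3-graph isomorphic to $F$; $H$ is $F$-free if $H\not\supseteq F$. $P$ is the loose path: the 3-graph on 7 vertices $a,b,c,d,e,f,g$ with edges $\{a,b,c\},\{c,d,e\},\{e,f,g\}$. Turán numbers of higher order: $\mathrm{ex}^{(1)}(n;P)$ is the maximum number of edges in an $n$-vertex $P$-free 3-graph, and $\mathrm{Ex}^{(1)}(n;P)$ is the family of all pairwise non-isomorphic $n$-vertex $P$-free 3-graphs with $\mathrm{ex}^{(1)}(n;P)$ edges. Recursively, for an integer $s\ge1$, $\mathrm{ex}^{(s+1)}(n;P)$ is the maximum of $|E(H)|$ over all $n$-vertex $P$-free 3-graphs $H$ such that $H\nsubseteq H'$ for every $H'\in \mathrm{Ex}^{(1)}(n;P)\cup\dots\cup\mathrm{Ex}^{(s)}(n;P)$ (if such $H$ exists), and $\mathrm{Ex}^{(s+1)}(n;P)$ is the family of all (pairwise non-isomorphic) such $H$ attaining this maximum. Special 3-graphs: $K_n$ is the complete 3-graph on $n$ vertices. $S_n$ (the full star) is the 3-graph on $n$ vertices with $\binom{n-1}{2}$ edges in which one vertex, the center, forms edges with all pairs of the remaining vertices. $F_1\cup F_2$ denotes the vertex-disjoint union of $F_1$ and $F_2$. The comet $\mathrm{Co}(n)$ is the $n$-vertex 3-graph consisting of a $K_4$ and a full star $S_{n-3}$ sharing exactly one vertex, which is the center of the star. For a vertex set $V$ with $|V|=n\ge7$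 and four distinct vertices $x,y,z,v\in V$, $G_1(n)$ and $G_2(n)$ are the 3-graphs on $V$ with edge sets $$G_1(n)=\{\{x,y,z\}\}\cup\left\{h\in\binom V3: v\in h,\ h\cap\{x,y,z\}\ne\emptyset\right\},$$ $$G_2(n)=\{\{x,y,z\}\}\cup\left\{h\in\binom V3: |h\cap\{x,y,z\}|=2\right\}.$$ *)

(* Defs.v *)
From mathcomp Require Import all_boot.
From Stdlib Require List.

Set Implicit Arguments.
Unset Strict Implicit.
Unset Printing Implicit Defensive.

Record hypergraph := Hypergraph {
  vertex : finType;
  edges : {set {set vertex}}
}.

Definition is_3graph (V : finType) (E : {set {set V}}) : bool :=
  [forall e in E, #|e| == 3].

Definition isomorphic (F H : hypergraph) : Prop :=
  exists2 f : vertex F -> vertex H,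
    bijective f & forall e : {set vertex F}, (e \in edges F) = (f @: e \in edges H).

(* [contains H F]: some subhypergraph of [H], not necessarily induced, is
   isomorphic to [F]. *)
Definition contains (H F : hypergraph) : bool :=
  [exists f : {ffun vertex F -> vertex H},
    injectiveb f && [forall e in edges F, f @: e \in edges H]].

(* The loose path with a, ..., g numbered 0, ..., 6. *)
Definition loose_path : hypergraph :=
  let u (k : nat) : 'I_7 := inord k in
  Hypergraph [set [set u 0; u 1; u 2]; [set u 2; u 3; u 4]; [set u 4; u 5; u 6]].

Section HigherOrderTuran.
Variables (P : hypergraph) (n : nat).

(* Every n-vertex 3-graph is represented, up to isomorphism, by an edge set on
   'I_n.  Families of n-vertex 3-graphs are represented by sets of such edge
   sets containing all labelled copies of their members. *)

Definition admissible (A : {set {set {set 'I_n}}}) : {set {set {set 'I_n}}} :=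
  [set E : {set {set 'I_n}} |
    [&& is_3graph E, ~~ contains (Hypergraph E) P
      & [forall E' in A, ~~ contains (Hypergraph E') (Hypergraph E)]]].

(* If no 3-graph is admissible, this is 0 and [max_admissible A] is empty. *)
Definition max_size (A : {set {set {set 'I_n}}}) : nat :=
  \max_(E in admissible A) #|E|.

Definition max_admissible (A : {set {set {set 'I_n}}}) : {set {set {set 'I_n}}} :=
  [set E in admissible A | #|E| == max_size A].

(* The union of the extremal families of orders 1, ..., s. *)
Fixpoint Ex_upto (s : nat) : {set {set {set 'I_n}}} :=
  if s is s'.+1 then Ex_upto s' :|: max_admissible (Ex_upto s') else set0.

(* Orders start at 1; the values at order 0 are junk. *)
Definition ex (s : nat) : nat :=
  if s is s'.+1 then max_size (Ex_upto s') else 0.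

Definition Ex (s : nat) : {set {set {set 'I_n}}} :=
  if s is s'.+1 then max_admissible (Ex_upto s') else set0.

(* [L] lists the isomorphism classes in [A], each exactly once. *)
Definition family_is (A : {set {set {set 'I_n}}}) (L : seq hypergraph) : Prop :=
  [/\ forall E : {set {set 'I_n}},
        E \in A <-> exists2 F, List.In F L & isomorphic (Hypergraph E) F,
      forall F, List.In F L ->
        exists2 E : {set {set 'I_n}}, E \in A & isomorphic (Hypergraph E) F
    & List.ForallOrdPairs (fun F G => ~ isomorphic F G) L].

End HigherOrderTuran.

Definition complete_on (V : finType) (A : {set V}) : {set {set V}} :=
  [set h : {set V} | (#|h| == 3) && (h \subset A)].

Definition star_on (V : finType) (c : V) (A : {set V}) : {set {set V}} :=
  [set h : {set V} in complete_on A | c \in h].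

Definition disjoint_union (F G : hypergraph) : hypergraph :=
  @Hypergraph (vertex F + vertex G)%type
    ([set [set inl x | x in e] | e : {set vertex F} in edges F]
     :|: [set [set inr x | x in e] | e : {set vertex G} in edges G]).

Definition K (n : nat) : hypergraph := Hypergraph (complete_on [set: 'I_n]).

(* From here on 'I_n.-1.+1 is the n-element vertex set (for n > 0); it is used
   in place of 'I_n so that it has visible elements. *)

Definition Star (n : nat) : hypergraph :=
  Hypergraph (star_on ord0 [set: 'I_n.-1.+1]).

Definition Co (n : nat) : hypergraph :=
  Hypergraph (complete_on [set i : 'I_n.-1.+1 | i < 4]
              :|: star_on ord0 [set i : 'I_n.-1.+1 | (i == ord0) || (4 <= i)]).

Definition G1_edges (V : finType) (x y z v : V) : {set {set V}} :=
  [set x; y; z] |: [set h : {set V} |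
    [&& #|h| == 3, v \in h & h :&: [set x; y; z] != set0]].

Definition G2_edges (V : finType) (x y z : V) : {set {set V}} :=
  [set x; y; z] |: [set h : {set V} |
    (#|h| == 3) && (#|h :&: [set x; y; z]| == 2)].

Definition G1 (n : nat) : hypergraph :=
  let u (k : nat) : 'I_n.-1.+1 := inord k in
  Hypergraph (G1_edges (u 0) (u 1) (u 2) (u 3)).

Definition G2 (n : nat) : hypergraph :=
  let u (k : nat) : 'I_n.-1.+1 := inord k in
  Hypergraph (G2_edges (u 0) (u 1) (u 2)).

(* Main.v *)
Require Import Defs.
From mathcomp Require Import all_boot zify_ssreflect.
From Stdlib Require Import Lia.

Set Implicit Arguments.
Unset Strict Implicit.
Unset Printing Implicit Defensive.

(* Every large P-free 3-graph H is contained in a full star, in a comet, in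
   K_6 and a vertex-disjoint rest, in K_4 and a vertex-disjoint star, or in G_1 or
   G_2; this is proved by induction on the number of vertices.  A disconnected H
   is handled by adding up the bounds for its parts, and an intersecting H by a
   Hilton-Milner type argument.  Any other H contains edges abc, bcd, def.  On at
   most eleven vertices, a search for the sets of triples that avoid P and contain
   these three edges finds only 3-graphs contained in a comet or in K_6 and a rest,
   or smaller than 3n-8.  On more vertices, if H contains a triangle pqr', qrp',
   rpq', then every other edge that leaves its six vertices has one vertex outside,
   so that H has at most 3n-8 edges.  Without triangles, the edges around a vertex
   of maximum degree among those in which two edges meet alone are so restricted
   that deleting two or three vertices loses few edges, by the induction hypothesis.
   Given the classification, the first three orders are read off from the sizes of
   these 3-graphs, since an extremal 3-graph of one of these orders does not embed
   into those of a smaller order. *)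

(** A bound on the number of edges alone cannot be carried through the induction: what is left after
    deleting two or three vertices may be a star or a comet, far larger than the third number. Hence
    the induction runs over a statement about containment. A left-over star or comet with its centre
    elsewhere is disposed of by the choice of a junction of maximum degree, and a left-over K_6 by
    counting, since without triangles six vertices carry at most 15 edges instead of 20. The value
    31 at twelve vertices, where the third number is 32, is dictated by the same deletion: from
    fourteen vertices, two are removed together with at most ten edges, and 30 + 10 is just below
    41. The irregular small cases are due to K_6: its 20 edges beat the star at n = 7, two copies of
    it tie with the comet at n = 13, and K_6 with a star stays ahead of K_4 with a star up to n =
    14. *)

(* Clears the hypotheses on elements and sets, which only slow [lia] down, and
   unfolds [reverse_coercion], by which equal cardinals may differ. *)
Ltac nlia :=
  repeat match goal with
  | h : is_true (_ \in _) |- _ => clear h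
  | h : is_true (_ \notin _) |- _ => clear h
  | h : is_true (_ \subset _) |- _ => clear h
  | h : is_true (@eq_op ?T _ _) |- _ =>
      lazymatch eval hnf in (Equality.sort T) with nat => fail | _ => clear h end
  | h : is_true (~~ @eq_op ?T _ _) |- _ =>
      lazymatch eval hnf in (Equality.sort T) with nat => fail | _ => clear h end
  | h : forall _, _ |- _ => clear h
  end; unfold reverse_coercion in *; lia.

Notation meet e f := #|e :&: f|.

(** * 3-graphs on a vertex set, loose paths, connectedness *)

Section Triples.
Variable V : finType.
Implicit Types (x y z a b c : V) (e f g A B : {set V}) (H : {set {set V}}).

Lemma card_set3 a b c : a != b -> a != c -> b != c -> #|[set a; b; c]| = 3.
Proof.
move=> ab ac bc; rewrite -setUA cardsU1 !inE negb_or ab ac /=.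
by rewrite cards2 bc.
Qed.

Lemma meet_set3 a b c g : a != b -> a != c -> b != c ->
  meet [set a; b; c] g = (a \in g) + (b \in g) + (c \in g).
Proof.
move=> ab ac bc.
have -> : [set a; b; c] :&: g = [set x in [seq x <- [:: a; b; c] | x \in g]].
  by apply/setP=> x; rewrite !inE mem_filter !inE andbC orbA.
rewrite cardsE; have /card_uniqP -> : uniq [seq x <- [:: a; b; c] | x \in g].
  by rewrite filter_uniq //= !inE negb_or ab ac bc.
by rewrite size_filter /= addn0 addnA.
Qed.

Lemma meetC e f : meet e f = meet f e.
Proof. by rewrite setIC. Qed.

Lemma card3P e : #|e| = 3 ->
  exists a b c, [/\ e = [set a; b; c], a != b, a != c & b != c].
Proof.
move=> e3; have : size (enum e) = 3 by rewrite -cardE.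
have := enum_uniq e; have := set_enum e.
case: (enum e) => [|a [|b [|c [|]]]] //= <-; rewrite !inE negb_or.
move=> /and3P[/andP[ab ac] bc _] _; exists a, b, c; split=> //.
by apply/setP=> x; rewrite !inE orbA.
Qed.

Lemma count_mem_le (s : seq V) g : uniq s -> count (mem g) s <= #|g|.
Proof.
move=> us; rewrite -size_filter cardE; apply: uniq_leq_size.
  exact: filter_uniq.
by move=> x; rewrite mem_filter mem_enum => /andP[].
Qed.

Lemma set3_eq a b c g : a != b -> a != c -> b != c -> #|g| = 3 ->
  a \in g -> b \in g -> c \in g -> g = [set a; b; c].
Proof.
move=> ab ac bc g3 ga gb gc; apply/eqP; rewrite eq_sym eqEcard g3 card_set3 //.
by rewrite andbT; apply/subsetP=> x; rewrite !inE -orbA => /or3P[]/eqP->.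
Qed.

Lemma meet1P e f : meet e f = 1 -> exists x, e :&: f = [set x].
Proof. by move/eqP/cards1P. Qed.

Lemma meet2P e f : meet e f = 2 -> exists x y, x != y /\ e :&: f = [set x; y].
Proof. by move/eqP/cards2P. Qed.

Lemma meet_gt0P e f : 0 < meet e f -> exists x, x \in e /\ x \in f.
Proof. by move/card_gt0P => [x]; rewrite inE => /andP[xe xf]; exists x. Qed.

Lemma meet_gt0 e f x : x \in e -> x \in f -> 0 < meet e f.
Proof. by move=> xe xf; apply/card_gt0P; exists x; rewrite inE xe. Qed.

Lemma meet0_notin e f x : meet e f = 0 -> x \in e -> x \notin f.
Proof. by move=> ef xe; apply/negP=> xf; have := meet_gt0 xe xf; rewrite ef. Qed.

Definition three_graph A H := forall e, e \in H -> #|e| = 3 /\ e \subset A.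

Lemma three_graphS A H H' : H' \subset H -> three_graph A H -> three_graph A H'.
Proof. by move=> /subsetP sub tH e /sub/tH. Qed.

(** The middle edge [g] comes last. As [e] and [f] are disjoint, it meets them in different
    vertices, so these intersection sizes describe exactly the loose path; [loose_path_free] is the
    translation. *)
Definition P_free H := forall e f g, e \in H -> f \in H -> g \in H ->
  meet e f = 0 -> meet g e = 1 -> meet g f = 1 -> False.

Lemma P_freeS H H' : H' \subset H -> P_free H -> P_free H'.
Proof. by move=> /subsetP sub Pf e f g /sub eH /sub fH /sub gH; apply: Pf. Qed.

Definition closed_in A H B :=
  forall e, e \in H -> e \subset B \/ e \subset A :\: B.

(** Closed sets are unions of components, so isolated vertices are excluded too as soon as [A] has
    two elements. *)
Definition connected_in A H :=
  forall B, B \subset A -> B != set0 -> closed_in A H B -> B = A.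

Definition intersecting H := forall e f, e \in H -> f \in H -> 0 < meet e f.

(** If no edge joins [e] to an edge disjoint from it, the union of the edges meeting [e] is closed,
    hence everything. A joining edge has only three vertices to share between two disjoint edges,
    which leaves the sizes 2, 1 and 1, 1 up to exchanging the ends. *)
Lemma not_intersecting A H : three_graph A H -> connected_in A H ->
  ~ intersecting H ->
  exists e g f, [/\ e \in H, g \in H, f \in H, meet e f = 0 &
    meet e g = 2 /\ meet g f = 1 \/ meet e g = 1 /\ meet g f = 1].
Proof.
move=> tH cH nI.
have [/existsP[e /existsP[g /existsP[f]]]|nex] :=
  boolP [exists e, exists g, exists f,
   [&& e \in H, g \in H, f \in H, meet e f == 0, 0 < meet e g & 0 < meet g f]].
  case/and5P=> eH gH fH /eqP ef /andP[eg gf].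
  have [g3 _] := tH _ gH.
  have : meet g e + meet g f <= 3.
    rewrite -g3 -cardsUI -setIUr.
    have -> : (g :&: e) :&: (g :&: f) = set0.
      by rewrite setIACA (eqP (_ : e :&: f == set0)) ?setI0 // -cards_eq0 ef.
    by rewrite cards0 addn0 subset_leq_card // subsetIl.
  rewrite (meetC g e) => le3.
  case eg2 : (meet e g == 2).
    exists e, g, f; split=> //; left; split; [exact/eqP | lia].
  have eg1 : meet e g = 1 by lia.
  have [gf2|gf2] := boolP (meet g f == 2).
    exists f, g, e; split=> //; first by rewrite meetC.
    by left; rewrite meetC (eqP gf2) meetC.
  exists e, g, f; split=> //; right; split => //; lia.
exfalso; apply: nI => e f eH fH; rewrite lt0n; apply/negP => /eqP ef0.
pose B := \bigcup_(g in H | 0 < meet e g) g.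
have clB : closed_in A H B.
  move=> h hH; have [eh|eh] := boolP (0 < meet e h).
    by left; apply: (bigcup_sup h); rewrite hH.
  right; apply/subsetP=> x xh; rewrite inE (subsetP (tH _ hH).2 _ xh) andbT.
  apply/bigcupP=> -[g /andP[gH eg] xg]; case/negP: nex.
  apply/existsP; exists e; apply/existsP; exists g; apply/existsP; exists h.
  by rewrite eH gH hH eg (meet_gt0 xg xh) -leqn0 leqNgt eh.
have eB : e \subset B.
  by apply: (bigcup_sup e); rewrite eH setIid (tH _ eH).1.
have BA : B = A.
  apply: cH => //; first by apply/bigcupsP=> g /andP[/tH[]].
  apply/set0Pn; have /card_gt0P[x xe] : 0 < #|e| by rewrite (tH _ eH).1.
  by exists x; apply: (subsetP eB).
have /card_gt0P[x xf] : 0 < #|f| by rewrite (tH _ fH).1.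
have := subsetP (tH _ fH).2 _ xf; rewrite -BA => /bigcupP[g /andP[gH eg] xg].
case/negP: nex; apply/existsP; exists e; apply/existsP; exists g.
apply/existsP; exists f.
by rewrite eH gH fH ef0 eg (meet_gt0 xg xf).
Qed.

(** Sizes 1, 1 form a loose path, so 2, 1 remain. The three edges are the seed of the search on few
    vertices, and [d] is the first junction on many vertices. *)
Lemma chain_labels A H : three_graph A H -> P_free H -> connected_in A H ->
  ~ intersecting H -> exists a b c d e f : V,
  [/\ uniq [:: a; b; c; d; e; f], [set a; b; c] \in H, [set b; c; d] \in H,
      [set d; e; f] \in H & all (mem A) [:: a; b; c; d; e; f]].
Proof.
move=> tH Pf cH nI; have [E [G [F [EH GH FH EF0]]]] := not_intersecting tH cH nI.
case=> [[EG2 GF1]|[EG1 GF1]]; last first.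
  by case: (Pf E F G) => //; rewrite meetC.
have [E3 EA] := tH _ EH; have [G3 GA] := tH _ GH; have [F3 FA] := tH _ FH.
have [b [c [bc EGE]]] := meet2P EG2.
have [d GFE] := meet1P GF1.
have bE : b \in E :&: G by rewrite EGE !inE eqxx.
have cE : c \in E :&: G by rewrite EGE !inE eqxx orbT.
have dG : d \in G :&: F by rewrite GFE !inE eqxx.
move: bE cE dG; rewrite !inE => /andP[bE bG] /andP[cE cG] /andP[dG dF].
have nF x : x \in E -> x \notin F by apply: meet0_notin.
have bd : b != d by apply: contraNneq (nF _ bE) => ->.
have cd : c != d by apply: contraNneq (nF _ cE) => ->.
have dE : d \notin E by apply/negP=> /nF; rewrite dF.
have /card_gt0P[a] : 0 < #|E :\: [set b; c]|.
  by rewrite cardsD E3 (setIidPr _) ?cards2 ?bc // subUset !sub1set bE.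
rewrite !inE negb_or => /andP[/andP[ab ac] aE].
have /eqP/cards2P[e [f [ef FE]]] : #|F :\ d| = 2.
  by have := cardsD1 d F; rewrite dF F3 => -[].
have : e \in F :\ d by rewrite FE !inE eqxx.
have : f \in F :\ d by rewrite FE !inE eqxx orbT.
rewrite !inE => /andP[fd fF] /andP[ed eF].
have ad : a != d by apply: contraNneq dE => <-.
have ne x y : x \in E -> y \in F -> x != y.
  by move=> xE yF; apply: contraNneq (nF _ xE) => ->.
exists a, b, c, d, e, f; split.
- by rewrite /= !inE !negb_or ab ac ad bc bd cd ef (ne a e) // (ne a f) // (ne b e) //
     (ne b f) // (ne c e) // (ne c f) //= (eq_sym d e) ed (eq_sym d f) fd.
- by rewrite -(set3_eq _ _ _ E3).
- by rewrite -(set3_eq _ _ _ G3).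
- by rewrite -(set3_eq _ _ _ F3) // eq_sym.
- by rewrite /= (subsetP EA _ aE) (subsetP EA _ bE) (subsetP EA _ cE)
    (subsetP FA _ dF) (subsetP FA _ eF) (subsetP FA _ fF).
Qed.

End Triples.

(** * Connected 3-graphs on at most eleven vertices *)

Section Shapes.
Variable V : finType.
Implicit Types (A : {set V}) (H : {set {set V}}).

(** This shape and the next two express containment in a standard 3-graph by a condition on each
    single edge, so they pass to subgraphs. *)
Definition star_like H := exists v, forall e, e \in H -> v \in e.

Definition comet_like A H := exists (K : {set V}) v,
  [/\ K \subset A, #|K| = 4, v \in K
    & forall e, e \in H -> e \subset K \/ e :&: K = [set v]].

Definition K6_like A H := exists K : {set V},
  [/\ K \subset A, #|K| = 6 & forall e, e \in H -> e \subset K \/ meet e K = 0].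

End Shapes.

(** * The search, on triples of numbers *)

Definition triple := (nat * nat * nat)%type.

Definition mem3 (i : nat) (t : triple) :=
  let: (a, b, c) := t in [|| i == a, i == b | i == c].

Definition meet3 (s t : triple) : nat :=
  let: (a, b, c) := s in mem3 a t + mem3 b t + mem3 c t.

Definition is_path (e f g : triple) :=
  [&& meet3 e f == 0, meet3 g e == 1 & meet3 g f == 1].

Definition conflict e f g := [|| is_path e f g, is_path e g f | is_path f g e].

(** The numbers 0, 1, 2, 3 stand for [a], [b], [c], [d] of the chain. They carry the K_4, and [d] is
    the centre because the edge [def] meets the K_4 only there. *)
Definition in_comet (t : triple) :=
  [&& meet3 t (0, 1, 2) == 0 & mem3 3 t]
  || all (fun i => i < 4) [:: t.1.1; t.1.2; t.2].

(** The numbers below 6 are the vertices of the chain; they serve as the K_6. *)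
Definition core_size (t : triple) := (t.1.1 < 6) + (t.1.2 < 6) + (t.2 < 6).

Definition in_K6 (t : triple) := core_size t \in [:: 0; 3].

(* [chosen] and [open] are the triples already put in, and those still allowed,
   respectively; each branch adds or discards the first open triple.  The tests
   are conditionals, not [||] and [&&], to be lazy under [vm_compute]. *)
Fixpoint search (target fuel : nat) (chosen open : seq triple) : bool :=
  let cand := chosen ++ open in
  if size cand < target then true
  else if all in_comet cand then true
  else if all in_K6 cand then true
  else if fuel isn't fuel'.+1 then false
  else if open isn't g :: open' then false
  else if search target fuel' chosen open' then
    search target fuel' (g :: chosen)
      [seq h <- open' | all (fun f => ~~ conflict g f h) chosen]
  else false.

Definition triples (m : nat) : seq triple :=
  [seq (ij.1, ij.2, k) | k <- iota 0 m,
     ij <- [seq (i, j) | j <- iota 0 k, i <- iota 0 j]].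

Definition chain3 : seq triple := [:: (0, 1, 2); (1, 2, 3); (3, 4, 5)].

(* Crossing triples first: this order keeps the search tree small. *)
Definition open_triples (m : nat) : seq triple :=
  [seq t <- flatten [seq [seq t <- triples m | core_size t == i]
                    | i <- [:: 1; 2; 3; 0]]
    | (t \notin chain3)
      && all (fun e => all (fun f => ~~ conflict e f t) chain3) chain3].

(** On at most eleven vertices the target is the value of [third_bound], so a node with fewer
    candidates can be closed. Each call consumes an open triple, hence the number of all triples is
    enough fuel. *)
Definition search_ok (m : nat) :=
  search (3 * m - 8) (size (triples m)) chain3 (open_triples m).

Lemma search_ok_small m : 7 <= m <= 11 -> search_ok m.
Proof.
have /allP ok : all search_ok (iota 7 5) by vm_compute.
by move=> m711; apply: ok; rewrite mem_iota; lia.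
Qed.

(** * Soundness of the search *)

Section SearchSound.
Variables (V : finType) (x0 : V) (l : seq V) (A : {set V}) (H : {set {set V}}).
Hypotheses (ul : uniq l) (lA : A =i l) (tH : three_graph A H) (PH : P_free H).

Definition tset (t : triple) : {set V} :=
  let: (a, b, c) := t in [set nth x0 l a; nth x0 l b; nth x0 l c].

Definition valid (t : triple) := let: (a, b, c) := t in [&& a < b, b < c & c < size l].

Lemma nth_neq i j : i < size l -> j < size l -> (nth x0 l i == nth x0 l j) = (i == j).
Proof. by move=> il jl; rewrite nth_uniq. Qed.

Lemma mem_tset i t : i < size l -> valid t -> (nth x0 l i \in tset t) = mem3 i t.
Proof.
case: t => [[a b] c] il /and3P[ab bc cl]; have bl := ltn_trans bc cl.
have al := ltn_trans ab bl.
by rewrite !inE !nth_neq // -orbA.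
Qed.

Lemma meet_tset g t : valid t ->
  meet (tset t) g = (nth x0 l t.1.1 \in g) + (nth x0 l t.1.2 \in g) + (nth x0 l t.2 \in g).
Proof.
case: t => [[a b] c] /= /and3P[ab bc cl].
have bl := ltn_trans bc cl; have al := ltn_trans ab bl.
by rewrite meet_set3 // nth_neq //; lia.
Qed.

Lemma meet3E s t : valid s -> valid t -> meet (tset s) (tset t) = meet3 s t.
Proof.
move=> vs vt; rewrite meet_tset //; case: s vs => [[a b] c] /= /and3P[ab bc cl].
have bl := ltn_trans bc cl; have al := ltn_trans ab bl.
by rewrite !mem_tset.
Qed.

Lemma mem_triples m a b c : ((a, b, c) \in triples m) = (a < b < c) && (c < m).
Proof.
apply/allpairsPdep/idP => /= [[k [[i j] [+ + [-> -> ->]]]]|/andP[/andP[ab bc] cm]].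
  rewrite mem_iota /= add0n => km /allpairsPdep[j' [i' []]].
  by rewrite !mem_iota /= !add0n => jk ij [-> ->]; rewrite ij jk.
exists c, (a, b); split=> //; first by rewrite mem_iota.
by apply/allpairsPdep; exists b, a; rewrite !mem_iota.
Qed.

Lemma validE t : valid t = (t \in triples (size l)).
Proof. by case: t => [[a b] c]; rewrite mem_triples /= andbA. Qed.

Lemma edge_tset h : h \in H -> exists2 t, valid t & h = tset t.
Proof.
move=> /tH [/card3P[x [y [z [-> xy xz yz]]]] /subsetP sub].
have idx u : u \in [set x; y; z] -> index u l < size l /\ nth x0 l (index u l) = u.
  by move=> /sub; rewrite lA => ul'; rewrite index_mem nth_index.
have [|xl xE] := idx x; first by rewrite !inE eqxx.
have [|yl yE] := idx y; first by rewrite !inE eqxx orbT.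
have [|zl zE] := idx z; first by rewrite !inE eqxx orbT.
have ne u v : u != v -> nth x0 l (index u l) = u -> nth x0 l (index v l) = v ->
    index u l <> index v l by move=> /eqP uv uE vE e; apply: uv; rewrite -uE -vE e.
have := ne _ _ xy xE yE; have := ne _ _ xz xE zE; have := ne _ _ yz yE zE.
move: (index x l) (index y l) (index z l) xl yl zl xE yE zE.
move=> i j k il jl kl iE jE kE jk ik ij.
have S p q r : p < q < r -> r < size l -> exists2 t, valid t &
    [set nth x0 l p; nth x0 l q; nth x0 l r] = tset t.
  by move=> /andP[pq qr] rl; exists (p, q, r) => //=; rewrite pq qr.
rewrite -iE -jE -kE.
(* [C] and [R] exchange neighbours; sorting the three indices takes at most three exchanges. *)
have C p q r : [set p; q; r] = [set q; p; r] :> {set V} by rewrite (setUC [set p]).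
have R p q r : [set p; q; r] = [set p; r; q] :> {set V} by rewrite setUAC.
case: (ltngtP i j) => [lij|lji|]; last by [].
  case: (ltngtP j k) => [ljk|lkj|]; last by [].
    by apply: S; rewrite ?lij.
  rewrite R; case: (ltngtP i k) => [lik|lki|]; last by [].
    by apply: S; rewrite ?lik.
  by rewrite C; apply: S; rewrite ?lki.
rewrite C; case: (ltngtP i k) => [lik|lki|]; last by [].
  by apply: S; rewrite ?lji.
rewrite R; case: (ltngtP j k) => [ljk|lkj|]; last by [].
  by apply: S; rewrite ?ljk.
by rewrite C; apply: S; rewrite ?lkj.
Qed.

Lemma conflict_edges e f g : valid e -> valid f -> valid g ->
  tset e \in H -> tset f \in H -> tset g \in H -> ~~ conflict e f g.
Proof.
move=> ve vf vg eH fH gH.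
have C e' f' g' : valid e' -> valid f' -> valid g' ->
    tset e' \in H -> tset f' \in H -> tset g' \in H -> ~~ is_path e' f' g'.
  move=> v1 v2 v3 h1 h2 h3; apply/negP; rewrite /is_path -!meet3E //.
  by case/and3P=> /eqP a /eqP b /eqP c; exact: (PH h1 h2 h3).
by rewrite /conflict !negb_or !C.
Qed.

(** The invariant is that [chosen] lies in [H] and [H] in [chosen ++ open]. At each node only the
    branch that agrees with [H] on the first open triple is followed. A triple discarded on adding
    [g] would form a loose path with [g] and a chosen triple. *)
Lemma search_sound target fuel chosen open :
  all valid chosen -> all (fun t => tset t \in H) chosen ->
  (forall t, valid t -> tset t \in H -> t \in chosen ++ open) ->
  all valid open ->
  search target fuel chosen open ->
  [\/ #|H| < target, forall t, valid t -> tset t \in H -> in_comet t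
    | forall t, valid t -> tset t \in H -> in_K6 t].
Proof.
elim: fuel chosen open => [|fuel IH] chosen open vc cH cov vo /=.
all: case: ifPn => [lt _|_].
1,3: apply: Or31; apply: leq_ltn_trans lt; rewrite -(size_map tset) cardE.
1,2: apply: uniq_leq_size (enum_uniq _) _ => h; rewrite mem_enum => hH.
1,2: have [t vt ht] := edge_tset hH; rewrite ht map_f // cov // -ht //.
all: case: ifPn => [/allP co _|_].
1,3: by apply: Or32 => t vt /(cov _ vt)/co.
all: case: ifPn => [/allP co _|_] //.
1,2: by apply: Or33 => t vt /(cov _ vt)/co.
case: open cov vo => // g open' cov /= /andP[vg vo].
case: ifPn => // s1 s2.
have [gH|gH] := boolP (tset g \in H).
  apply: IH s2 => /=; rewrite ?gH ?vg //.
    move=> t vt tH'; have := cov t vt tH'; rewrite !(mem_cat, inE, mem_filter).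
    case: eqP => //= _; case: (t \in chosen) => //= ->.
    rewrite andbT; apply/allP => f fc; apply: conflict_edges => //.
      exact: (allP vc).
    exact: (allP cH).
  by apply/allP=> t; rewrite mem_filter => /andP[_ /(allP vo)].
apply: IH s1 => // t vt tH'; have := cov t vt tH'.
rewrite !mem_cat inE; case: eqP => [tg|//]; by rewrite -tg tH' in gH.
Qed.

End SearchSound.

Section SmallChain.
Variables (V : finType) (A : {set V}) (H : {set {set V}}).
Hypotheses (tH : three_graph A H) (PH : P_free H).
Variables a b c d e f : V.
Hypotheses (us : uniq [:: a; b; c; d; e; f]) (sA : all (mem A) [:: a; b; c; d; e; f]).
Hypotheses (abc : [set a; b; c] \in H) (bcd : [set b; c; d] \in H)
  (def : [set d; e; f] \in H).

Lemma small_chain : 7 <= #|A| <= 11 ->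
  [\/ #|H| < 3 * #|A| - 8, comet_like A H | K6_like A H].
Proof.
move=> A711; pose s := [:: a; b; c; d; e; f].
(* The chain is listed first, so that the numbers 0 to 5 of the search are [a] to [f]. *)
pose l := s ++ [seq x <- enum A | x \notin s].
have ul : uniq l.
  rewrite cat_uniq us filter_uniq ?enum_uniq // andbT.
  by apply/hasPn=> x; rewrite mem_filter => /andP[].
have lA : A =i l.
  move=> x; rewrite mem_cat mem_filter mem_enum; case: (boolP (x \in s)) => //=.
  by move=> /(allP sA) /= ->.
have sl : size l = #|A| by rewrite -(card_uniqP ul); apply: eq_card => x.
have l6 : 6 < size l by rewrite sl; case/andP: A711.
have nl i : i < 6 -> nth a l i = nth a s i by move=> i6; rewrite nth_cat i6.
have nlt u : u < size l -> (nth a l u \in s) = (u < 6).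
  move=> ul'; rewrite nth_cat; case: ltnP => u6; first by rewrite mem_nth.
  apply/negbTE; have := mem_nth a (_ : u - size s < size [seq x <- enum A | x \notin s]).
  rewrite mem_filter => /(_ _)/andP[] //.
  by move: ul' u6; rewrite /l size_cat /s /=; lia.
clearbody l.
have cH : all (fun t => tset a l t \in H) chain3.
  by rewrite /= !nl // abc bcd def.
have vc : all (valid l) chain3 by rewrite /= !(ltn_trans _ l6).
have := search_ok_small A711; rewrite /search_ok -sl => ok.
have := search_sound ul lA tH PH vc cH _ _ ok; case.
- move=> t vt tH0; rewrite mem_cat; have [//|tc] := boolP (t \in chain3).
  rewrite mem_filter tc orFb andTb; apply/andP; split.
    apply/allP=> x xc; apply/allP=> y yc; apply: (conflict_edges ul PH) => //.
    + exact: (allP vc _ xc).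
    + exact: (allP vc _ yc).
    + exact: (allP cH _ xc).
    + exact: (allP cH _ yc).
    + exact: tH0.
  rewrite validE in vt; have cs : core_size t \in [:: 1; 2; 3; 0].
    by rewrite /core_size; do 3 case: (_ < 6).
  by apply/flattenP; exists [seq t' <- triples (size l) | core_size t' == core_size t];
    [apply: (map_f (fun i => [seq t' <- triples (size l) | core_size t' == i]))
    | rewrite mem_filter eqxx].
- apply/allP=> t; rewrite mem_filter => /andP[_ /flattenP[_ /mapP[i _ ->]]].
  by rewrite mem_filter validE => /andP[].
- by rewrite sl => ?; apply: Or31.
- move=> co; apply: Or32; exists [set a; b; c; d], d; split.
  + by apply/subsetP=> x; rewrite !inE -!orbA => /or4P[] /eqP->; apply: (allP sA); rewrite !inE eqxx ?orbT.
  + move: us; rewrite /= !inE !negb_or => /and3P[/and5P[ab ac ad _ _] /and4P[bc bd _ _] /andP[/and3P[cd _ _] _]].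
    by rewrite setUC cardsU1 card_set3 // !inE !negb_or !(eq_sym d) ad bd cd.
  + by rewrite !inE eqxx !orbT.
  + move=> h hH; have [t vt hE] := edge_tset a lA tH hH.
    rewrite hE in hH *; have /orP[/andP[/eqP m0 m3]|/allP t4] := co t vt hH.
      right; apply/setP=> x; rewrite !inE.
      have v012 : valid l (0, 1, 2) by rewrite /= !(ltn_trans _ l6).
      have m0' : meet (tset a l t) [set a; b; c] = 0.
        by rewrite -m0 -(meet3E a ul vt v012) /= !nl.
      have dt : d \in tset a l t.
        by rewrite -[d]/(nth a s 3) -nl // mem_tset // (ltn_trans _ l6).
      case: (eqVneq x d) => [->|_]; first by rewrite dt orbT.
      rewrite orbF; apply/negbTE/negP=> /andP[xt xabc].
      by have := meet0_notin m0' xt; rewrite !inE xabc.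
    left; move: vt t4; case: t {hE hH} => [[i j] k] vt t4.
    have n4 u : u < 4 -> nth a l u \in [set a; b; c; d].
      by case: u => [|[|[|[|]]]] //= _; rewrite nl //=; rewrite !inE eqxx ?orbT.
    apply/subsetP=> x; rewrite /tset [x \in _]inE [x \in _]inE !in_set1 -orbA.
    by case/or3P=> /eqP->; rewrite n4 // t4 // !inE eqxx ?orbT.
- move=> co; apply: Or33; exists [set x in s]; split.
  + by apply/subsetP=> x; rewrite inE => /(allP sA).
  + by rewrite cardsE (card_uniqP us).
  + move=> h hH; have [t vt hE] := edge_tset a lA tH hH.
    rewrite hE in hH *; have := co t vt hH.
    rewrite /in_K6 !inE; move: vt; case: t {hE hH} => [[i j] k] vt.
    rewrite /core_size /= => cs.
    move: vt => /= /and3P[ij jk kl].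
    have jl := ltn_trans jk kl; have il := ltn_trans ij jl.
    case/orP: cs => cs; last first.
      left; apply/subsetP=> x xt; rewrite in_set; move: xt.
      rewrite [x \in _]inE [x \in _]inE !in_set1 -orbA.
      by case/or3P=> /eqP->; rewrite nlt //; lia.
    right; apply/eqP; rewrite cards_eq0; apply/eqP/setP=> x.
    rewrite in_setI in_set in_set0; apply/negbTE/negP=> /andP[].
    rewrite [x \in _]inE [x \in _]inE !in_set1 -orbA.
    by case/or3P=> /eqP->; rewrite nlt //; lia.
Qed.
End SmallChain.

(** * Intersecting 3-graphs *)

Section Pairs.
Variable V : finType.
Implicit Types (u v w x y z : V) (e f g p q : {set V}) (U : {set V}).
Implicit Types (A B : {set {set V}}).

Definition pairs_in U A := forall p, p \in A -> #|p| = 2 /\ p \subset U.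

Lemma pairE p u : #|p| = 2 -> u \in p -> exists2 w, u != w & p = [set u; w].
Proof.
move=> /eqP/cards2P[a [b [ab ->]]]; rewrite !inE => /orP[]/eqP->.
  by exists b.
by exists a; [rewrite eq_sym | rewrite setUC].
Qed.

Lemma card_sub_imset (T : finType) (F : T -> {set V}) (W : {set T}) A :
  (forall p, p \in A -> exists2 w, w \in W & p = F w) -> #|A| <= #|W|.
Proof.
move=> AF; apply: leq_trans (leq_imset_card F W); apply: subset_leq_card.
by apply/subsetP=> p /AF[w wW ->]; apply: imset_f.
Qed.

Lemma card_pairs_star U A u : pairs_in U A -> (forall p, p \in A -> u \in p) ->
  #|A| <= #|U|.-1.
Proof.
move=> pA uA; have [->|/set0Pn[p0 p0A]] := eqVneq A set0; first by rewrite cards0.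
have uU : u \in U by apply: subsetP (uA _ p0A); case: (pA _ p0A).
apply: leq_trans (_ : #|U :\ u| <= _); last by rewrite (cardsD1 u U) uU.
apply: (@card_sub_imset _ (fun w => [set u; w])) => p pA'.
have [p2 pU] := pA _ pA'; have [w uw pE] := pairE p2 (uA _ pA').
exists w => //; rewrite !inE eq_sym uw; apply: (subsetP pU).
by rewrite pE !inE eqxx orbT.
Qed.

Lemma pairs_inS U U' A A' : A' \subset A -> U \subset U' -> pairs_in U A ->
  pairs_in U' A'.
Proof.
by move=> /subsetP sA sU pA p /sA/pA[p2 pU]; split; rewrite ?(subset_trans pU).
Qed.

(** With [u] and [v] the elements of [e]: at most [#|U| - 1] pairs contain [u], and at most
    [#|U| - 2] further ones contain [v]. *)
Lemma card_pairs_meet U A e : pairs_in U A -> #|e| = 2 -> e \subset U ->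
  (forall p, p \in A -> 0 < meet p e) -> #|A| <= #|U|.*2 - 3.
Proof.
move=> pA /eqP/cards2P[u [v [uv ->]]]; rewrite subUset !sub1set => /andP[uU vU] m.
rewrite -(cardsID [set p : {set V} | u \in p] A).
have pu : #|A :&: [set p : {set V} | u \in p]| <= #|U|.-1.
  apply: (@card_pairs_star _ _ u); first exact: pairs_inS (subsetIl _ _) _ pA.
  by move=> p; rewrite !inE => /andP[].
have pv : #|A :\: [set p : {set V} | u \in p]| <= #|U :\ u|.-1.
  apply: (@card_pairs_star _ _ v).
    move=> p; rewrite !inE => /andP[up /pA[p2 pU]]; split=> //.
    by rewrite subsetD1 pU.
  move=> p; rewrite !inE => /andP[up pA']; have [x [xp]] := meet_gt0P (m _ pA').
  by rewrite !inE => /orP[]/eqP xE; rewrite xE in xp; first by rewrite xp in up.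
have U2 : 1 < #|U| by rewrite (cardD1 u) (cardD1 v) !inE uU vU eq_sym uv.
have := cardsD1 u U; rewrite uU; nlia.
Qed.

(** A Hilton-Milner type statement for two cross-intersecting families of pairs, to be applied to
    the links of two vertices. The bound is reached by a single pair against the [2 #|U| - 3] pairs
    meeting it, and by two full stars at one vertex. With five points, configurations inside a
    triangle or on four points are strictly smaller. *)
Lemma cross_pairs U A B : 5 <= #|U| -> pairs_in U A -> pairs_in U B ->
  A != set0 -> B != set0 ->
  (forall p q, p \in A -> q \in B -> 0 < meet p q) ->
  #|A| + #|B| <= #|U|.*2 - 2 /\
  [\/ exists e, A = [set e], exists e, B = [set e],
      exists z, forall p, p \in A :|: B -> z \in p
    | #|A| + #|B| < #|U|.*2 - 2].
Proof.
move=> U5.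
wlog leBA : A B / #|B| <= #|A|.
  move=> W; have [|/ltnW] := leqP #|B| #|A|; first exact: W.
  move=> le pA pB A0 B0 m; have [|le2 c] := W B A le pB pA B0 A0.
    by move=> p q pB' qA'; rewrite meetC m.
  rewrite addnC; split=> //; case: c; [by constructor 2|by constructor 1| |by constructor 4].
  by move=> zc; constructor 3; rewrite setUC.
move=> pA pB A0 B0 m.
have [B1|B1] := leqP #|B| 1.
  have /cards1P[e eB] : #|B| == 1 by rewrite eqn_leq B1 card_gt0.
  have [e2 eU] : #|e| = 2 /\ e \subset U by apply: pB; rewrite eB inE.
  have : #|A| <= #|U|.*2 - 3.
    by apply: (card_pairs_meet pA e2 eU) => p pA'; apply: m; rewrite // eB inE.
  rewrite {1}eB cards1 => leA; split; first nlia.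
  by constructor 2; exists e.
suff lt : (exists z, forall p, p \in A :|: B -> z \in p) /\ #|A| + #|B| <= #|U|.*2 - 2
    \/ #|A| + #|B| < #|U|.*2 - 2.
  by case: lt => [[cz lt]|lt]; (split; first nlia); [constructor 3 | constructor 4].
have [/existsP[e /existsP[f /and3P[eB fB /eqP ef]]]|nex] :=
  boolP [exists e, exists f, [&& e \in B, f \in B & meet e f == 0]].
  (* Two disjoint pairs in [B] confine [A] to the four pairs joining them, and if all four occur,
     [B] has no third member. Either way there are at most six pairs, fewer than 2 * 5 - 2. *)
  right; have [e2 eU] := pB _ eB; have [f2 fU] := pB _ fB.
  pose F := (fun z : V * V => [set z.1; z.2]) @: setX e f.
  have AF : A \subset F.
    apply/subsetP=> p pA'; have [p2 _] := pA _ pA'.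
    have [x [xp xe]] := meet_gt0P (m _ _ pA' eB).
    have [y [yp yf]] := meet_gt0P (m _ _ pA' fB).
    have xy : x != y by apply: contraTneq yf => <-; apply: meet0_notin ef xe.
    apply/imsetP; exists (x, y); first by rewrite inE /= xe yf.
    apply/eqP.
    by rewrite eq_sym eqEcard p2 cards2 xy subUset !sub1set xp yp.
  have F4 : #|F| <= 4.
    by apply: leq_trans (leq_imset_card _ _) _; rewrite cardsX e2 f2.
  have := subset_leq_card AF; have [A4|A4] := leqP 4 #|A|; last by nlia.
  have AE : A = F by apply/eqP; rewrite eqEcard AF (leq_trans F4).
  suff : #|B| <= #|[set e; f]| by have := cards2 e f; case: (e != f); nlia.
  apply: subset_leq_card; apply/subsetP=> b bB; have [b2 _] := pB _ bB.
  rewrite !inE; apply/orP; have [eb|/subsetPn[x xe xb]] := boolP (e \subset b).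
    by left; rewrite eq_sym eqEcard eb b2 e2.
  right; rewrite eq_sym eqEcard b2 f2 andbT; apply/subsetP=> y yf.
  have : [set x; y] \in A by rewrite AE; apply/imsetP; exists (x, y); rewrite ?inE /= ?xe ?yf.
  move=> /m/(_ bB)/meet_gt0P[z []]; rewrite !inE => /orP[]/eqP-> //.
  by rewrite (negbTE xb).
have mB e f : e \in B -> f \in B -> 0 < meet e f.
  move=> eB fB; rewrite lt0n; apply: contra nex => ef.
  by apply/existsP; exists e; apply/existsP; exists f; rewrite eB fB.
have /card_gt1P[e [f [eB fB ef]]] := B1.
have [e2 eU] := pB _ eB; have [f2 fU] := pB _ fB.
(* Now [B] is intersecting and has two members [uv] and [uw]; a pair that avoids [u] and meets both
   is [vw]. *)
have [u [ue uf]] := meet_gt0P (mB _ _ eB fB).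
have [v uv eE] := pairE e2 ue; have [w uw fE] := pairE f2 uf.
have vw : v != w by apply: contraNneq ef => vw; rewrite eE fE vw.
have Au p : p \in A -> u \notin p -> p = [set v; w].
  move=> pA' up; have [p2 _] := pA _ pA'.
  have [x [xp]] := meet_gt0P (m _ _ pA' eB); rewrite eE !inE.
  move=> /orP[]/eqP xE; rewrite xE in xp; first by rewrite xp in up.
  have [y [yp]] := meet_gt0P (m _ _ pA' fB); rewrite fE !inE.
  move=> /orP[]/eqP yE; rewrite yE in yp; first by rewrite yp in up.
  by apply/eqP; rewrite eq_sym eqEcard p2 cards2 vw subUset !sub1set xp yp.
have Bu q : q \in B -> u \notin q -> q = [set v; w].
  move=> qB uq; have [q2 _] := pB _ qB.
  have [x [xq]] := meet_gt0P (mB _ _ qB eB); rewrite eE !inE.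
  move=> /orP[]/eqP xE; rewrite xE in xq; first by rewrite xq in uq.
  have [y [yq]] := meet_gt0P (mB _ _ qB fB); rewrite fE !inE.
  move=> /orP[]/eqP yE; rewrite yE in yq; first by rewrite yq in uq.
  by apply/eqP; rewrite eq_sym eqEcard q2 cards2 vw subUset !sub1set xq yq.
have uU : u \in U by apply: (subsetP eU).
have [vwA|vwA] := boolP ([set v; w] \in A); last first.
  have uA p : p \in A -> u \in p.
    by move=> pA'; apply: contraNT vwA => /(Au _ pA') <-.
  have leA := card_pairs_star pA uA.
  have [lt|ge] := ltnP (#|A| + #|B|) (#|U|.*2 - 2); [by right | left].
  split; last by nlia.
  exists u => p; rewrite inE => /orP[/uA//|pB'].
  (* Equality needs every pair at [u] to be in [A], and a pair avoiding [u] cannot meet all of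
     them. *)
  have AE : A = [set [set u; x] | x in U :\ u].
    apply/eqP; rewrite eqEcard; apply/andP; split.
      apply/subsetP=> q qA; have [q2 qU] := pA _ qA.
      have [x ux qE] := pairE q2 (uA _ qA); apply/imsetP; exists x => //.
      by rewrite !inE eq_sym ux (subsetP qU) // qE !inE eqxx orbT.
    apply: leq_trans (leq_imset_card _ _) _; have := cardsD1 u U; rewrite uU; nlia.
  apply/negPn/negP=> up; have [p2 pU] := pB _ pB'.
  have : U :\ u \subset p.
    apply/subsetP=> x xU; have : [set u; x] \in A by rewrite AE; apply/imsetP; exists x.
    by move=> /m/(_ pB')/meet_gt0P[y []]; rewrite !inE => /orP[]/eqP-> // /(negP up).
  move/subset_leq_card; rewrite p2; have := cardsD1 u U; rewrite uU; nlia.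
(* With [vw] in [A], the family [B] lies in the triangle [uvw]; if [vw] is in [B] as well, so does
   [A]. *)
right; have leA : #|A| <= #|U|.
  rewrite -(cardsID [set p : {set V} | u \in p] A).
  have : #|A :&: [set p : {set V} | u \in p]| <= #|U|.-1.
    apply: (@card_pairs_star _ _ u); first exact: pairs_inS (subsetIl _ _) _ pA.
    by move=> p; rewrite !inE => /andP[].
  have : #|A :\: [set p : {set V} | u \in p]| <= #|[set [set v; w]]|.
    apply: subset_leq_card; apply/subsetP=> p; rewrite !inE => /andP[up pA'].
    by apply/eqP; apply: Au.
  rewrite cards1; have : 0 < #|U| by apply/card_gt0P; exists u.
  nlia.
have B3 : B \subset [set e; f; [set v; w]].
  apply/subsetP=> q qB; rewrite !inE; have [uq|uq] := boolP (u \in q); last first.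
    by rewrite (Bu _ qB uq) eqxx orbT.
  have [q2 _] := pB _ qB; have [x ux qE] := pairE q2 uq.
  have [y []] := meet_gt0P (m _ _ vwA qB); rewrite qE !inE => /orP[]/eqP->.
    by rewrite eq_sym (negbTE uv) /= => /eqP <-; rewrite eE eqxx.
  by rewrite eq_sym (negbTE uw) /= => /eqP <-; rewrite fE eqxx orbT.
have [vwB|vwB] := boolP ([set v; w] \in B); last first.
  suff : #|B| <= #|[set e; f]| by rewrite cards2 ef; nlia.
  apply: subset_leq_card; apply/subsetP=> q qB; have := subsetP B3 _ qB.
  rewrite !inE => /orP[//|/eqP qE]; by rewrite -qE qB in vwB.
have A3 : A \subset [set e; f; [set v; w]].
  apply/subsetP=> q qA; rewrite !inE; have [uq|uq] := boolP (u \in q); last first.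
    by rewrite (Au _ qA uq) eqxx orbT.
  have [q2 _] := pA _ qA; have [x ux qE] := pairE q2 uq.
  have [y []] := meet_gt0P (m _ _ qA vwB); rewrite qE !inE => /orP[]/eqP->.
    by rewrite (negbTE uv) (negbTE uw).
  by case/orP=> /eqP->; rewrite ?eE ?fE eqxx ?orbT.
have c3 (S : {set {set V}}) : S \subset [set e; f; [set v; w]] -> #|S| <= 3.
  move=> /subset_leq_card le; apply: leq_trans le _.
  by rewrite setUC cardsU1 cards2; case: (_ \notin _); case: (_ != _).
have := c3 _ A3; have := c3 _ B3; nlia.
Qed.

End Pairs.

Section Intersecting.
Variable V : finType.
Implicit Types (u v w x y z : V) (e f g : {set V}) (A : {set V}).
Implicit Types (H : {set {set V}}).

Definition G1_like H := exists x y z v,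
  uniq [:: x; y; z; v] /\ H \subset G1_edges x y z v.

Definition G2_like H := exists x y z,
  uniq [:: x; y; z] /\ H \subset G2_edges x y z.

Definition edges_at H x : {set {set V}} := [set e in H | x \in e].
Definition edges_at2 H x y : {set {set V}} := [set e in H | (x \in e) && (y \in e)].
Definition edges_only H x y : {set {set V}} := [set e in H | (x \in e) && (y \notin e)].

Lemma edge_third x y e : #|e| = 3 -> x != y -> x \in e -> y \in e ->
  exists2 w, e = [set x; y; w] & (w != x) && (w != y).
Proof.
move=> e3 xy xe ye.
have /card_gt0P[w] : 0 < #|e :\: [set x; y]|.
  by rewrite cardsD e3 (setIidPr _) ?cards2 ?xy // subUset !sub1set xe.
rewrite !inE negb_or => /andP[/andP[wx wy] we]; exists w; rewrite ?wx //.
by apply: set3_eq; rewrite // eq_sym.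
Qed.

Lemma card_edges_at2 A H x y (W : {set V}) : three_graph A H -> x != y ->
  (forall w, [set x; y; w] \in H -> w != x -> w != y -> w \in W) ->
  #|edges_at2 H x y| <= #|W|.
Proof.
move=> tH xy HW; apply: (@card_sub_imset _ _ (fun w => [set x; y; w])) => e.
rewrite inE => /andP[eH /andP[xe ye]].
have [w eE /andP[wx wy]] := edge_third (tH _ eH).1 xy xe ye.
by exists w; rewrite // HW // -eE.
Qed.

Lemma codegree_le A H x y : three_graph A H -> x != y -> x \in A -> y \in A ->
  #|edges_at2 H x y| <= #|A| - 2.
Proof.
move=> tH xy xA yA; apply: leq_trans (_ : #|A :\ x :\ y| <= _).
  apply: (card_edges_at2 tH xy) => w wH wx wy; rewrite !inE wx wy /=.
  by apply: (subsetP (tH _ wH).2); rewrite !inE eqxx orbT.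
rewrite (cardsD1 x A) xA (cardsD1 y (A :\ x)) !inE yA eq_sym xy; nlia.
Qed.

(** The link of [x] restricted to the edges avoiding [y]. In an intersecting [H] the links for [x],
    [y] and for [y], [x] are cross-intersecting. *)
Definition link H x y : {set {set V}} := [set e :\ x | e in edges_only H x y].

Lemma card_link H x y : #|link H x y| = #|edges_only H x y|.
Proof.
apply: card_in_imset => e f; rewrite !inE => /and3P[_ xe _] /and3P[_ xf _] ef.
by rewrite -(setD1K xe) -(setD1K xf) ef.
Qed.

Lemma pairs_in_link A H x y : three_graph A H ->
  pairs_in (A :\: [set x; y]) (link H x y).
Proof.
move=> tH p /imsetP[e]; rewrite inE => /and3P[eH xe ye] ->; have [e3 eA] := tH _ eH.
split; first by have := cardsD1 x e; rewrite xe e3 => -[].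
apply/subsetP=> z; rewrite !inE negb_or => /andP[-> ze] /=.
by rewrite (subsetP eA) // andbT; apply: contraNneq ye => <-.
Qed.

Lemma link_cross H x y p q : intersecting H ->
  p \in link H x y -> q \in link H y x -> 0 < meet p q.
Proof.
move=> iH /imsetP[e]; rewrite inE => /and3P[eH xe ye] -> /imsetP[f].
rewrite inE => /and3P[fH yf xf] ->.
have [z [ze zf]] := meet_gt0P (iH _ _ eH fH).
apply: (@meet_gt0 _ _ _ z); rewrite !inE ?ze ?zf andbT.
  by apply: contraNneq xf => <-.
by apply: contraNneq ye => <-.
Qed.

Lemma card_at_split H x y :
  #|H| = #|edges_at2 H x y| + #|edges_only H x y| + #|edges_only H y x| +
         #|[set e in H | (x \notin e) && (y \notin e)]|.
Proof.
rewrite -(cardsID [set e : {set V} | x \in e] H).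
rewrite -(cardsID [set e : {set V} | y \in e] (H :&: _)).
rewrite -(cardsID [set e : {set V} | y \in e] (H :\: _)).
rewrite addnA; congr (_ + _ + _ + _); apply: eq_card => e; rewrite !inE.
all: by case: (e \in H); case: (x \in e); case: (y \in e).
Qed.

(** At most [#|A| - 2] edges contain both [x] and [y]; the others are counted by two
    cross-intersecting links on [#|A| - 2] vertices, at most [2 (#|A| - 2) - 2] in all. Of the
    extremal cases of [cross_pairs], a single pair leads to G_1 and a common vertex [z] to G_2 on
    [x], [y], [z]. *)
Lemma two_cover A H x y : three_graph A H -> intersecting H -> 7 <= #|A| ->
  (forall e, e \in H -> (x \in e) || (y \in e)) ->
  star_like H \/ #|H| <= 3 * #|A| - 8 /\
    [\/ G1_like H, G2_like H | #|H| < 3 * #|A| - 8].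
Proof.
move=> tH iH A7 cov.
have [H1|X0] := eqVneq (edges_only H x y) set0.
  left; exists y => e eH; have /orP[xe|//] := cov _ eH.
  apply/negPn/negP=> ye; have : e \in edges_only H x y by rewrite inE eH xe ye.
  by rewrite H1 inE.
have [H1|Y0] := eqVneq (edges_only H y x) set0.
  left; exists x => e eH; have /orP[//|ye] := cov _ eH.
  apply/negPn/negP=> xe; have : e \in edges_only H y x by rewrite inE eH xe ye.
  by rewrite H1 inE.
have [ex /[!inE] /and3P[exH xex yex]] := set0Pn _ X0.
have [ey /[!inE] /and3P[eyH yey xey]] := set0Pn _ Y0.
have xy : x != y by apply: contraNneq yex => <-.
have xA : x \in A by apply: (subsetP (tH _ exH).2).
have yA : y \in A by apply: (subsetP (tH _ eyH).2).
have U2 : #|A :\: [set x; y]| = #|A| - 2.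
  by rewrite cardsD (setIidPr _) ?cards2 ?xy // subUset !sub1set xA.
have := @cross_pairs _ (A :\: [set x; y]) (link H x y) (link H y x).
rewrite U2 => /(_ _ _ _ _ _ _) []; first by nlia.
- exact: pairs_in_link.
- by rewrite setUC; apply: pairs_in_link.
- by rewrite -card_gt0 card_link card_gt0.
- by rewrite -card_gt0 card_link card_gt0.
- by move=> p q; apply: link_cross.
rewrite !card_link => le C; right.
have sH := card_at_split H x y.
have c2 := codegree_le tH xy xA yA.
have r0 : #|[set e in H | (x \notin e) && (y \notin e)]| = 0.
  apply: eq_card0 => e; rewrite !inE; apply/negP=> /and3P[eH xe ye].
  by have := cov _ eH; rewrite (negbTE xe) (negbTE ye).
split; first by nlia.
(* Only one edge avoids [b]: it is the triple of G_1, and [b] is the vertex common to all other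
   edges. *)
have G1 a b p : a != b -> (forall e, e \in H -> (a \in e) || (b \in e)) ->
    edges_only H a b != set0 -> link H a b = [set p] -> G1_like H.
  move=> ab cov' /set0Pn[e0 e0X] lE.
  have e0l : e0 :\ a \in link H a b by apply: imset_f.
  have [e0H ae0 be0] : [/\ e0 \in H, a \in e0 & b \notin e0].
    by move: e0X; rewrite inE => /and3P[].
  have p2 : #|p| = 2.
    by have [] := @pairs_in_link A H a b tH p _ => //; rewrite lE inE.
  have e0p : e0 :\ a = p by apply/set1P; rewrite -lE.
  have /eqP/cards2P[u [v [uv pE]]] := p2.
  have up : u \in p by rewrite pE !inE eqxx.
  have vp : v \in p by rewrite pE !inE eqxx orbT.
  move: (up) (vp); rewrite -e0p !inE => /andP[ua ue] /andP[va ve].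
  have e0E : e0 = [set a; u; v].
    by apply: set3_eq; rewrite ?(tH _ e0H).1 // eq_sym.
  exists a, u, v, b; split.
    rewrite /= !inE !negb_or uv ab eq_sym ua eq_sym va /=.
    by rewrite andbT; apply/andP; split; apply: contraNneq be0 => <-.
  apply/subsetP=> e eH; rewrite !inE; have [be|be] := boolP (b \in e).
    rewrite (tH _ eH).1 eqxx /=; apply/orP; right.
    by rewrite -e0E -card_gt0; apply: iH.
  apply/orP; left; rewrite -e0E; have := cov' _ eH; rewrite (negbTE be) orbF => ae.
  have : e :\ a \in link H a b by apply: imset_f; rewrite inE eH ae be.
  by rewrite lE inE -e0p => /eqP eE; rewrite -(setD1K ae) -(setD1K ae0) eE.
case: C => [[p lE]|[p lE]|[z zc]|lt].
- by apply: Or31; apply: (G1 x y p).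
- apply: Or31; apply: (G1 y x p) => //; first by rewrite eq_sym.
  by move=> e /cov; rewrite orbC.
- apply: Or32; have zl : z \in ex :\ x.
    by apply: zc; rewrite inE; apply/orP; left; apply: imset_f; rewrite inE exH xex.
  have zl' : z \in ey :\ y.
    by apply: zc; rewrite inE; apply/orP; right; apply: imset_f; rewrite inE eyH yey.
  move: zl zl'; rewrite !inE => /andP[zx _] /andP[zy _].
  have nz : [/\ x != y, x != z & y != z] by split; rewrite // eq_sym.
  case: nz => _ xz yz; exists x, y, z; split.
    by rewrite /= !inE negb_or xy xz yz.
  apply/subsetP=> e eH; rewrite !inE (tH _ eH).1 eqxx /=.
  rewrite setIC meet_set3 //; apply/orP.
  have [xe|xe] := boolP (x \in e); have [ye|ye] := boolP (y \in e).
  + have [ze|ze] := boolP (z \in e); last by right.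
    by left; apply/eqP; apply: set3_eq => //; case: (tH _ eH).
  + have /zc : e :\ x \in link H x y :|: link H y x.
      by rewrite inE; apply/orP; left; apply: imset_f; rewrite inE eH xe ye.
    by rewrite !inE => /andP[_ ->]; right.
  + have /zc : e :\ y \in link H x y :|: link H y x.
      by rewrite inE; apply/orP; right; apply: imset_f; rewrite inE eH ye xe.
    by rewrite !inE => /andP[_ ->]; right.
  + by have := cov _ eH; rewrite (negbTE xe) (negbTE ye).
- by apply: Or33; nlia.
Qed.

(** An edge avoiding [x] and [y] contains the third vertex of each edge through both, so codegrees
    are at most 3. An edge avoiding [x] bounds the degree of [x] by three codegrees. The cases are:
    some codegree 3, some codegree 2, none above 1. *)
Lemma no_two_cover A H : three_graph A H -> intersecting H -> 7 <= #|A| ->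
  (forall x y, exists e, [/\ e \in H, x \notin e & y \notin e]) ->
  #|H| < 3 * #|A| - 8.
Proof.
move=> tH iH A7 nc.
have thirdW x y f : x != y -> f \in H -> x \notin f -> y \notin f ->
    #|edges_at2 H x y| <= 3.
  move=> xy fH xf yf; rewrite -(tH _ fH).1; apply: (card_edges_at2 tH xy) => w wH _ _.
  have [z [zf]] := meet_gt0P (iH _ _ fH wH).
  rewrite !inE -orbA => /or3P[]/eqP zE; rewrite zE in zf => //.
    by rewrite zf in xf.
  by rewrite zf in yf.
have [/existsP[x /existsP[y /andP[xy d3]]]|n3] :=
  boolP [exists x, exists y, (x != y) && (3 <= #|edges_at2 H x y|)].
  (* An edge avoiding [x] and [y] contains all of [W], so it equals [W], and there is at most one.
     The total is 3 + (2 ([#|A|] - 2) - 2) + 1. *)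
  pose W := [set w in A | ([set x; y; w] \in H) && (w != x) && (w != y)].
  have W3 : 3 <= #|W|.
    apply: leq_trans d3 _; apply: (card_edges_at2 tH xy) => w wH wx wy.
    rewrite inE wH wx wy !andbT; apply: (subsetP (tH _ wH).2).
    by rewrite !inE eqxx orbT.
  have fW f : f \in H -> x \notin f -> y \notin f -> f = W.
    move=> fH xf yf; apply/eqP; rewrite eq_sym eqEcard (tH _ fH).1 W3 andbT.
    apply/subsetP=> w; rewrite inE => /andP[_ /andP[/andP[wH _] _]].
    have [z [zf]] := meet_gt0P (iH _ _ fH wH).
    rewrite !inE -orbA => /or3P[]/eqP zE; rewrite zE in zf => //.
      by rewrite zf in xf.
    by rewrite zf in yf.
  have r1 : #|[set e in H | (x \notin e) && (y \notin e)]| <= 1.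
    rewrite -(cards1 W); apply: subset_leq_card; apply/subsetP=> e.
    by rewrite !inE => /and3P[eH xe ye]; apply/eqP; apply: fW.
  have [f [fH xf yf]] := nc x y.
  have [z zW] : exists z, z \in W by apply/card_gt0P; nlia.
  (* The edge avoiding [b] and [z] is not [W], so it must contain [a]. *)
  have ne a b : (forall f, f \in H -> a \notin f -> b \notin f -> f = W) ->
      edges_only H a b != set0.
    move=> fW'; have [e [eH be ze]] := nc b z; apply/set0Pn; exists e.
    rewrite inE eH be andbT; apply/negPn/negP=> ae.
    by move: ze; rewrite (fW' _ eH) // zW.
  have xA : x \in A.
    have /set0Pn[e] := ne x y fW; rewrite inE => /and3P[eH xe _].
    exact: (subsetP (tH _ eH).2).
  have yA : y \in A.
    have /set0Pn[e] : edges_only H y x != set0 by apply: ne => g gH yg xg; apply: fW.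
    by rewrite inE => /and3P[eH ye _]; exact: (subsetP (tH _ eH).2).
  have U2 : #|A :\: [set x; y]| = #|A| - 2.
    by rewrite cardsD (setIidPr _) ?cards2 ?xy // subUset !sub1set xA.
  have := @cross_pairs _ (A :\: [set x; y]) (link H x y) (link H y x).
  rewrite U2 => /(_ _ _ _ _ _ _) []; first by nlia.
  - exact: pairs_in_link.
  - by rewrite setUC; apply: pairs_in_link.
  - by rewrite -card_gt0 card_link card_gt0 ne.
  - by rewrite -card_gt0 card_link card_gt0 ne // => g gH yg xg; apply: fW.
  - by move=> p q; apply: link_cross.
  rewrite !card_link => le _; have := card_at_split H x y.
  have := thirdW x y f xy fH xf yf; nlia.
have d2 x y : x != y -> #|edges_at2 H x y| <= 2.
  move=> xy; rewrite leqNgt; apply: contra n3 => d3.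
  by apply/existsP; exists x; apply/existsP; exists y; rewrite xy.
have degle k x : (forall y, x != y -> #|edges_at2 H x y| <= k) ->
    #|edges_at H x| <= 3 * k.
  move=> dk; have [f [fH xf _]] := nc x x.
  have [a [b [c [fE _ _ _]]]] := card3P (tH _ fH).1.
  have ne w : w \in f -> #|edges_at2 H x w| <= k.
    by move=> wf; apply: dk; apply: contraNneq xf => ->.
  apply: leq_trans (_ : #|edges_at2 H x a :|: edges_at2 H x b :|: edges_at2 H x c| <= _).
    apply: subset_leq_card; apply/subsetP=> e; rewrite !inE => /andP[eH xe].
    have [w [wf we]] := meet_gt0P (iH _ _ fH eH); rewrite eH xe /=.
    by move: wf; rewrite fE !inE -orbA => /or3P[]/eqP <-; rewrite we ?orbT.
  have := ne a; have := ne b; have := ne c; rewrite fE !inE !eqxx !orbT.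
  move=> /(_ isT) Hc /(_ isT) Hb /(_ isT) Ha.
  have := (leq_card_setU (edges_at2 H x a :|: edges_at2 H x b) (edges_at2 H x c)).1.
  have := (leq_card_setU (edges_at2 H x a) (edges_at2 H x b)).1.
  nlia.
have [/existsP[x /existsP[y /andP[xy dE]]]|n2] :=
  boolP [exists x, exists y, (x != y) && (2 <= #|edges_at2 H x y|)].
  have at_split a b : #|edges_at H a| = #|edges_at2 H a b| + #|edges_only H a b|.
    rewrite -(cardsID [set e : {set V} | b \in e] (edges_at H a)).
    by congr (_ + _); apply: eq_card => e; rewrite !inE; case: (e \in H); case: (a \in e); case: (b \in e).
  have := card_at_split H x y; have := at_split x y; have := at_split y x.
  have -> : edges_at2 H y x = edges_at2 H x y.
    by apply/setP=> e; rewrite !inE [(y \in e) && _]andbC.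
  have := degle 2 x (d2 x); have := degle 2 y (d2 y).
  (* Edges avoiding [x] and [y] pass through both third vertices [a] and [b], so there are at most
     two. With degrees at most 6 the total is 6 + 6 - 2 + 2 = 12, while [3 * #|A| - 8] is at least
     13. *)
  have /card_gt1P[e [f []]] := dE; rewrite !inE => /and3P[eH xe ye] /and3P[fH xf yf] ef.
  have [a eE /andP[ax ay]] := edge_third (tH _ eH).1 xy xe ye.
  have [b fE /andP[bx by_]] := edge_third (tH _ fH).1 xy xf yf.
  have ab : a != b by apply: contraNneq ef => ab; rewrite eE fE ab.
  have : #|[set e in H | (x \notin e) && (y \notin e)]| <= 2.
    apply: leq_trans (d2 a b ab); apply: subset_leq_card; apply/subsetP=> g.
    rewrite !inE => /and3P[gH xg yg]; rewrite gH /=.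
    have [u [ug]] := meet_gt0P (iH _ _ gH eH); rewrite eE !inE -orbA.
    have [v [vg]] := meet_gt0P (iH _ _ gH fH); rewrite fE !inE -orbA.
    case/or3P=> /eqP vE; rewrite vE in vg; [by rewrite vg in xg|by rewrite vg in yg|].
    case/or3P=> /eqP uE; rewrite uE in ug; [by rewrite ug in xg|by rewrite ug in yg|].
    by rewrite ug vg.
  have := d2 x y xy; nlia.
have [x0 [e [eH _ _]]] : exists x e, [/\ e \in H, x \notin e & x \notin e].
  have /card_gt0P[x _] : 0 < #|A| by nlia.
  by exists x; apply: nc.
have [a [b [c [eE _ _ _]]]] := card3P (tH _ eH).1.
have d3 x : #|edges_at H x| <= 3.
  apply: (degle 1) => y xy; rewrite leqNgt; apply: contra n2 => d2'.
  by apply/existsP; exists x; apply/existsP; exists y; rewrite xy.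
have : #|H| <= #|edges_at H a :|: edges_at H b :|: edges_at H c|.
  apply: subset_leq_card; apply/subsetP=> g gH; rewrite !inE gH /=.
  have [w [we wg]] := meet_gt0P (iH _ _ eH gH).
  by move: we; rewrite eE !inE -orbA => /or3P[]/eqP <-; rewrite wg ?orbT.
have := (leq_card_setU (edges_at H a :|: edges_at H b) (edges_at H c)).1.
have := (leq_card_setU (edges_at H a) (edges_at H b)).1.
have := d3 a; have := d3 b; have := d3 c; nlia.
Qed.

Lemma intersecting_cases A H : three_graph A H -> intersecting H -> 7 <= #|A| ->
  star_like H \/ #|H| <= 3 * #|A| - 8 /\
    [\/ G1_like H, G2_like H | #|H| < 3 * #|A| - 8].
Proof.
move=> tH iH A7.
have [/existsP[x /existsP[y /forall_inP c]]|nc] :=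
  boolP [exists x, exists y, [forall e in H, (x \in e) || (y \in e)]].
  exact: (two_cover tH iH A7 c).
have lt : #|H| < 3 * #|A| - 8.
  apply: (no_two_cover tH iH A7) => x y; move: nc; rewrite negb_exists.
  move=> /forallP/(_ x); rewrite negb_exists => /forallP/(_ y).
  rewrite negb_forall => /existsP[e]; rewrite negb_imply negb_or.
  by case/and3P=> *; exists e.
by right; split; [nlia | apply: Or33].
Qed.

End Intersecting.

(** * Connected 3-graphs with a triangle *)

Section Uniq.
Variable T : eqType.

Lemma uniq6_neq (a b c d e f : T) : uniq [:: a; b; c; d; e; f] ->
  ((a == b = false) * (a == c = false) * (a == d = false) * (a == e = false) *
   (a == f = false) * (b == c = false) * (b == d = false) * (b == e = false) *
   (b == f = false) * (c == d = false) * (c == e = false) * (c == f = false) *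
   (d == e = false) * (d == f = false) * (e == f = false)) *
  ((b == a = false) * (c == a = false) * (d == a = false) * (e == a = false) *
   (f == a = false) * (c == b = false) * (d == b = false) * (e == b = false) *
   (f == b = false) * (d == c = false) * (e == c = false) * (f == c = false) *
   (e == d = false) * (f == d = false) * (f == e = false)).
Proof.
rewrite /= !inE !negb_or -!andbA.
repeat (case/andP=> /negbTE ?); move=> _.
by do !split; first [assumption | rewrite eq_sym; assumption].
Qed.

End Uniq.

(** A truth table: the bits tell which of [p], [q], [r], [p'], [q'], [r'] lie in an edge, and [n1],
    [n2], [n3] are its intersections with the edges of the triangle. The implications exclude loose
    paths with two of these edges. What remains is a side of [pqr] or a spoke, that is a corner with
    the vertex opposite to it. *)
Lemma triangle_bits (a b c a' b' c' : bool) :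
  let n1 := a + b + c' in let n2 := b + c + a' in let n3 := c + a + b' in
  0 < a + (b + (c + (a' + (b' + c')))) <= 2 ->
  [&& (n1 == 1) ==> (n2 != 0), (n1 == 1) ==> (n3 != 0), (n2 == 1) ==> (n1 != 0),
      (n2 == 1) ==> (n3 != 0), (n3 == 1) ==> (n1 != 0) & (n3 == 1) ==> (n2 != 0)] ->
  [|| a && b, b && c, c && a, a && a', b && b' | c && c'].
Proof. by case: a; case: b; case: c; case: a'; case: b'; case: c'. Qed.

(** * Edges attached to a core set, used for triangles, kites and twins *)

Section Attached.
Variables (V : finType) (A F : {set V}) (H : {set {set V}}) (pairs : seq {set V}).
Implicit Types (g pi : {set V}) (w : V).
Hypotheses (tH : three_graph A H) (cH : connected_in A H) (FA : F \subset A).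
Hypotheses (F0 : F != set0) (pairsF : forall pi, pi \in pairs -> pi \subset F).
Hypothesis crossing : forall g, g \in H -> ~~ (g \subset F) -> 0 < meet g F ->
  exists w pi, [/\ w \in A, w \notin F, pi \in pairs & g = w |: pi].
Hypothesis attached : forall w pi g, w \in g -> w \notin F -> pi \in pairs ->
  w |: pi \in H -> g \in H -> 0 < meet g F.

(** The core [F] with the outside vertices of crossing edges is closed: an edge that reaches such a
    vertex meets [F], so it is inside or crossing. By connectedness there is nothing else. *)
Lemma attached_edges g : g \in H -> g \subset F \/
  exists w pi, [/\ w \in A, w \notin F, pi \in pairs & g = w |: pi].
Proof.
pose W := [set w in A :\: F | has (fun pi => w |: pi \in H) pairs].
have BA : F :|: W = A.
  apply: cH.
  - by rewrite subUset FA /=; apply/subsetP=> x; rewrite !inE => /andP[/andP[_]].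
  - by rewrite setU_eq0 negb_and F0.
  move=> e eH; have [eF0|eF0] := boolP (e \subset F).
    by left; apply: subset_trans eF0 (subsetUl _ _).
  have [m0|mpos] := posnP (meet e F); last first.
    have [w [pi [wA wF piT eE]]] := crossing eH eF0 mpos; left.
    rewrite eE subUset sub1set; apply/andP; split; last first.
      exact: subset_trans (pairsF piT) (subsetUl _ _).
    rewrite in_setU; apply/orP; right; rewrite inE in_setD wF wA !andTb.
    by apply/hasP; exists pi; rewrite // -eE.
  right; apply/subsetP=> w we; rewrite in_setD (subsetP (tH eH).2) // andbT.
  have wF := meet0_notin m0 we; rewrite in_setU (negbTE wF) inE orFb.
  apply/negP=> /andP[_ /hasP[pi piT hH]].
  by have := attached we wF piT hH eH; rewrite m0.
move=> gH; have [gF|gF] := boolP (g \subset F); [by left | right].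
apply: crossing => //; have /subsetPn[w wg wF] := gF.
have := subsetP (tH gH).2 _ wg; rewrite -BA in_setU (negbTE wF) inE.
by case/andP=> _ /hasP[pi piT hH]; apply: attached wg wF piT hH gH.
Qed.

End Attached.

Section Triangle.
Variables (V : finType) (A : {set V}) (H : {set {set V}}).
Implicit Types (e g pi : {set V}) (w x : V).
Hypotheses (tH : three_graph A H) (PH : P_free H) (cH : connected_in A H).
Variables p q r p' q' r' : V.
Hypothesis us : uniq [:: p; q; r; p'; q'; r'].
Hypotheses (e1H : [set p; q; r'] \in H) (e2H : [set q; r; p'] \in H)
  (e3H : [set r; p; q'] \in H).

Let ne := uniq6_neq us.
Let F := [set x in [:: p; q; r; p'; q'; r']].

Let m1 g : meet [set p; q; r'] g = (p \in g) + (q \in g) + (r' \in g).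
Proof. by rewrite meet_set3 ?ne. Qed.
Let m2 g : meet [set q; r; p'] g = (q \in g) + (r \in g) + (p' \in g).
Proof. by rewrite meet_set3 ?ne. Qed.
Let m3 g : meet [set r; p; q'] g = (r \in g) + (p \in g) + (q' \in g).
Proof. by rewrite meet_set3 ?ne. Qed.

Let m12 : meet [set p; q; r'] [set q; r; p'] = 1.
Proof. by rewrite m1 !inE !ne !eqxx. Qed.
Let m13 : meet [set p; q; r'] [set r; p; q'] = 1.
Proof. by rewrite m1 !inE !ne !eqxx. Qed.
Let m23 : meet [set q; r; p'] [set r; p; q'] = 1.
Proof. by rewrite m2 !inE !ne !eqxx. Qed.

Definition triangle_pairs : seq {set V} :=
  [:: [set p; q]; [set q; r]; [set r; p]; [set p; p']; [set q; q']; [set r; r']].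

Lemma triangle_crossing g : g \in H -> ~~ (g \subset F) -> 0 < meet g F ->
  exists w pi, [/\ w \in A, w \notin F, pi \in triangle_pairs & g = w |: pi].
Proof.
move=> gH /subsetPn[w wg wF] gF; have [g3 gA] := tH gH.
exists w, (g :\ w); split=> //; first exact: (subsetP gA); last by rewrite setD1K.
have wF' : w \notin [:: p; q; r; p'; q'; r'] by move: wF; rewrite inE.
have sum2 : (p \in g) + ((q \in g) + ((r \in g) + ((p' \in g) + ((q' \in g) + (r' \in g))))) <= 2.
  have := @count_mem_le _ [:: w; p; q; r; p'; q'; r'] g.
  by rewrite cons_uniq wF' us g3 /= wg addn0 => /(_ isT).
have pos : 0 < (p \in g) + ((q \in g) + ((r \in g) + ((p' \in g) + ((q' \in g) + (r' \in g))))).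
  have [x [xg]] := meet_gt0P gF; rewrite inE !inE !addn_gt0 !lt0b.
  by do 5 (case/predU1P=> [<-|]; first by rewrite xg ?orbT); move/eqP <-; rewrite xg ?orbT.
have end_path e f : e \in H -> f \in H -> meet e f = 1 ->
    (meet e g == 1) ==> (meet f g != 0).
  move=> eH fH ef; apply/implyP=> /eqP eg; apply/eqP => fg.
  by apply: (PH gH fH eH); rewrite // meetC.
have bits : [|| (p \in g) && (q \in g), (q \in g) && (r \in g), (r \in g) && (p \in g),
    (p \in g) && (p' \in g), (q \in g) && (q' \in g) | (r \in g) && (r' \in g)].
  apply: triangle_bits; first by rewrite pos.
  rewrite -m1 -m2 -m3; repeat (apply/andP; split); apply: end_path => //.
  - by rewrite meetC m12.
  - by rewrite meetC m13.
  - by rewrite meetC m23.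
have g2 : #|g :\ w| = 2 by have := cardsD1 w g; rewrite wg g3 => -[].
have neq x : x \in F -> x != w by move=> xF; apply: contraNneq wF => <-.
have pair x y : x \in F -> y \in F -> x != y -> x \in g -> y \in g -> g :\ w = [set x; y].
  move=> xF yF xy xg yg; apply/eqP; rewrite eq_sym eqEcard cards2 xy g2 andbT.
  by rewrite subUset !sub1set !inE xg yg !neq.
have inF x : x \in [:: p; q; r; p'; q'; r'] -> x \in F by rewrite in_set.
rewrite !inE; case/or4P: bits => [a1|a1|a1|/or3P[] a1]; case/andP: a1 => x y.
- by rewrite (pair p q) ?ne ?inE ?eqxx ?orbT.
- by rewrite (pair q r) ?ne ?inE ?eqxx ?orbT.
- by rewrite (pair r p) ?ne ?inE ?eqxx ?orbT.
- by rewrite (pair p p') ?ne ?inE ?eqxx ?orbT.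
- by rewrite (pair q q') ?ne ?inE ?eqxx ?orbT.
- by rewrite (pair r r') ?ne ?inE ?eqxx ?orbT.
Qed.

Let inF x : x \in [:: p; q; r; p'; q'; r'] -> x \in F.
Proof. by rewrite in_set. Qed.

Let pair_sub (pi : {set V}) : pi \in triangle_pairs -> pi \subset F.
Proof.
rewrite !inE => /or4P[/eqP->|/eqP->|/eqP->|/or3P[]/eqP->].
all: by rewrite subUset !sub1set !inF ?inE ?eqxx ?orbT.
Qed.

Let meet_out w (pi e : {set V}) : w \notin F -> e \subset F -> meet e (w |: pi) = meet e pi.
Proof.
move=> wF eF; congr #|pred_of_set _|; rewrite setIUr.
have -> : e :&: [set w] = set0; last by rewrite set0U.
apply/eqP; rewrite -subset0; apply/subsetP=> x; rewrite !inE => /andP[xe /eqP xw].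
by rewrite -xw (subsetP eF) in wF.
Qed.

Let eF : [/\ [set p; q; r'] \subset F, [set q; r; p'] \subset F & [set r; p; q'] \subset F].
Proof. by split; rewrite !subUset !sub1set !inF ?inE ?eqxx ?orbT. Qed.

(** Otherwise [g], the crossing edge and a triangle edge meeting [pi] in one vertex form a loose
    path. *)
Lemma triangle_attached w (pi g : {set V}) : w \in g -> w \notin F ->
  pi \in triangle_pairs -> w |: pi \in H -> g \in H -> 0 < meet g F.
Proof.
move=> wg wF piT hH gH; rewrite lt0n; apply/negP=> /eqP m0.
have mh : meet (w |: pi) g = 1.
  rewrite -(cards1 w); congr #|pred_of_set _|; apply/setP=> x; rewrite !inE.
  case: eqP => [->|_] /=; first by rewrite wg.
  apply/negP=> /andP[xpi xe]; have := meet0_notin m0 xe.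
  by rewrite (subsetP (pair_sub piT)).
have [ei [eiH eiF ei1]] : exists ei, [/\ ei \in H, ei \subset F & meet ei pi = 1].
  have [F1 F2 F3] := eF.
  move: piT; rewrite !inE => /or4P[/eqP->|/eqP->|/eqP->|/or3P[]/eqP->].
  + by exists [set q; r; p']; rewrite m2 !inE !ne eqxx.
  + by exists [set r; p; q']; rewrite m3 !inE !ne eqxx.
  + by exists [set p; q; r']; rewrite m1 !inE !ne eqxx.
  + by exists [set p; q; r']; rewrite m1 !inE !ne eqxx.
  + by exists [set p; q; r']; rewrite m1 !inE !ne eqxx.
  + by exists [set q; r; p']; rewrite m2 !inE !ne eqxx.
apply: (PH gH eiH hH) => //; last by rewrite meetC meet_out.
apply/eqP; rewrite -leqn0 -m0; apply: subset_leq_card.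
by apply: setIS.
Qed.

Lemma triangle_core_sub : F \subset A.
Proof.
have [[s1 s2] s3] := (subsetP (tH e1H).2, subsetP (tH e2H).2, subsetP (tH e3H).2).
apply/subsetP=> x; rewrite in_set !inE.
case/or4P=> [/eqP->|/eqP->|/eqP->|/or3P[]/eqP->].
- by apply: s1; rewrite !inE eqxx.
- by apply: s1; rewrite !inE eqxx orbT.
- by apply: s2; rewrite !inE eqxx orbT.
- by apply: s2; rewrite !inE eqxx orbT.
- by apply: s3; rewrite !inE eqxx orbT.
- by apply: s1; rewrite !inE eqxx orbT.
Qed.

Lemma triangle_edges g : g \in H -> g \subset F \/
  exists w pi, [/\ w \in A, w \notin F, pi \in triangle_pairs & g = w |: pi].
Proof.
apply: (attached_edges tH cH triangle_core_sub _ pair_sub triangle_crossing triangle_attached).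
by apply/set0Pn; exists p; rewrite inF ?inE ?eqxx.
Qed.

Lemma card_pairs3 w (s : seq {set V}) :
  (forall pi, pi \in triangle_pairs -> w |: pi \in H -> pi \in s) ->
  w \notin F -> #|edges_at H w| <= size s.
Proof.
move=> Hs wF; apply: leq_trans (card_size s).
rewrite -[leqRHS](@cardsE _ (mem s)).
apply: (@card_sub_imset _ _ (fun pi : {set V} => w |: pi)) => e.
rewrite inE => /andP[eH we]; have [eF0|[u [pi [_ uF piT eE]]]] := triangle_edges eH.
  by rewrite (subsetP eF0) in wF.
have uw : w = u.
  move: we; rewrite eE !inE => /orP[/eqP//|wpi].
  by rewrite (subsetP (pair_sub piT)) in wF.
by exists pi; rewrite ?uw // inE Hs // uw -eE.
Qed.

(** For a pair of the list disjoint from [pp'], some triangle edge meets both in one vertex and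
    closes a loose path between the two crossing edges. Only the three pairs through [p] are left
    for [w2]. *)
Lemma spoke_degree w1 w2 : w1 != w2 -> w1 \notin F -> w2 \notin F ->
  w1 |: [set p; p'] \in H -> #|edges_at H w2| <= 3.
Proof.
move=> w12 w1F w2F h1H.
apply: (@card_pairs3 _ [:: [set p; q]; [set r; p]; [set p; p']]) => // pi piT h2H.
apply: contraTT isT => pis.
have piF := pair_sub piT.
have [ei [eiH eiF ei1 ei2 pp]] : exists ei, [/\ ei \in H, ei \subset F,
    meet ei [set p; p'] = 1, meet ei pi = 1 & [disjoint [set p; p'] & pi]].
  have [F1 F2 F3] := eF.
  move: piT pis; rewrite !inE !negb_or.
  case/or4P=> [/eqP->|/eqP->|/eqP->|/or3P[]/eqP->]; rewrite ?eqxx ?andbF //= => _.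
  + exists [set r; p; q']; rewrite !m3 !inE !ne !eqxx; split=> //.
    by rewrite disjoints_subset subUset !sub1set !inE !ne.
  + exists [set p; q; r']; rewrite !m1 !inE !ne !eqxx; split=> //.
    by rewrite disjoints_subset subUset !sub1set !inE !ne.
  + exists [set r; p; q']; rewrite !m3 !inE !ne !eqxx; split=> //.
    by rewrite disjoints_subset subUset !sub1set !inE !ne.
exfalso; apply: (PH h1H h2H eiH); [|by rewrite meet_out | by rewrite meet_out].
have PF : [set p; p'] \subset F by rewrite pair_sub // !inE eqxx !orbT.
apply/eqP; rewrite cards_eq0 -subset0; apply/subsetP=> x.
move=> /setIP[/setU1P x1 /setU1P x2]; move: x1 x2.
case=> [->|xP]; case=> [xw|xpi].
- by rewrite xw eqxx in w12.
- by rewrite (subsetP piF) in w1F.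
- by rewrite -xw (subsetP PF) in w2F.
- by have := disjointFr pp xP; rewrite xpi.
Qed.

Lemma no_spoke_degree w : w \notin F ->
  ~~ has (fun pi => w |: pi \in H) [:: [set p; p']; [set q; q']; [set r; r']] ->
  #|edges_at H w| <= 3.
Proof.
move=> wF /hasPn nh; apply: (@card_pairs3 _ [:: [set p; q]; [set q; r]; [set r; p]]) => //.
move=> pi; rewrite -[triangle_pairs]/([:: [set p; q]; [set q; r]; [set r; p]] ++ _).
by rewrite mem_cat => /orP[//|/nh/negP].
Qed.

End Triangle.

Lemma card_bigcup_le (T I : finType) (S : {set I}) (f : I -> {set T}) k :
  (forall i, i \in S -> #|f i| <= k) -> #|\bigcup_(i in S) f i| <= k * #|S|.
Proof.
move=> fk; apply: (@leq_trans (\sum_(i in S) #|f i|)).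
  elim/big_rec2: _ => [|i n B _ le]; first by rewrite cards0.
  by apply: leq_trans (leq_card_setU _ _).1 _; rewrite leq_add2l.
by rewrite mulnC -sum_nat_const; apply: leq_sum.
Qed.

Section TriangleBound.
Variables (V : finType) (A : {set V}) (H : {set {set V}}).
Implicit Types (e g pi : {set V}) (w x : V).
Hypotheses (tH : three_graph A H) (PH : P_free H) (cH : connected_in A H).
Variables p q r p' q' r' : V.
Hypothesis us : uniq [:: p; q; r; p'; q'; r'].
Hypotheses (e1H : [set p; q; r'] \in H) (e2H : [set q; r; p'] \in H)
  (e3H : [set r; p; q'] \in H).
Hypothesis bound7 : forall (B : {set V}) (H' : {set {set V}}),
  #|B| = 7 -> three_graph B H' -> P_free H' ->
  [\/ star_like H', comet_like B H', K6_like B H' | #|H'| <= 13].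

Let ne := uniq6_neq us.
Let F := [set x in [:: p; q; r; p'; q'; r']].

Let FA : F \subset A.
Proof. exact: (triangle_core_sub tH e1H e2H e3H). Qed.

Let rot1 : [set x in [:: q; r; p; q'; r'; p']] = F.
Proof. by apply/setP=> x; rewrite !inE; do 6 case: (x == _). Qed.

Let rot2 : [set x in [:: r; p; q; r'; p'; q']] = F.
Proof. by apply/setP=> x; rewrite !inE; do 6 case: (x == _). Qed.

Let us1 : uniq [:: q; r; p; q'; r'; p'].
Proof. by rewrite /= !inE !ne. Qed.

Let us2 : uniq [:: r; p; q; r'; p'; q'].
Proof. by rewrite /= !inE !ne. Qed.

Lemma triangle_two_degrees w1 w2 : w1 != w2 -> w1 \notin F -> w2 \notin F ->
  #|edges_at H w2| <= #|edges_at H w1| -> #|edges_at H w2| <= 3.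
Proof.
move=> w12 w1F w2F le.
have [sp|nsp] := boolP (has (fun pi => w1 |: pi \in H)
    [:: [set p; p']; [set q; q']; [set r; r']]); last first.
  exact: leq_trans le (no_spoke_degree tH PH cH us e1H e2H e3H w1F nsp).
case/hasP: sp => pi; rewrite !inE => /or3P[] /eqP-> hH.
- exact: (spoke_degree tH PH cH us e1H e2H e3H w12 w1F w2F hH).
- apply: (spoke_degree tH PH cH us1 e2H e3H e1H w12 _ _ hH); by rewrite rot1.
- apply: (spoke_degree tH PH cH us2 e3H e1H e2H w12 _ _ hH); by rewrite rot2.
Qed.

(** On seven vertices, the triangle fits neither into a star nor into a comet. An edge there meets
    every set of six vertices, so a K_6 would have to contain all edges; but these cover all seven
    vertices, [w0] by the edge [h]. *)
Lemma triangle_core_bound w0 : w0 \in A -> w0 \notin F -> edges_at H w0 != set0 ->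
  #|[set e in H | e \subset w0 |: F]| <= 13.
Proof.
move=> w0A w0F /set0Pn[h]; rewrite inE => /andP[hH w0h].
have F6 : #|F| = 6 by rewrite cardsE (card_uniqP us).
have B7 : #|w0 |: F| = 7 by rewrite cardsU1 w0F F6.
set H' := [set e in H | _].
have H'H : H' \subset H by apply/subsetP=> e; rewrite inE => /andP[].
have tH' : three_graph (w0 |: F) H'.
  by move=> e; rewrite inE => /andP[/tH[]].
have inF x : x \in [:: p; q; r; p'; q'; r'] -> x \in F by rewrite in_set.
have subF : [/\ [set p; q; r'] \subset F, [set q; r; p'] \subset F & [set r; p; q'] \subset F].
  by split; rewrite !subUset !sub1set !inF ?inE ?eqxx ?orbT.
have FB e : e \subset F -> e \subset w0 |: F.
  by move=> eF; apply: subset_trans eF (subsetUr _ _).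
have [E1 E2 E3] : [/\ [set p; q; r'] \in H', [set q; r; p'] \in H' & [set r; p; q'] \in H'].
  by case: subF => s1 s2 s3; rewrite !inE e1H e2H e3H !FB.
have hH' : h \in H'.
  rewrite inE hH; case: (triangle_edges tH PH cH us e1H e2H e3H hH) => [/FB//|].
  case=> w [pi [_ wF piT hE]]; have piF : pi \subset F.
    by move: piT; rewrite !inE => /or4P[/eqP->|/eqP->|/eqP->|/or3P[]/eqP->];
      rewrite subUset !sub1set !inF ?inE ?eqxx ?orbT.
  have : w0 \in w |: pi by rewrite -hE.
  case/setU1P=> [->|w0pi]; first by rewrite hE setUS.
  by rewrite (subsetP piF) in w0F.
have := bound7 B7 tH' (P_freeS H'H PH); case=> //.
- case=> v sv; have := sv _ E1; have := sv _ E2; have := sv _ E3.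
  rewrite !inE -!orbA => /or3P[]/eqP->; by rewrite !ne ?eqxx ?orbT ?orbF ?orFb // !ne.
- case=> K [v [_ K4 vK HK]].
  have two e f : e \in H' -> f \in H' -> meet e f = 1 -> e \subset K -> f \subset K -> False.
    move=> eH' fH' ef eK fK; have [e3 _] := tH' _ eH'; have [f3 _] := tH' _ fH'.
    have : #|e :|: f| <= 4 by rewrite -K4 subset_leq_card // subUset eK.
    by rewrite cardsU ef e3 f3.
  have one e f g x y : e :&: K = [set v] -> f :&: K = [set v] ->
      (g \subset K \/ g :&: K = [set v]) ->
      (forall z, z \in e -> z \in f -> z = x) -> x \notin g -> y \in g -> y \in e -> y != x ->
      False.
    move=> eK fK gK efx xg yg ye; have : v \in e :&: K by rewrite eK inE.
    have : v \in f :&: K by rewrite fK inE.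
    rewrite !inE => /andP[vf _] /andP[ve _]; have vx := efx _ ve vf.
    case: gK => gK; last first.
      have : v \in g :&: K by rewrite gK inE.
      by rewrite inE vx (negbTE xg).
    have : y \in e :&: K by rewrite inE ye (subsetP gK).
    by rewrite eK inE -vx => ->.
  have M12 : meet [set p; q; r'] [set q; r; p'] = 1.
    by rewrite meet_set3 ?ne // !inE !ne !eqxx.
  have M13 : meet [set p; q; r'] [set r; p; q'] = 1.
    by rewrite meet_set3 ?ne // !inE !ne !eqxx.
  have M23 : meet [set q; r; p'] [set r; p; q'] = 1.
    by rewrite meet_set3 ?ne // !inE !ne !eqxx.
  have K1 := HK _ E1; have K2 := HK _ E2; have K3 := HK _ E3.
  case: (K1) => k1; case: (K2) => k2; case: (K3) => k3.
  + by case: (two _ _ E1 E2).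
  + by case: (two _ _ E1 E2).
  + by case: (two _ _ E1 E3).
  + case: (one _ _ _ r q k2 k3 K1); rewrite ?inE ?ne ?eqxx ?orbT //.
    by move=> z; rewrite !inE -!orbA => /or3P[]/eqP->; rewrite ?ne ?orbF ?eqxx.
  + by case: (two _ _ E2 E3).
  + case: (one _ _ _ p q k1 k3 K2); rewrite ?inE ?ne ?eqxx ?orbT //.
    by move=> z; rewrite !inE -!orbA => /or3P[]/eqP->; rewrite ?ne ?orbF ?eqxx.
  + case: (one _ _ _ q p k1 k2 K3); rewrite ?inE ?ne ?eqxx ?orbT //.
    by move=> z; rewrite !inE -!orbA => /or3P[]/eqP->; rewrite ?ne ?orbF ?eqxx.
  + case: (one _ _ _ q p k1 k2 K3); rewrite ?inE ?ne ?eqxx ?orbT //.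
    by move=> z; rewrite !inE -!orbA => /or3P[]/eqP->; rewrite ?ne ?orbF ?eqxx.
- case=> K [KB K6 HK].
  have hK e : e \in H' -> e \subset K.
    move=> eH'; have [//|eK] := HK _ eH'; have [e3 eB] := tH' _ eH'.
    have : #|e :|: K| <= 7 by rewrite -B7 subset_leq_card // subUset eB.
    by rewrite cardsU eK e3 K6.
  have : w0 |: F \subset K.
    rewrite subUset sub1set (subsetP (hK _ hH')) //=.
    have [[s1 s2] s3] := (subsetP (hK _ E1), subsetP (hK _ E2), subsetP (hK _ E3)).
    apply/subsetP=> x; rewrite in_set !inE.
    case/or4P=> [/eqP->|/eqP->|/eqP->|/or3P[]/eqP->].
    + by apply: s1; rewrite !inE eqxx.
    + by apply: s1; rewrite !inE eqxx orbT.
    + by apply: s2; rewrite !inE eqxx orbT.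
    + by apply: s2; rewrite !inE eqxx orbT.
    + by apply: s3; rewrite !inE eqxx orbT.
    + by apply: s1; rewrite !inE eqxx orbT.
  by move/subset_leq_card; rewrite B7 K6.
Qed.

(** Take [w0] of maximum degree outside [F]. Every other outside vertex has degree at most 3: a
    spoke at [w0] forces this, and without one [w0] itself has only the three sides. The total is 13
    + 3 ([#|A|] - 7). *)
Lemma triangle_bound : 7 <= #|A| -> #|H| <= 3 * #|A| - 8.
Proof.
move=> A7; have F6 : #|F| = 6 by rewrite cardsE (card_uniqP us).
have W0 : A :\: F != set0.
  by rewrite -card_gt0 cardsD (setIidPr FA) F6; nlia.
have [w1 w1W] := set0Pn _ W0.
have [w0 w0W wmax] := @arg_maxnP _ w1 (mem (A :\: F)) (fun w => #|edges_at H w|) w1W.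
have [w0F w0A] : w0 \notin F /\ w0 \in A by move: w0W; rewrite !inE => /andP[].
have sub : H \subset [set e in H | e \subset w0 |: F] :|:
    \bigcup_(w in (A :\: F) :\ w0) edges_at H w.
  apply/subsetP=> e eH; rewrite in_setU inE eH /=.
  have [//|/subsetPn[w we]] := boolP (e \subset w0 |: F).
  rewrite in_setU1 negb_or => /andP[ww0 wF]; apply/bigcupP; exists w.
    by rewrite in_setD1 ww0 in_setD wF (subsetP (tH eH).2).
  by rewrite inE eH.
have le3 : #|\bigcup_(w in (A :\: F) :\ w0) edges_at H w| <= 3 * #|(A :\: F) :\ w0|.
  apply: card_bigcup_le => w; rewrite in_setD1 in_setD => /and3P[ww0 wF wA].
  apply: (@triangle_two_degrees w0) => //; first by rewrite eq_sym.
  by apply: wmax => /=; rewrite in_setD wF.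
have cW : #|(A :\: F) :\ w0| = #|A| - 7.
  have := cardsD1 w0 (A :\: F); rewrite in_setD w0F w0A cardsD (setIidPr FA) F6; nlia.
apply: leq_trans (subset_leq_card sub) _; apply: leq_trans (leq_card_setU _ _).1 _.
suff ne0 : edges_at H w0 != set0 by have := triangle_core_bound w0A w0F ne0; nlia.
(* If even [w0] is in no edge, [F] is closed, against connectedness. *)
apply/negP=> /eqP e0; suff FE : F = A by rewrite -FE F6 in A7.
apply: cH => //; first by rewrite -card_gt0 F6.
move=> e eH; left; apply/subsetP=> w we; apply/negPn/negP=> wF.
have : #|edges_at H w| <= #|edges_at H w0|.
  by apply: wmax => /=; rewrite in_setD wF (subsetP (tH eH).2).
rewrite e0 cards0 leqn0 cards_eq0 => /eqP e1.
have : e \in edges_at H w by rewrite inE eH.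
by rewrite e1 inE.
Qed.

End TriangleBound.

Lemma binD a b : 'C(a + b, 2) = 'C(a, 2) + 'C(b, 2) + a * b.
Proof.
elim: b => [|b IH]; first by rewrite addn0 muln0 !addn0.
by rewrite addnS !binS !bin1 IH mulnS; lia.
Qed.

Lemma card_pairs_in (V : finType) (S : {set V}) (B : {set {set V}}) :
  pairs_in S B -> #|B| <= 'C(#|S|, 2).
Proof.
move=> pB; rewrite -cards_draws; apply: subset_leq_card; apply/subsetP=> p /pB[p2 pS].
by rewrite !inE pS p2.
Qed.

(** * Connected 3-graphs without triangles *)

Section TriangleFree.
Variables (V : finType).
Implicit Types (A : {set V}) (H : {set {set V}}).
Implicit Types (e f g : {set V}) (u v w x y z : V).

(* C is the loose triangle: three edges, any two of which share one vertex, with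
   no vertex common to all. *)
Definition C_free H := forall e f g x, e \in H -> f \in H -> g \in H ->
  e :&: f = [set x] -> x \notin g -> meet g e = 1 -> meet g f = 1 -> False.

Lemma C_freeS H H' : H' \subset H -> C_free H -> C_free H'.
Proof. by move=> /subsetP sub Cf e f g x /sub eH /sub fH /sub gH; apply: Cf. Qed.

Lemma C_free_or_triangle A H : three_graph A H -> C_free H \/
  exists p q r p' q' r' : V, [/\ uniq [:: p; q; r; p'; q'; r'],
    [set p; q; r'] \in H, [set q; r; p'] \in H & [set r; p; q'] \in H].
Proof.
move=> tH.
have [/existsP[e /existsP[f /existsP[g /existsP[q]]]]|nex] :=
  boolP [exists e : {set V}, exists f : {set V}, exists g : {set V}, exists q : V,
    [&& e \in H, f \in H, g \in H, e :&: f == [set q] &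
        [&& q \notin g, meet g e == 1 & meet g f == 1]]]; last first.
  left=> e f g x eH fH gH ef xg ge gf; case/negP: nex.
  apply/existsP; exists e; apply/existsP; exists f; apply/existsP; exists g.
  by apply/existsP; exists x; rewrite eH fH gH ef xg ge gf !eqxx.
case/and5P=> eH fH gH /eqP ef /and3P[qg /eqP ge /eqP gf]; right.
have [p gep] := meet1P ge; have [r gfr] := meet1P gf.
have : q \in e :&: f by rewrite ef inE.
have : p \in g :&: e by rewrite gep inE.
have : r \in g :&: f by rewrite gfr inE.
rewrite !inE => /andP[rg rf] /andP[pg pe] /andP[qe qf].
have efq z : z \in e -> z \in f -> z = q.
  by move=> ze zf; apply/set1P; rewrite -ef inE ze.
have gep' z : z \in g -> z \in e -> z = p.
  by move=> ze zf; apply/set1P; rewrite -gep inE ze.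
have gfr' z : z \in g -> z \in f -> z = r.
  by move=> ze zf; apply/set1P; rewrite -gfr inE ze.
have pq : p != q by apply: contraNneq qg => <-.
have rq : r != q by apply: contraNneq qg => <-.
have pr : p != r by apply: contraNneq pq => pr; apply/eqP/efq; rewrite // pr.
have [r' eE /andP[r'p r'q]] := edge_third (tH _ eH).1 pq pe qe.
have qr : q != r by rewrite eq_sym.
have [p' fE /andP[p'q p'r]] := edge_third (tH _ fH).1 qr qf rf.
have rp : r != p by rewrite eq_sym.
have [q' gE /andP[q'r q'p]] := edge_third (tH _ gH).1 rp rg pg.
have r'e : r' \in e by rewrite eE !inE eqxx orbT.
have p'f : p' \in f by rewrite fE !inE eqxx orbT.
have q'g : q' \in g by rewrite gE !inE eqxx orbT.
have r'f : r' \notin f by apply: contraNN r'q => h; apply/eqP/efq.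
have r'g : r' \notin g by apply: contraNN r'p => h; apply/eqP/gep'.
have p'e : p' \notin e by apply: contraNN p'q => h; apply/eqP/efq.
have p'g : p' \notin g by apply: contraNN p'r => h; apply/eqP/gfr'.
have q'e : q' \notin e by apply: contraNN q'p => h; apply/eqP/gep'.
have ne (S : {set V}) a b : a \in S -> b \notin S -> (a == b) = false.
  by move=> aS bS; apply/negbTE; apply: contraNneq bS => <-.
exists p, q, r, p', q', r'; split; rewrite -?eE -?fE -?gE //.
rewrite /= !inE !negb_or pq pr qr.
rewrite (ne _ _ _ pe p'e) (ne _ _ _ pe q'e) (ne _ _ _ pg r'g).
rewrite (ne _ _ _ qe p'e) (ne _ _ _ qe q'e) (ne _ _ _ qf r'f).
rewrite (ne _ _ _ rg p'g) (eq_sym r) (negbTE q'r) (ne _ _ _ rg r'g).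
by rewrite (eq_sym p') (ne _ _ _ q'g p'g) (ne _ _ _ p'f r'f) (ne _ _ _ q'g r'g).
Qed.

(** If [g] missed [f], then [g], [e], [f] would be a loose path; one common vertex gives a loose
    triangle, and three are impossible because [x] is not in [g]. Kites and twins are analysed by
    this rule. *)
Lemma forced_meet A H e f g x : three_graph A H -> P_free H -> C_free H ->
  e \in H -> f \in H -> g \in H -> e :&: f = [set x] -> x \notin g ->
  meet g e = 1 -> meet g f = 2.
Proof.
move=> tH PH CH eH fH gH ef xg ge.
have ef1 : meet e f = 1 by rewrite ef cards1.
have : meet g f <= 2.
  have /setIP[_ xf] : x \in e :&: f by rewrite ef inE.
  have := cardsD1 x f; rewrite xf (tH _ fH).1 => -[->]; apply: subset_leq_card.
  by apply/subsetP=> z; rewrite !inE => /andP[zg ->]; rewrite andbT; apply: contraNneq xg => <-.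
case mf : (meet g f) => [|[|[|n]]] // _.
- by case: (PH g f e); rewrite // meetC.
- by case: (CH e f g x).
Qed.

(** An intersecting family of pairs is a star or lies in a triangle. *)
Lemma card_intersecting_pairs A (B : {set {set V}}) : pairs_in A B ->
  (forall p q, p \in B -> q \in B -> 0 < meet p q) -> #|B| <= maxn #|A|.-1 3.
Proof.
move=> pB mB; have [B1|B1] := leqP #|B| 1; first by nlia.
have /card_gt1P[e [f [eB fB ef]]] := B1.
have [e2 eU] := pB _ eB; have [f2 fU] := pB _ fB.
have [u [ue uf]] := meet_gt0P (mB _ _ eB fB).
have [v uv eE] := pairE e2 ue; have [w uw fE] := pairE f2 uf.
have vw : v != w by apply: contraNneq ef => vw; rewrite eE fE vw.
have Bu q : q \in B -> u \notin q -> q = [set v; w].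
  move=> qB uq; have [q2 _] := pB _ qB.
  have [x [xq]] := meet_gt0P (mB _ _ qB eB); rewrite eE !inE.
  move=> /orP[]/eqP xE; rewrite xE in xq; first by rewrite xq in uq.
  have [y [yq]] := meet_gt0P (mB _ _ qB fB); rewrite fE !inE.
  move=> /orP[]/eqP yE; rewrite yE in yq; first by rewrite yq in uq.
  by apply/eqP; rewrite eq_sym eqEcard q2 cards2 vw subUset !sub1set xq yq.
have [vwB|vwB] := boolP ([set v; w] \in B); last first.
  rewrite leq_max; apply/orP; left; apply: (card_pairs_star pB (u := u)) => q qB.
  by apply: contraNT vwB => /(Bu _ qB) <-.
rewrite leq_max; apply/orP; right.
have B3 : B \subset [set e; f; [set v; w]].
  apply/subsetP=> q qB; rewrite !inE; have [uq|uq] := boolP (u \in q); last first.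
    by rewrite (Bu _ qB uq) eqxx orbT.
  have [q2 _] := pB _ qB; have [x ux qE] := pairE q2 uq.
  have [y []] := meet_gt0P (mB _ _ vwB qB); rewrite qE !inE => /orP[]/eqP->.
    by rewrite eq_sym (negbTE uv) /= => /eqP <-; rewrite eE eqxx.
  by rewrite eq_sym (negbTE uw) /= => /eqP <-; rewrite fE eqxx orbT.
apply: leq_trans (subset_leq_card B3) _.
by rewrite setUC cardsU1 cards2; case: (_ \notin _); case: (_ != _).
Qed.

Definition junction H x := exists e f, [/\ e \in H, f \in H & e :&: f = [set x]].

Lemma junctionP H x : reflect (junction H x)
  [exists e in H, exists f in H, e :&: f == [set x]].
Proof.
apply: (iffP exists_inP) => [[e eH /exists_inP[f fH /eqP ef]]|[e [f [eH fH ef]]]].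
  by exists e, f.
by exists e => //; apply/exists_inP; exists f; rewrite // ef.
Qed.

Lemma edges_at_imset A H x : three_graph A H ->
  #|[set e :\ x | e in edges_at H x]| = #|edges_at H x| /\
  pairs_in (A :\ x) [set e :\ x | e in edges_at H x].
Proof.
move=> tH; split.
  apply: card_in_imset => e f; rewrite !inE => /andP[_ xe] /andP[_ xf] ef.
  by rewrite -(setD1K xe) -(setD1K xf) ef.
move=> p /imsetP[e]; rewrite inE => /andP[eH xe] ->; have [e3 eA] := tH _ eH.
by split; [have := cardsD1 x e; rewrite xe e3 => -[] | apply: setSD].
Qed.

(** The link of [x] is an intersecting family of pairs on [#|A| - 1] vertices. *)
Lemma non_junction_degree A H x : three_graph A H -> ~ junction H x -> 5 <= #|A| ->
  #|edges_at H x| <= #|A| - 2.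
Proof.
move=> tH nj A5; have [<- pI] := edges_at_imset x tH.
have [->|/set0Pn[p pB]] := eqVneq [set e :\ x | e in edges_at H x] set0.
  by rewrite cards0.
have xA : x \in A.
  move: pB => /imsetP[e]; rewrite inE => /andP[eH xe] _.
  exact: (subsetP (tH _ eH).2).
have := cardsD1 x A; rewrite xA.
suff : #|[set e :\ x | e in edges_at H x]| <= maxn #|A :\ x|.-1 3 by nlia.
apply: card_intersecting_pairs pI _ => p' q' /imsetP[e] + -> /imsetP[f] + ->.
rewrite !inE => /andP[eH xe] /andP[fH xf].
rewrite lt0n cards_eq0; apply/negP=> /eqP d; apply: nj; exists e, f; split=> //.
by rewrite -(setD1K xe) -(setD1K xf) -setUIr d setU0.
Qed.

End TriangleFree.

Definition triangle3 (e f g : triple) :=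
  [&& meet3 e f == 1, meet3 g e == 1, meet3 g f == 1
    & ~~ has (fun i => [&& mem3 i e, mem3 i f & mem3 i g]) (iota 0 6)].

(* A 3-graph without triangles misses an edge of each of these five disjoint ones. *)
Definition triangle_packing : seq (triple * triple * triple) :=
  [:: ((0, 1, 2), (0, 3, 4), (1, 3, 5)); ((0, 1, 3), (0, 2, 4), (1, 2, 5));
      ((0, 1, 4), (0, 2, 3), (2, 4, 5)); ((0, 1, 5), (1, 2, 3), (3, 4, 5));
      ((0, 2, 5), (1, 4, 5), (2, 3, 4))].

Lemma card_C_free6 (V : finType) (A K : {set V}) (H : {set {set V}}) :
  three_graph A H -> C_free H -> #|K| = 6 -> #|[set e in H | e \subset K]| <= 15.
Proof.
move=> tH CH K6; set H' := [set e in H | _].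
have tH' : three_graph K H' by move=> e; rewrite inE => /andP[/tH[]].
have /card_gt0P[x0 _] : 0 < #|K| by rewrite K6.
pose l := enum K; have ul : uniq l := enum_uniq _.
have sl : size l = 6 by rewrite -cardE.
have lK : K =i l by move=> x; rewrite mem_enum.
clearbody l.
pose P t := tset x0 l t \in H.
have tri e f g : valid l e -> valid l f -> valid l g -> triangle3 e f g ->
    P e + P f + P g <= 2.
  move=> ve vf vg /and4P[/eqP ef /eqP ge /eqP gf nc].
  case Pe : (P e); case Pf : (P f); case Pg : (P g) => //.
  have ef' : meet (tset x0 l e) (tset x0 l f) = 1 by rewrite (meet3E x0).
  have [x efx] := meet1P ef'.
  have /setIP[xe xf] : x \in tset x0 l e :&: tset x0 l f by rewrite efx inE.
  case: (@CH _ _ _ x Pe Pf Pg efx); rewrite ?(meet3E x0) //.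
  apply: contra nc => xg; have il : index x l < size l.
    rewrite index_mem -lK; move: xe ve; case: e {Pe ef ge efx ef'} => [[a b] c].
    rewrite /= !inE -orbA => xE /and3P[ab bc cl].
    have bl := ltn_trans bc cl; have al := ltn_trans ab bl.
    by case/or3P: xE => /eqP->; rewrite lK mem_nth.
  apply/hasP; exists (index x l); first by rewrite mem_iota -sl.
  by rewrite -!(@mem_tset _ x0 l ul) // nth_index ?xe ?xf ?xg // -index_mem.
have vl t : t \in triples 6 -> valid l t by rewrite -sl -validE.
have : #|H'| <= count P (triples 6).
  rewrite cardE -size_filter -(size_map (tset x0 l)); apply: uniq_leq_size (enum_uniq _) _.
  move=> h; rewrite mem_enum => hH'; have [t vt hE] := edge_tset x0 lK tH' hH'.
  rewrite hE map_f // mem_filter -sl -validE vt andbT /P -hE.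
  by move: hH'; rewrite inE => /andP[].
move=> le; apply: leq_trans le _.
have /allP pk : all (fun t => [&& t.1.1 \in triples 6, t.1.2 \in triples 6, t.2 \in triples 6
    & triangle3 t.1.1 t.1.2 t.2]) triangle_packing by [].
pose Q t := nat_of_bool (P t).
have pk2 t : t \in triangle_packing -> Q t.1.1 + Q t.1.2 + Q t.2 <= 2.
  by move=> /pk /and4P[/vl v1 /vl v2 /vl v3 tr]; apply: tri.
have Q1 t : Q t <= 1 by apply: leq_b1.
rewrite -sumn_count -/Q; clearbody Q; clear -pk2 Q1.
have t0 : triple * triple * triple := ((0, 0, 0), (0, 0, 0), (0, 0, 0)).
have := pk2 _ (mem_nth t0 (isT : 0 < size triangle_packing)).
have := pk2 _ (mem_nth t0 (isT : 1 < size triangle_packing)).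
have := pk2 _ (mem_nth t0 (isT : 2 < size triangle_packing)).
have := pk2 _ (mem_nth t0 (isT : 3 < size triangle_packing)).
have := pk2 _ (mem_nth t0 (isT : 4 < size triangle_packing)).
(* The five triples outside the packing may all be present: 5 * 2 + 5 = 15. *)
have := Q1 (0, 3, 5); have := Q1 (0, 4, 5); have := Q1 (1, 2, 4).
have := Q1 (1, 3, 4); have := Q1 (2, 3, 5).
rewrite /=; lia.
Qed.

(** * A junction whose edges are never met in a single vertex from outside *)

Section Strict.
Variables (V : finType) (A : {set V}) (H : {set {set V}}).
Implicit Types (e f g p : {set V}) (u v w y z i : V).
Hypotheses (tH : three_graph A H) (cH : connected_in A H) (A12 : 12 <= #|A|).
Variable x : V.
Hypothesis jx : junction H x.
Hypothesis strict : forall e g, e \in H -> g \in H -> x \in e -> x \notin g -> meet e g != 1.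

(** The intersection is not empty, avoids [x] and is not a single vertex, so it is the whole pair
    [e :\ x]. *)
Let link_sub e g v : e \in H -> g \in H -> x \in e -> x \notin g -> v \in e -> v \in g ->
  e :\ x \subset g.
Proof.
move=> eH gH xe xg ve vg; have s := strict eH gH xe xg.
have e2 : #|e :\ x| = 2 by have := cardsD1 x e; rewrite xe (tH eH).1 => -[].
have sub : e :&: g \subset e :\ x.
  by apply/subsetP=> z; rewrite !inE => /andP[-> zg]; rewrite andbT; apply: contraNneq xg => <-.
have pos := meet_gt0 ve vg; have le := subset_leq_card sub.
have -> : e :\ x = e :&: g; last exact: subsetIr.
by apply/esym/eqP; rewrite eqEcard sub e2; nlia.
Qed.

Let xA : x \in A.
Proof.
have [e [f [eH fH ef]]] := jx; have /setIP[xe _] : x \in e :&: f by rewrite ef inE.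
exact: (subsetP (tH eH).2).
Qed.

(** The neighbourhood of [x]; [M] below collects the edges avoiding [x]. *)
Let N := \bigcup_(e in edges_at H x) (e :\ x).

Let NP v : v \in N -> exists e, [/\ e \in H, x \in e & v \in e :\ x].
Proof. by case/bigcupP=> e; rewrite inE => /andP[eH xe] ve; exists e. Qed.

Let mem_N e v : e \in H -> x \in e -> v \in e -> v != x -> v \in N.
Proof.
by move=> eH xe ve vx; apply/bigcupP; exists e; rewrite ?inE ?eH // vx ve.
Qed.

Let sub_N e : e \in H -> x \in e -> e :\ x \subset N.
Proof. by move=> eH xe; apply: (bigcup_sup e); rewrite inE eH. Qed.

Let x_N : x \notin N.
Proof. by apply/negP=> /NP[e [_ _]]; rewrite !inE eqxx. Qed.

Let NA : N \subset A.
Proof. by apply/subsetP=> v /NP[e [eH _]]; rewrite inE => /andP[_]; apply: (subsetP (tH eH).2). Qed.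

Let card_N : 4 <= #|N|.
Proof.
have [e [f [eH fH ef]]] := jx.
have /setIP[xe xf] : x \in e :&: f by rewrite ef inE.
have e2 : #|e :\ x| = 2 by have := cardsD1 x e; rewrite xe (tH eH).1 => -[].
have f2 : #|f :\ x| = 2 by have := cardsD1 x f; rewrite xf (tH fH).1 => -[].
have : #|(e :\ x) :|: (f :\ x)| <= #|N|.
  by apply: subset_leq_card; rewrite subUset !sub_N.
rewrite cardsU e2 f2; have -> : (e :\ x) :&: (f :\ x) = set0; last by rewrite cards0.
by rewrite -setDIl ef setDv.
Qed.

Let M := [set g in H | x \notin g].

(** The K_4 is [x |: g], since an edge at [x] that meets [g] has its other two vertices in [g]. *)
Lemma strict_comet g : M = [set g] -> comet_like A H.
Proof.
move=> Mg; have : g \in M by rewrite Mg inE.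
rewrite inE => /andP[gH xg]; have [g3 gA] := tH gH.
exists (x |: g), x; split.
- by rewrite subUset sub1set xA.
- by rewrite cardsU1 xg g3.
- by rewrite !inE eqxx.
move=> e eH; have [xe|xe] := boolP (x \in e); last first.
  have : e \in M by rewrite inE eH.
  by rewrite Mg inE => /eqP->; left; apply: subsetUr.
have [m0|mpos] := posnP (meet e g).
  right; apply/setP=> z; rewrite !inE; case: (eqVneq z x) => [->|zx] //=.
    by rewrite xe.
  by apply/negP=> /andP[ze]; apply/negP; apply: meet0_notin m0 ze.
have [v [ve vg]] := meet_gt0P mpos; left.
by rewrite -(setD1K xe) setUS // (link_sub eH gH xe xg ve).
Qed.

(** The triple [g] is covered by link pairs of [x], all contained in it. One through [v] also lies
    in [g']; any other link pair inside [g] meets this one, so it lies in [g'] too. *)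
Let D g g' v : g \in M -> g' \in M -> g \subset N -> v \in g -> v \in g' -> g \subset g'.
Proof.
rewrite !inE => /andP[gH xg] /andP[g'H xg'] gN vg vg'.
have [e [eH xe]] := NP (subsetP gN _ vg); rewrite inE => /andP[vx ve].
have eg := link_sub eH gH xe xg ve vg; have eg' := link_sub eH g'H xe xg' ve vg'.
have e2 : #|e :\ x| = 2 by have := cardsD1 x e; rewrite xe (tH eH).1 => -[].
apply/subsetP=> s sg; have [sE|sE] := boolP (s \in e :\ x); first exact: (subsetP eg').
have [f [fH xf]] := NP (subsetP gN _ sg); rewrite inE => /andP[sx sf].
have fg := link_sub fH gH xf xg sf sg.
have f2 : #|f :\ x| = 2 by have := cardsD1 x f; rewrite xf (tH fH).1 => -[].
have : 0 < meet (f :\ x) (e :\ x).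
  have : #|(f :\ x) :|: (e :\ x)| <= 3.
    by rewrite -(tH gH).1 subset_leq_card // subUset fg.
  by rewrite cardsU f2 e2; nlia.
case/meet_gt0P=> t [tf te].
have fg' := link_sub fH g'H xf xg' (subsetP (subD1set _ _) _ tf) (subsetP eg' _ te).
by apply: (subsetP fg'); rewrite inE sx.
Qed.

(** Here [x |: N] is closed, so it is [A], and by [D] the edges avoiding [x] are pairwise disjoint.
    If there are two, [g] and [g'], each link pair of [x] lies in [g], in [g'] or in the other
    [#|A| - 7] vertices. *)
Lemma strict_no_outside : (forall g, g \in M -> g \subset N \/ meet g N = 0) ->
  [\/ star_like H, comet_like A H | #|H| <= 'C(#|A| - 5, 2) + 3].
Proof.
move=> noI; have NE : x |: N = A.
  apply: cH; first by rewrite subUset sub1set xA NA.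
    by apply/set0Pn; exists x; rewrite !inE eqxx.
  move=> e eH; have [xe|xe] := boolP (x \in e).
    by left; rewrite -(setD1K xe) setUS // sub_N.
  have /noI[eN|eN] : e \in M by rewrite inE eH.
    by left; apply: subset_trans eN (subsetUr _ _).
  right; apply/subsetP=> z ze; rewrite !inE (subsetP (tH eH).2) // andbT negb_or.
  by rewrite (meet0_notin eN ze) andbT; apply: contraNneq xe => <-.
have MN g : g \in M -> g \subset N.
  move=> gM; move: (gM); rewrite inE => /andP[gH xg].
  apply/subsetP=> z zg; have := subsetP (tH gH).2 _ zg; rewrite -NE => /setU1P[zx|//].
  by rewrite -zx zg in xg.
have [M1|] := leqP #|M| 1.
  have [M0|] := posnP #|M|.
    apply: Or31; exists x => e eH; apply/negPn/negP=> xe.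
    by have := card0_eq M0 e; rewrite !inE eH xe.
  move=> Mpos; have /cards1P[g Mg] : #|M| == 1 by rewrite eqn_leq M1.
  by apply: Or32; apply: strict_comet Mg.
case/card_gt1P=> g [g' [gM g'M gg']]; apply: Or33.
have disj h h' : h \in M -> h' \in M -> h != h' -> [disjoint h & h'].
  move=> hM h'M; apply: contraR => /pred0Pn[v /andP[/= vh vh']].
  rewrite eqEsubset (D hM h'M (MN _ hM) vh vh').
  by rewrite (D h'M hM (MN _ h'M) vh' vh).
have M3 : 3 * #|M| <= #|A| - 1.
  have tr : trivIset M by apply/trivIsetP=> h h'; apply: disj.
  have : \sum_(h in M) #|h| = 3 * #|M|.
    rewrite mulnC -sum_nat_const; apply: eq_bigr => h; rewrite inE => /andP[hH _].
    by rewrite (tH hH).1.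
  move=> <-; rewrite (eqP tr); have -> : #|A| - 1 = #|A :\ x|.
    by rewrite (cardsD1 x A) xA addKn.
  apply: subset_leq_card; apply/bigcupsP=> h; rewrite inE => /andP[hH xh].
  by rewrite subsetD1 (tH hH).2.
move: (gM) (g'M); rewrite !inE => /andP[gH xg] /andP[g'H xg'].
have [cE pE] := edges_at_imset x tH.
set B := [set e :\ x | e in edges_at H x] in cE pE.
have dgg' := disj _ _ gM g'M gg'.
have split3 q : q \in B -> [\/ q \subset g, q \subset g' | q \subset A :\ x :\: (g :|: g')].
  move=> qB; have [q2 qA] := pE _ qB.
  case/imsetP: qB => e; rewrite inE => /andP[eH xe] qE.
  have [m0|/meet_gt0P[v [vq vg]]] := posnP (meet q g); last first.
    apply: Or31; rewrite qE; apply: (link_sub eH gH xe xg) vg.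
    by move: vq; rewrite qE inE => /andP[].
  have [m0'|/meet_gt0P[v [vq vg]]] := posnP (meet q g'); last first.
    apply: Or32; rewrite qE; apply: (link_sub eH g'H xe xg') vg.
    by move: vq; rewrite qE inE => /andP[].
  apply: Or33; apply/subsetP=> z zq; rewrite in_setD (subsetP qA) // andbT.
  by rewrite in_setU negb_or (meet0_notin m0) // (meet0_notin m0').
have cR : #|A :\ x :\: (g :|: g')| = #|A| - 7.
  rewrite cardsD (setIidPr _).
    rewrite cardsU (tH gH).1 (tH g'H).1 disjoint_setI0 // cards0.
    have := cardsD1 x A; rewrite xA; nlia.
  by rewrite subUset !subsetD1 (tH gH).2 (tH g'H).2 xg xg'.
pose BS (S : {set V}) := [set q in B | q \subset S].
have cBS S : #|BS S| <= 'C(#|S|, 2).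
  by apply: card_pairs_in => q; rewrite inE => /andP[/pE[]].
have subB : B \subset BS g :|: BS g' :|: BS (A :\ x :\: (g :|: g')).
  by apply/subsetP=> q qB; rewrite !in_setU !inE qB /=; case: (split3 q qB) => ->; rewrite ?orbT.
have cB : #|B| <= 6 + 'C(#|A| - 7, 2).
  have := cBS g; have := cBS g'; have := cBS (A :\ x :\: (g :|: g')).
  rewrite cR (tH gH).1 (tH g'H).1.
  have := subset_leq_card subB.
  have := (leq_card_setU (BS g :|: BS g') (BS (A :\ x :\: (g :|: g')))).1.
  have := (leq_card_setU (BS g) (BS g')).1.
  rewrite (_ : 'C(3, 2) = 3) //; nlia.
have HE : #|H| = #|edges_at H x| + #|M|.
  rewrite -(cardsID [set e : {set V} | x \in e] H); congr (_ + _); apply: eq_card => e.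
    by rewrite !inE.
  by rewrite !inE andbC.
have -> : #|A| - 5 = (#|A| - 7) + 2 by nlia.
rewrite binD (_ : 'C(2, 2) = 1) //; nlia.
Qed.

Section Outside.
Variables (e0 g0 : {set V}) (i0 : V).
Hypotheses (e0H : e0 \in H) (g0H : g0 \in H) (xe0 : x \in e0) (xg0 : x \notin g0)
  (e0g0 : e0 :\ x \subset g0) (i0g : i0 \in g0) (i0N : i0 \notin N).
Variable u2 : nat.
Hypothesis degx : forall v, junction H v -> #|edges_at H v| <= #|edges_at H x|.
Hypothesis IH : forall (B : {set V}) (H' : {set {set V}}), #|B| = #|A| - 2 -> three_graph B H' -> H' \subset H ->
  [\/ star_like H', comet_like B H' | #|H'| <= u2].

(** In the remaining case some edge [g0] avoiding [x] consists of a link pair [p] of [x] and a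
    vertex [i0] outside the neighbourhood. The two vertices of [p] are deleted, as few edges meet
    them. *)
Let p := e0 :\ x.

Let p2 : #|p| = 2.
Proof. by have := cardsD1 x e0; rewrite xe0 (tH e0H).1 => -[]. Qed.

Let i0p : i0 \notin p.
Proof. by apply: contra i0N; apply/subsetP/sub_N. Qed.

Let g0E : g0 = i0 |: p.
Proof.
apply/eqP; rewrite eq_sym eqEcard subUset sub1set i0g e0g0 (tH g0H).1.
by rewrite cardsU1 i0p p2.
Qed.

Let I' := [set i in A | (i |: p \in H) && (i \notin x |: N)].

(** An edge at [x] that meets [p] has its other vertices in [g0] but not at [i0], so they form [p].
    An edge avoiding [x] contains [p]; if its third vertex [i] were a neighbour of [x], the link
    pair through [i] would meet [p] and thus lie in [g0], forcing [i = i0]. *)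
Let meets_p e : e \in H -> 0 < meet e p -> e = e0 \/ exists2 i, i \in I' & e = i |: p.
Proof.
move=> eH /meet_gt0P[v [ve vp]].
have vg0 : v \in g0 := subsetP e0g0 _ vp.
have vx : v != x by move: vp; rewrite !inE => /andP[].
have ve0 : v \in e0 by move: vp; rewrite !inE => /andP[].
have [xe|xe] := boolP (x \in e); [left | right].
  have eg0 := link_sub eH g0H xe xg0 ve vg0.
  have e2 : #|e :\ x| = 2 by have := cardsD1 x e; rewrite xe (tH eH).1 => -[].
  suff : e :\ x = p by move=> ep; rewrite -(setD1K xe) ep setD1K.
  apply/eqP; rewrite eqEcard p2 e2 andbT; apply/subsetP=> z ze.
  have := subsetP eg0 _ ze; rewrite g0E => /setU1P[zi|//].
  by move: i0N; rewrite -zi (subsetP (sub_N eH xe)).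
have pe : p \subset e := link_sub e0H eH xe0 xe ve0 ve.
have /card_gt0P[i] : 0 < #|e :\: p| by rewrite cardsD (setIidPr pe) p2 (tH eH).1.
rewrite inE => /andP[ip ie].
have eE : e = i |: p.
  by apply/eqP; rewrite eq_sym eqEcard subUset sub1set ie pe (tH eH).1 cardsU1 ip p2.
exists i => //; rewrite inE (subsetP (tH eH).2) // -eE eH /= in_setU1 negb_or.
apply/andP; split; first by apply: contraNneq xe => <-.
apply/negP=> /NP[f [fH xf /[dup] iF]]; rewrite in_setD1 => /andP[ix if_].
have fe := link_sub fH eH xf xe if_ ie.
have f2 : #|f :\ x| = 2 by have := cardsD1 x f; rewrite xf (tH fH).1 => -[].
have [w wf wi] : exists2 w, w \in f :\ x & w != i.
  have /card_gt1P[a [b [af bf ab]]] : 1 < #|f :\ x| by rewrite f2.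
  have [ai|ai] := eqVneq a i; last by exists a.
  by exists b; rewrite // eq_sym -ai.
have wp : w \in p.
  have := subsetP fe _ wf; rewrite eE => /setU1P[wi'|//].
  by rewrite wi' eqxx in wi.
have fg0 : f :\ x \subset g0.
  apply: (link_sub fH g0H xf xg0 _ (subsetP e0g0 _ wp)).
  by move: wf; rewrite inE => /andP[].
have := subsetP fg0 _ iF; rewrite g0E => /setU1P[ii|ip']; last by rewrite ip' in ip.
by move: i0N; rewrite -ii (mem_N fH xf if_ ix).
Qed.

Let Ep := [set e : {set V} in H | 0 < meet e p].
Let J := H :\: Ep.
Let B := A :\: p.

Let pA : p \subset A.
Proof. exact: subset_trans (subD1set _ _) (tH e0H).2. Qed.

Let cardB : #|B| = #|A| - 2.
Proof. by rewrite cardsD (setIidPr pA) p2. Qed.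

Let JH : J \subset H.
Proof. exact: subsetDl. Qed.

Let mem_J e : e \in J -> e \in H /\ meet e p = 0.
Proof. by rewrite !inE => /andP[+ eH]; rewrite eH -leqNgt leqn0 => /eqP. Qed.

Let tJ : three_graph B J.
Proof.
move=> e /mem_J[eH m0]; have [e3 eA] := tH eH; split=> //.
by apply/subsetP=> z ze; rewrite inE (meet0_notin m0 ze) (subsetP eA).
Qed.

Let HJ : #|H| = #|J| + #|Ep|.
Proof.
rewrite addnC /J -(cardsID Ep H); congr (_ + _); apply: eq_card => e.
by rewrite !inE; case: (e \in H).
Qed.

(** [x] and its neighbours, at least four by the two edges at the junction, are not in [I']. *)
Let cardI' : #|I'| <= #|A| - 5.
Proof.
have : #|I'| <= #|A :\: (x |: N)|.
  by apply: subset_leq_card; apply/subsetP=> i; rewrite !inE => /and3P[-> _ ->].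
rewrite cardsD (setIidPr _) ?subUset ?sub1set ?xA // cardsU1 x_N; have := card_N; nlia.
Qed.

Let cardEp : #|Ep| <= 1 + #|I'|.
Proof.
apply: (@leq_trans #|e0 |: [set i |: p | i in I']|).
  apply: subset_leq_card; apply/subsetP=> e; rewrite inE => /andP[eH /(meets_p eH)[->|]].
    by rewrite !inE eqxx.
  by case=> i iI ->; rewrite in_setU1 (imset_f (fun i => i |: p) iI) orbT.
rewrite cardsU1; have := leq_imset_card (fun i => i |: p) I'; case: (_ \notin _); nlia.
Qed.

Let link_J e : e \in H -> x \in e -> e != e0 -> e :\ x \subset A :\ x :\: p :\: I'.
Proof.
move=> eH xe ee0; apply/subsetP=> z ze; move: (ze); rewrite !in_setD1 => /andP[zx ze'].
have zI : z \notin I'.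
  by rewrite inE !negb_and negbK in_setU1 (subsetP (sub_N eH xe) _ ze) !orbT.
apply/setDP; split=> //; apply/setDP; split.
  by rewrite in_setD1 zx (subsetP (tH eH).2 _ ze').
apply/negP=> zp; have [ee|[i]] := meets_p eH (meet_gt0 ze' zp).
  by rewrite ee eqxx in ee0.
rewrite inE in_setU1 negb_or => /and4P[_ _ ix _] eE.
by move: xe; rewrite eE !inE eqxx orbF => /eqP xi; rewrite xi eqxx in ix.
Qed.

Let card_free : #|A :\ x :\: p :\: I'| = #|A| - 3 - #|I'|.
Proof.
have xp : x \notin p by rewrite !inE eqxx.
have I'A : I' \subset A :\ x :\: p.
  apply/subsetP=> i; rewrite inE in_setU1 negb_or => /and4P[iA _ ix iN].
  rewrite in_setD in_setD1 ix iA !andbT.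
  by apply: contra iN; apply/subsetP/sub_N.
rewrite cardsD (setIidPr I'A) cardsD (setIidPr _) ?p2; last by rewrite subsetD1 pA.
have := cardsD1 x A; rewrite xA; nlia.
Qed.

Let M_J : M \subset [set e in J | x \notin e] :|: [set i |: p | i in I'].
Proof.
apply/subsetP=> e; rewrite inE => /andP[eH xe]; rewrite in_setU.
have [m0|mpos] := posnP (meet e p).
  by rewrite inE xe andbT !inE eH m0.
have [ee|[i iI eE]] := meets_p eH mpos; first by rewrite ee xe0 in xe.
by rewrite eE (imset_f (fun i => i |: p) iI) orbT.
Qed.

Let at_J e : e \in H -> x \in e -> e != e0 -> e \in J.
Proof.
move=> eH xe ee0; rewrite !inE eH andbT /= -leqNgt leqn0; apply/negPn/negP.
rewrite -lt0n => mpos; have [ee|[i iI eE]] := meets_p eH mpos.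
  by rewrite ee eqxx in ee0.
move: iI; rewrite inE in_setU1 negb_or => /and4P[_ _ ix _].
by move: xe; rewrite eE !inE eqxx orbF => /eqP xi; rewrite xi eqxx in ix.
Qed.

Let HM : #|H| = #|edges_at H x| + #|M|.
Proof.
rewrite -(cardsID [set e : {set V} | x \in e] H); congr (_ + _); apply: eq_card => e.
  by rewrite !inE.
by rewrite !inE andbC.
Qed.

Let links := [set e :\ x | e in edges_at H x].

Let p_links : p \in links.
Proof. by apply/imsetP; exists e0; rewrite // inE e0H. Qed.

(** Centre [x]: with at most one element in [I'] this is a comet; otherwise [#|A| - 3 - #|I'|]
    vertices are left for the links other than [p], and two elements in [I'] give just
    ['C(#|A| - 5, 2) + 3]. Another centre [v]: all edges at [x] but [e0] pass through [v], so [x]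
    has degree at most [#|A| - 1], which bounds the degree of [v] if that is a junction. *)
Let I'_star : star_like J -> [\/ star_like H, comet_like A H
  | #|H| <= maxn ('C(#|A| - 5, 2) + 3) (u2 + (#|A| - 4))].
Proof.
have small : 2 * #|A| - 3 <= 'C(#|A| - 5, 2) + 3.
  have -> : #|A| - 5 = #|A| - 12 + 7 by nlia.
  by rewrite binD (_ : 'C(7, 2) = 21) //; nlia.
have [cE pE] := edges_at_imset x tH; rewrite -/links in cE pE.
case=> v Jv; have [vx|vx] := eqVneq v x.
  have MI : M \subset [set i |: p | i in I'].
    apply: subset_trans M_J _; rewrite subUset subxx andbT.
    by apply/subsetP=> e; rewrite inE => /andP[/Jv]; rewrite vx => ->.
  have leM := leq_trans (subset_leq_card MI) (leq_imset_card (fun i => i |: p) I').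
  have g0M : g0 \in M by rewrite inE g0H.
  have [I1|I1] := leqP #|I'| 1.
    apply: Or32; apply: (@strict_comet g0); apply/eqP.
    by rewrite eq_sym eqEcard sub1set g0M cards1 (leq_trans leM).
  apply: Or33; rewrite leq_max; apply/orP; left; rewrite HM -cE.
  have : #|links :\ p| <= 'C(#|A :\ x :\: p :\: I'|, 2).
    apply: card_pairs_in => q; rewrite in_setD1 => /andP[qp /[dup] /pE[q2 _] /imsetP[e]].
    rewrite inE => /andP[eH xe] qE; split=> //; rewrite qE; apply: link_J => //.
    by apply: contraNneq qp => ee; rewrite qE ee.
  have := cardsD1 p links; rewrite p_links card_free.
  have -> : #|A| - 5 = (#|A| - 3 - #|I'|) + (#|I'| - 2) by have := cardI'; nlia.
  rewrite binD; have : 2 <= #|A| - 3 - #|I'| by have := cardI'; nlia.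
  have : #|I'| - 2 <= (#|A| - 3 - #|I'|) * (#|I'| - 2) \/ #|A| - 3 - #|I'| = 0.
    by case: (_ - _ - _) => [|k]; [right | left; rewrite mulSn leq_addr].
  nlia.
apply: Or33; rewrite leq_max; apply/orP; left.
have leJ : #|J| <= #|edges_at H v|.
  by apply: subset_leq_card; apply/subsetP=> e eJ; rewrite inE Jv // (subsetP JH).
suff : #|J| <= #|A| - 1 by have := HJ; have := cardEp; have := cardI'; nlia.
have [vA|vA] := boolP (v \in A); last first.
  rewrite (_ : J = set0) ?cards0 //; apply/eqP; rewrite -subset0; apply/subsetP=> e eJ.
  by rewrite (subsetP (tH (subsetP JH _ eJ)).2 _ (Jv _ eJ)) in vA.
have dx : #|edges_at H x| <= 1 + (#|A| - 2).
  apply: (@leq_trans #|e0 |: edges_at2 H x v|).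
    apply: subset_leq_card; apply/subsetP=> e; rewrite inE => /andP[eH xe].
    have [->|ee] := eqVneq e e0; first by rewrite !inE eqxx.
    by rewrite in_setU1 inE eH xe Jv ?orbT // at_J.
  rewrite cardsU1; have := codegree_le tH (_ : x != v) xA vA; rewrite eq_sym => /(_ vx).
  by case: (_ \notin _); nlia.
have [/junctionP jv|/junctionP nj] := boolP [exists e in H, exists f in H, e :&: f == [set v]].
  by have := degx jv; nlia.
have := @non_junction_degree _ _ _ v tH nj; nlia.
Qed.

(** The deletion loses at most [1 + #|I'|] edges, at most [#|A| - 4], which settles a remainder with
    at most [u2] edges. A comet is treated like the star in [I'_star], with its K_4 counted
    separately. *)
Lemma strict_outside : [\/ star_like H, comet_like A H
  | #|H| <= maxn ('C(#|A| - 5, 2) + 3) (u2 + (#|A| - 4))].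
Proof.
have small : 2 * #|A| - 3 <= 'C(#|A| - 5, 2) + 3.
  have -> : #|A| - 5 = #|A| - 12 + 7 by nlia.
  by rewrite binD (_ : 'C(7, 2) = 21) //; nlia.
have [cE pE] := edges_at_imset x tH; rewrite -/links in cE pE.
case: (IH cardB tJ JH) => [|[K [v [KB K4 vK HK]]]|le]; first exact: I'_star.
  have [vx|vx] := eqVneq v x.
    have xK : x \in K by rewrite -vx.
    have KA : K \subset A by apply: subset_trans KB (subsetDl _ _).
    have K3 : #|K :\ x| = 3 by have := cardsD1 x K; rewrite xK K4 => -[].
    have MI : M \subset (K :\ x) |: [set i |: p | i in I'].
      apply: subset_trans M_J _; rewrite subUset subsetUr andbT.
      apply/subsetP=> e; rewrite inE => /andP[eJ xe]; apply/setU1P; left.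
      have [eH _] := mem_J eJ.
      apply/eqP; rewrite eqEcard K3 (tH eH).1 leqnn andbT subsetD1 xe andbT.
      case: (HK _ eJ) => // eK; have : v \in e :&: K by rewrite eK inE.
      by rewrite inE vx (negbTE xe).
    have leM : #|M| <= 1 + #|I'|.
      apply: leq_trans (subset_leq_card MI) _; rewrite cardsU1.
      have := leq_imset_card (fun i => i |: p) I'; case: (_ \notin _); nlia.
    apply: Or33; rewrite leq_max; apply/orP; left; rewrite HM -cE.
    (* A link pair is [p], one of the three pairs in [K :\ x], or contained in [R]. *)
    pose R := (A :\ x :\: p :\: I') :\: K.
    have leK : #|[set q in links | q \subset K :\ x]| <= 3.
      rewrite -[leqRHS](_ : 'C(#|K :\ x|, 2) = 3) ?K3 // -K3; apply: card_pairs_in => q.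
      by rewrite inE => /andP[/pE[]].
    have leR : #|[set q in links | q \subset R]| <= 'C(#|R|, 2).
      by apply: card_pairs_in => q; rewrite inE => /andP[/pE[]].
    have lel : #|links| <= 4 + 'C(#|R|, 2).
      have sub : links \subset p |: ([set q in links | q \subset K :\ x] :|: [set q in links | q \subset R]).
        apply/subsetP=> q ql; have [e] := imsetP ql; rewrite inE => /andP[eH xe] qE.
        have [ee|ee] := eqVneq e e0; first by rewrite qE ee !inE eqxx.
        rewrite in_setU1 in_setU !inE ql qE /=; apply/orP; right.
        have eJ := at_J eH xe ee; case: (HK _ eJ) => eK; apply/orP; [left | right].
          exact: setSD.
        apply/subsetP=> z ze; rewrite in_setD (subsetP (link_J eH xe ee)) // andbT.
        apply/negP=> zK; move: ze; rewrite in_setD1 => /andP[zx ze].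
        have : z \in e :&: K by rewrite inE ze.
        by rewrite eK vx inE (negbTE zx).
      apply: leq_trans (subset_leq_card sub) _; rewrite cardsU1.
      have := (leq_card_setU [set q in links | q \subset K :\ x] [set q in links | q \subset R]).1.
      case: (_ \notin _); nlia.
    have rj : #|R| + #|I'| <= #|A| - 3.
      have := card_free; have := cardI'.
      have : #|R| <= #|A :\ x :\: p :\: I'| by apply: subset_leq_card; apply: subsetDl.
      nlia.
    have r6 : #|R| <= #|A| - 6.
      have : #|R| <= #|B :\: K|.
        apply: subset_leq_card; apply/subsetP=> z /setDP[/setDP[/setDP[/setD1P[_ zA] zp] _] zK].
        by rewrite in_setD zK; apply/setDP.
      rewrite cardsD (setIidPr KB) cardB K4; nlia.
    have -> : #|A| - 5 = (#|R| + (#|A| - 6 - #|R|)) + 1 by nlia.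
    rewrite !binD (_ : 'C(1, 2) = 0) //.
    have [le|gt] := leqP 2 #|R|.
      have : #|A| - 6 - #|R| <= #|R| * (#|A| - 6 - #|R|) by rewrite leq_pmull; nlia.
      nlia.
    have : 'C(#|A| - 6 - #|R|, 2) >= 2 * (#|A| - 6 - #|R|) - 3.
      have -> : #|A| - 6 - #|R| = (#|A| - 8 - #|R|) + 2 by nlia.
      rewrite binD (_ : 'C(2, 2) = 1) //; nlia.
    nlia.
  (* A comet centred away from [x]: apart from the edge [K :\ v], the remainder is a star at [v], so
     all counts grow by one. *)
  apply: Or33; rewrite leq_max; apply/orP; left.
  have vA : v \in A by apply: (subsetP (subsetDl _ _ : B \subset A)); apply: (subsetP KB).
  have K3 : #|K :\ v| = 3 by have := cardsD1 v K; rewrite vK K4 => -[].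
  have Jv e : e \in J -> v \in e \/ e = K :\ v.
    move=> eJ; have [ve|ve] := boolP (v \in e); [by left | right].
    have [eH _] := mem_J eJ; case: (HK _ eJ) => eK.
      by apply/eqP; rewrite eqEcard K3 (tH eH).1 leqnn andbT subsetD1 ve andbT.
    have : v \in e :&: K by rewrite eK inE.
    by rewrite inE (negbTE ve).
  have leJ : #|J| <= 1 + #|edges_at H v|.
    apply: (@leq_trans #|(K :\ v) |: edges_at H v|).
      apply: subset_leq_card; apply/subsetP=> e eJ; rewrite in_setU1 inE.
      by case: (Jv _ eJ) => [ve|->]; rewrite ?eqxx // ve (subsetP JH) ?orbT.
    by rewrite cardsU1; case: (_ \notin _); nlia.
  suff : #|J| <= #|A| + 1 by have := HJ; have := cardEp; have := cardI'; nlia.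
  have dx : #|edges_at H x| <= 2 + (#|A| - 2).
    apply: (@leq_trans #|e0 |: ((K :\ v) |: edges_at2 H x v)|).
      apply: subset_leq_card; apply/subsetP=> e; rewrite inE => /andP[eH xe].
      have [->|ee] := eqVneq e e0; first by rewrite !inE eqxx.
      rewrite 2!in_setU1 inE eH xe; case: (Jv _ (at_J eH xe ee)) => [->|->].
        by rewrite !orbT.
      by rewrite eqxx orbT.
    rewrite 2!cardsU1; have := codegree_le tH (_ : x != v) xA vA; rewrite eq_sym => /(_ vx).
    by case: (_ \notin _); case: (_ \notin _); nlia.
  have [/junctionP jv|/junctionP nj] := boolP [exists e in H, exists f in H, e :&: f == [set v]].
    by have := degx jv; nlia.
  have := @non_junction_degree _ _ _ v tH nj; nlia.
apply: Or33; rewrite leq_max; apply/orP; right.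
have := HJ; have := cardEp; have := cardI'; nlia.
Qed.

End Outside.

Lemma strict_case (u2 : nat) :
  (forall v, junction H v -> #|edges_at H v| <= #|edges_at H x|) ->
  (forall (B : {set V}) (H' : {set {set V}}), #|B| = #|A| - 2 -> three_graph B H' ->
    H' \subset H -> [\/ star_like H', comet_like B H' | #|H'| <= u2]) ->
  [\/ star_like H, comet_like A H
    | #|H| <= maxn ('C(#|A| - 5, 2) + 3) (u2 + (#|A| - 4))].
Proof.
move=> degx IH.
have [/forall_inP inN|] := boolP [forall g in M, (g \subset N) || (meet g N == 0)].
  have [g gM|s|c|le] := strict_no_outside; first 1 last.
  - exact: Or31.
  - exact: Or32.
  - by apply: Or33; rewrite leq_max le.
  by case/orP: (inN _ gM) => [|/eqP]; [left | right].
rewrite negb_forall_in => /exists_inP[g]; rewrite inE => /andP[gH xg].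
rewrite negb_or -lt0n => /andP[/subsetPn[i ig iN] /meet_gt0P[v [vg /NP[e [eH xe /setD1P[_ ve]]]]]].
exact: (strict_outside eH gH xe xg (link_sub eH gH xe xg ve vg) ig iN).
Qed.

End Strict.

Lemma setU1_pair (V : finType) (g : {set V}) w a b : #|g| = 3 -> w \in g -> a \in g -> b \in g ->
  a != b -> a != w -> b != w -> g = w |: [set a; b].
Proof.
by move=> g3 wg ag bg ab aw bw; rewrite setUA; apply: set3_eq; rewrite // eq_sym.
Qed.

(** * Kites: edges [xac], [xab], [xbd], [acw0] *)

Section Kite.
Variables (V : finType) (A : {set V}) (H : {set {set V}}).
Implicit Types (e f g pi : {set V}) (u w y o : V).
Hypotheses (tH : three_graph A H) (PH : P_free H) (CH : C_free H) (cH : connected_in A H).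
Variables a b c x d w0 : V.
Hypothesis us : uniq [:: a; b; c; x; d; w0].
Hypotheses (E1 : [set x; a; c] \in H) (E2 : [set x; a; b] \in H)
  (E3 : [set x; b; d] \in H) (E4 : [set a; c; w0] \in H).

Let ne := uniq6_neq us.
Let F := [set y in [:: a; b; c; x; d; w0]].
Let pairs : seq {set V} := [:: [set a; c]; [set b; x]].

Let inF y : y \in [:: a; b; c; x; d; w0] -> y \in F.
Proof. by rewrite in_set. Qed.

Let m1 g : meet g [set x; a; c] = (x \in g) + (a \in g) + (c \in g).
Proof. by rewrite meetC meet_set3 ?ne. Qed.
Let m2 g : meet g [set x; a; b] = (x \in g) + (a \in g) + (b \in g).
Proof. by rewrite meetC meet_set3 ?ne. Qed.
Let m3 g : meet g [set x; b; d] = (x \in g) + (b \in g) + (d \in g).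
Proof. by rewrite meetC meet_set3 ?ne. Qed.
Let m4 g : meet g [set a; c; w0] = (a \in g) + (c \in g) + (w0 \in g).
Proof. by rewrite meetC meet_set3 ?ne. Qed.

(** A truth table for the trace of a crossing edge. The implications are [forced_meet] at the
    junction [x] of [E1] and [E3] and at the junction [a] of [E2] and [E4]; the last condition
    excludes a loose path joining the disjoint [E3] and [E4]. *)
Lemma kite_bits (ba bb bc bx bd bw : bool) :
  let n1 := bx + ba + bc in let n2 := bx + ba + bb in
  let n3 := bx + bb + bd in let n4 := ba + bc + bw in
  0 < ba + (bb + (bc + (bx + (bd + bw)))) <= 2 ->
  [&& (~~ bx && (n1 == 1)) ==> (n3 == 2), (~~ bx && (n3 == 1)) ==> (n1 == 2),
      (~~ ba && (n2 == 1)) ==> (n4 == 2), (~~ ba && (n4 == 1)) ==> (n2 == 2)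
    & ~~ ((n3 == 1) && (n4 == 1))] ->
  (ba && bc) || (bb && bx).
Proof. by case: ba; case: bb; case: bc; case: bx; case: bd; case: bw. Qed.

Let i13 : [set x; a; c] :&: [set x; b; d] = [set x].
Proof.
apply/setP=> y; rewrite !inE -!orbA; case: (eqVneq y x) => //= _.
by apply/negP=> /andP[/orP[]/eqP-> ]; rewrite !ne.
Qed.

Let i24 : [set x; a; b] :&: [set a; c; w0] = [set a].
Proof.
apply/setP=> y; rewrite !inE -!orbA; case: (eqVneq y a) => [->|ya] /=; first by rewrite orbT.
by apply/negP=> /andP[/orP[]/eqP-> ]; rewrite !ne.
Qed.

Let crossing g : g \in H -> ~~ (g \subset F) -> 0 < meet g F ->
  exists w pi, [/\ w \in A, w \notin F, pi \in pairs & g = w |: pi].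
Proof.
move=> gH /subsetPn[w wg wF] gF; have [g3 gA] := tH gH.
have wF' : w \notin [:: a; b; c; x; d; w0] by move: wF; rewrite in_set.
have sum2 : (a \in g) + ((b \in g) + ((c \in g) + ((x \in g) + ((d \in g) + (w0 \in g))))) <= 2.
  have := @count_mem_le _ [:: w; a; b; c; x; d; w0] g.
  by rewrite cons_uniq wF' us g3 /= wg addn0 => /(_ isT).
have pos : 0 < (a \in g) + ((b \in g) + ((c \in g) + ((x \in g) + ((d \in g) + (w0 \in g))))).
  have [y [yg]] := meet_gt0P gF; rewrite in_set !inE !addn_gt0 !lt0b.
  by do 5 (case/predU1P=> [<-|]; first by rewrite yg ?orbT); move/eqP <-; rewrite yg ?orbT.
have force e f z : e \in H -> f \in H -> e :&: f = [set z] ->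
    (~~ (z \in g) && (meet g e == 1)) ==> (meet g f == 2).
  move=> eH fH ef; apply/implyP=> /andP[zg /eqP ge]; apply/eqP.
  exact: (forced_meet tH PH CH eH fH gH ef).
have bits : (a \in g) && (c \in g) || (b \in g) && (x \in g).
  apply: (@kite_bits _ _ _ _ (d \in g) (w0 \in g)); first by rewrite pos.
  rewrite -m1 -m2 -m3 -m4 !force //; rewrite ?i13 ?i24 ?[_ :&: [set x; a; c]]setIC
    ?[_ :&: [set x; a; b]]setIC ?i13 ?i24 //=.
  apply/negP=> /andP[/eqP g3' /eqP g4']; apply: (PH E3 E4 gH) => //.
  by rewrite m4 !inE !ne.
have neq y : y \in F -> y != w by move=> yF; apply: contraNneq wF => <-.
case/orP: bits => /andP[y1 y2].
  exists w, [set a; c]; split; [exact: (subsetP gA) | by [] | by rewrite !inE eqxx ?orbT |].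
  by apply: setU1_pair; rewrite ?ne // neq // inF // !inE eqxx ?orbT.
exists w, [set b; x]; split; [exact: (subsetP gA) | by [] | by rewrite !inE eqxx ?orbT |].
by apply: setU1_pair; rewrite ?ne // neq // inF // !inE eqxx ?orbT.
Qed.

Let pairsF pi : pi \in pairs -> pi \subset F.
Proof.
by rewrite !inE => /orP[]/eqP->; rewrite subUset !sub1set !inF // !inE eqxx ?orbT.
Qed.

Let attached w pi g : w \in g -> w \notin F -> pi \in pairs -> w |: pi \in H -> g \in H ->
  0 < meet g F.
Proof.
move=> wg wF piP hH gH; rewrite lt0n; apply/negP=> /eqP m0.
have out y : y \in F -> (y \in g) = false.
  by move=> yF; apply/negbTE; apply: contraL yF => yg; apply: meet0_notin m0 yg.
have inF' y : y \in [:: a; b; c; x; d; w0] -> (y \in g) = false by move/inF/out.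
have wne y : y \in [:: a; b; c; x; d; w0] -> (y == w) = false.
  by move=> /inF yF; apply/negbTE; apply: contraNneq wF => <-.
have mh : meet (w |: pi) g = 1.
  rewrite -(cards1 w); congr #|pred_of_set _|; apply/setP=> y; rewrite !inE.
  case: eqP => [->|_] /=; first by rewrite wg.
  apply/negP=> /andP[ypi]; apply/negP/negbT/out.
  exact: (subsetP (pairsF piP)).
move: piP hH mh; rewrite !inE => /orP[]/eqP-> hH mh.
  apply: (PH gH E2 hH) => //; first by rewrite m2 !inF' // !inE eqxx ?orbT.
  by rewrite m2 !inE !ne !wne ?eqxx // !inE eqxx ?orbT.
apply: (PH gH E1 hH) => //; first by rewrite m1 !inF' // !inE eqxx ?orbT.
by rewrite m1 !inE !ne !wne ?eqxx // !inE eqxx ?orbT.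
Qed.

(** At most 15 edges lie inside the six vertices of the kite, by [card_C_free6], and each of the
    [#|A| - 6] other vertices has only two possible crossing edges. *)
Lemma kite_bound : 6 <= #|A| -> #|H| <= 2 * #|A| + 3.
Proof.
move=> A6; have F6 : #|F| = 6 by rewrite cardsE (card_uniqP us).
have FA : F \subset A.
  have [[s1 s2] [s3 s4]] := ((subsetP (tH E1).2, subsetP (tH E2).2),
                             (subsetP (tH E3).2, subsetP (tH E4).2)).
  apply/subsetP=> y; rewrite in_set !inE.
  case/or4P=> [/eqP->|/eqP->|/eqP->|/or3P[]/eqP->].
  + by apply: s1; rewrite !inE eqxx ?orbT.
  + by apply: s2; rewrite !inE eqxx ?orbT.
  + by apply: s1; rewrite !inE eqxx ?orbT.
  + by apply: s1; rewrite !inE eqxx ?orbT.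
  + by apply: s3; rewrite !inE eqxx ?orbT.
  + by apply: s4; rewrite !inE eqxx ?orbT.
have F0 : F != set0 by rewrite -card_gt0 F6.
have edges := attached_edges tH cH FA F0 pairsF crossing attached.
have sub : H \subset [set e in H | e \subset F] :|:
    ([set w |: [set a; c] | w in A :\: F] :|: [set w |: [set b; x] | w in A :\: F]).
  apply/subsetP=> e eH; rewrite in_setU; have [eF|[w [pi [wA wF piP eE]]]] := edges _ eH.
    by rewrite inE eH eF.
  apply/orP; right; rewrite in_setU; have wW : w \in A :\: F by rewrite in_setD wF.
  move: piP eE; rewrite !inE => /orP[]/eqP-> ->.
    by rewrite (imset_f (fun w => w |: [set a; c]) wW).
  by rewrite (imset_f (fun w => w |: [set b; x]) wW) orbT.
have := card_C_free6 tH CH F6; have := subset_leq_card sub.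
have := (leq_card_setU [set e in H | e \subset F]
  ([set w |: [set a; c] | w in A :\: F] :|: [set w |: [set b; x] | w in A :\: F])).1.
have := (leq_card_setU [set w |: [set a; c] | w in A :\: F] [set w |: [set b; x] | w in A :\: F]).1.
have := leq_imset_card (fun w => w |: [set a; c]) (A :\: F).
have := leq_imset_card (fun w => w |: [set b; x]) (A :\: F).
rewrite cardsD (setIidPr FA) F6; nlia.
Qed.

End Kite.

Lemma uniq5_neq (T : eqType) (a b c d e : T) : uniq [:: a; b; c; d; e] ->
  ((a == b = false) * (a == c = false) * (a == d = false) * (a == e = false) *
   (b == c = false) * (b == d = false) * (b == e = false) *
   (c == d = false) * (c == e = false) * (d == e = false)) *
  ((b == a = false) * (c == a = false) * (d == a = false) * (e == a = false) *
   (c == b = false) * (d == b = false) * (e == b = false) *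
   (d == c = false) * (e == c = false) * (e == d = false)).
Proof.
rewrite /= !inE !negb_or -!andbA.
repeat (case/andP=> /negbTE ?); move=> _.
by do !split; first [assumption | rewrite eq_sym; assumption].
Qed.

(** * Twins: two vertices of one edge sharing a link pair outside it *)

Section TwinPair.
Variables (V : finType) (A : {set V}) (H : {set {set V}}).
Implicit Types (e f g h pi : {set V}) (u v w y o : V).
Hypotheses (tH : three_graph A H) (PH : P_free H) (CH : C_free H) (cH : connected_in A H).
Hypothesis A12 : 12 <= #|A|.
Variables x z t q1 q2 : V.
Hypothesis us : uniq [:: x; z; t; q1; q2].
Hypotheses (E1 : [set x; z; t] \in H) (E2 : [set x; q1; q2] \in H)
  (E3 : [set z; q1; q2] \in H).
Variable u3 : nat.
Hypothesis degx : forall v, junction H v -> #|edges_at H v| <= #|edges_at H x|.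
Hypothesis IH : forall (B : {set V}) (H' : {set {set V}}), #|B| = #|A| - 3 ->
  three_graph B H' -> H' \subset H ->
  [\/ star_like H', comet_like B H' | #|H'| <= u3].

Let ne := uniq5_neq us.
Let F := [set y in [:: x; z; t; q1; q2]].
Let sides : seq {set V} := [:: [set x; t]; [set z; t]; [set x; z]].
Let q := [set q1; q2].

Let inF y : y \in [:: x; z; t; q1; q2] -> y \in F.
Proof. by rewrite in_set. Qed.

Let F5 : #|F| = 5.
Proof. by rewrite cardsE (card_uniqP us). Qed.

Let m1 g : meet g [set x; z; t] = (x \in g) + (z \in g) + (t \in g).
Proof. by rewrite meetC meet_set3 ?ne. Qed.
Let m2 g : meet g [set x; q1; q2] = (x \in g) + (q1 \in g) + (q2 \in g).
Proof. by rewrite meetC meet_set3 ?ne. Qed.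
Let m3 g : meet g [set z; q1; q2] = (z \in g) + (q1 \in g) + (q2 \in g).
Proof. by rewrite meetC meet_set3 ?ne. Qed.

(** The implications are [forced_meet] at the junctions [x] of [E1], [E2] and [z] of [E1], [E3]. *)
Lemma twin_bits (bx bz bt b1 b2 : bool) :
  let n1 := bx + bz + bt in let n2 := bx + b1 + b2 in let n3 := bz + b1 + b2 in
  0 < bx + (bz + (bt + (b1 + b2))) <= 2 ->
  [&& (~~ bx && (n1 == 1)) ==> (n2 == 2), (~~ bx && (n2 == 1)) ==> (n1 == 2),
      (~~ bz && (n1 == 1)) ==> (n3 == 2) & (~~ bz && (n3 == 1)) ==> (n1 == 2)] ->
  [|| bx && bt, bz && bt, bx && bz | b1 && b2].
Proof. by case: bx; case: bz; case: bt; case: b1; case: b2. Qed.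

Let i12 : [set x; z; t] :&: [set x; q1; q2] = [set x].
Proof.
apply/setP=> y; rewrite !inE -!orbA; case: (eqVneq y x) => //= _.
by apply/negP=> /andP[/orP[]/eqP-> ]; rewrite !ne.
Qed.

Let i13 : [set x; z; t] :&: [set z; q1; q2] = [set z].
Proof.
apply/setP=> y; rewrite !inE -!orbA; case: (eqVneq y z) => [->|ya] /=; first by rewrite orbT.
by apply/negP=> /andP[/orP[]/eqP-> ]; rewrite !ne.
Qed.

Let crossing g : g \in H -> ~~ (g \subset F) -> 0 < meet g F ->
  exists w pi, [/\ w \in A, w \notin F, pi \in rcons sides q & g = w |: pi].
Proof.
move=> gH /subsetPn[w wg wF] gF; have [g3 gA] := tH gH.
have wF' : w \notin [:: x; z; t; q1; q2] by move: wF; rewrite in_set.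
have sum2 : (x \in g) + ((z \in g) + ((t \in g) + ((q1 \in g) + (q2 \in g)))) <= 2.
  have := @count_mem_le _ [:: w; x; z; t; q1; q2] g.
  by rewrite cons_uniq wF' us g3 /= wg addn0 => /(_ isT).
have pos : 0 < (x \in g) + ((z \in g) + ((t \in g) + ((q1 \in g) + (q2 \in g)))).
  have [y [yg]] := meet_gt0P gF; rewrite in_set !inE !addn_gt0 !lt0b.
  by do 4 (case/predU1P=> [<-|]; first by rewrite yg ?orbT); move/eqP <-; rewrite yg ?orbT.
have force e f v : e \in H -> f \in H -> e :&: f = [set v] ->
    (~~ (v \in g) && (meet g e == 1)) ==> (meet g f == 2).
  move=> eH fH ef; apply/implyP=> /andP[vg /eqP ge]; apply/eqP.
  exact: (forced_meet tH PH CH eH fH gH ef).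
have bits : [|| (x \in g) && (t \in g), (z \in g) && (t \in g), (x \in g) && (z \in g)
    | (q1 \in g) && (q2 \in g)].
  apply: twin_bits; first by rewrite pos.
  rewrite -m1 -m2 -m3 !force //; rewrite ?i12 ?i13 ?[_ :&: [set x; z; t]]setIC
    ?i12 ?i13 //=.
have neq y : y \in F -> y != w by move=> yF; apply: contraNneq wF => <-.
have mk y1 y2 : y1 \in F -> y2 \in F -> y1 != y2 -> [set y1; y2] \in rcons sides q ->
    (y1 \in g) && (y2 \in g) ->
    exists w pi, [/\ w \in A, w \notin F, pi \in rcons sides q & g = w |: pi].
  move=> y1F y2F y12 pT /andP[y1g y2g]; exists w, [set y1; y2].
  by split=> //; [exact: (subsetP gA) | apply: setU1_pair; rewrite ?neq].
case/or4P: bits; apply: mk; rewrite ?ne // ?inF // ?mem_rcons !inE ?eqxx ?orbT //.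
Qed.

Let sidesF pi : pi \in rcons sides q -> pi \subset F.
Proof.
by rewrite mem_rcons !inE => /or4P[]/eqP->; rewrite subUset !sub1set !inF // !inE eqxx ?orbT.
Qed.

Let m_out e w pi : w \notin F -> e \subset F -> meet e (w |: pi) = meet e pi.
Proof.
move=> wF eF; congr #|pred_of_set _|; rewrite setIUr.
have -> : e :&: [set w] = set0; last by rewrite set0U.
apply/eqP; rewrite -subset0; apply/subsetP=> y; rewrite !inE => /andP[ye /eqP yw].
by rewrite -yw (subsetP eF) in wF.
Qed.

Let EF : [/\ [set x; z; t] \subset F, [set x; q1; q2] \subset F & [set z; q1; q2] \subset F].
Proof. by split; rewrite !subUset !sub1set !inF // !inE eqxx ?orbT. Qed.

Let FA : F \subset A.
Proof.
have [[s1 s2] s3] := (subsetP (tH E1).2, subsetP (tH E2).2, subsetP (tH E3).2).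
apply/subsetP=> y; rewrite in_set !inE.
case/or4P=> [/eqP->|/eqP->|/eqP->|/orP[]/eqP->].
+ by apply: s1; rewrite !inE eqxx ?orbT.
+ by apply: s1; rewrite !inE eqxx ?orbT.
+ by apply: s1; rewrite !inE eqxx ?orbT.
+ by apply: s2; rewrite !inE eqxx ?orbT.
+ by apply: s2; rewrite !inE eqxx ?orbT.
Qed.

Let cnt2 h y1 y2 : y1 != y2 -> meet h [set y1; y2] = (y1 \in h) + (y2 \in h).
Proof.
move=> y12; have -> : h :&: [set y1; y2] = [set y in [seq y <- [:: y1; y2] | y \in h]].
  by apply/setP=> y; rewrite !inE mem_filter !inE.
rewrite cardsE; have /card_uniqP -> : uniq [seq y <- [:: y1; y2] | y \in h].
  by rewrite filter_uniq //= !inE y12.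
by rewrite size_filter /= addn0.
Qed.

Let meet_outer w1 w2 pi1 pi2 : w1 != w2 -> w1 \notin F -> w2 \notin F ->
  pi1 \subset F -> pi2 \subset F -> (w1 |: pi1) :&: (w2 |: pi2) = pi1 :&: pi2.
Proof.
move=> w12 w1F w2F p1 p2; apply/setP=> y; rewrite !inE.
have out w pi : w \notin F -> pi \subset F -> (w \in pi) = false.
  by move=> wF piF; apply: contraNF wF; apply: (subsetP piF).
case: (eqVneq y w1) => [->|_] /=; first by rewrite (negbTE w12) (out _ _ w1F p1) (out _ _ w1F p2).
by case: (eqVneq y w2) => [->|_] //=; rewrite (out _ _ w2F p1) (out _ _ w2F p2).
Qed.

Let sides_clash w1 w2 pi1 pi2 h v : w1 != w2 -> w1 \notin F -> w2 \notin F ->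
  pi1 \in sides -> pi2 \in sides -> w1 |: pi1 \in H -> w2 |: pi2 \in H ->
  h \in H -> h \subset F -> pi1 :&: pi2 = [set v] -> v \notin h ->
  meet h pi1 = 1 -> meet h pi2 = 0 -> False.
Proof.
move=> w12 w1F w2F s1 s2 h1 h2 hH hF pv vh mh1 mh2.
have p1 : pi1 \subset F by apply: sidesF; rewrite mem_rcons inE s1 orbT.
have p2 : pi2 \subset F by apply: sidesF; rewrite mem_rcons inE s2 orbT.
have := @forced_meet _ A H (w1 |: pi1) (w2 |: pi2) h v tH PH CH h1 h2 hH.
by rewrite meet_outer // !m_out // mh1 mh2 => /(_ pv vh erefl).
Qed.

(** Two different sides have one common vertex, so crossing edges over them with different outside
    vertices meet only there. Then [E2] or [E3] avoids that vertex, meets one of the two edges once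
    and misses the other, against [forced_meet]. *)
Let same_side w1 w2 pi1 pi2 : w1 != w2 -> w1 \notin F -> w2 \notin F ->
  pi1 \in sides -> pi2 \in sides -> w1 |: pi1 \in H -> w2 |: pi2 \in H -> pi1 = pi2.
Proof.
have [F1 F2 F3] := EF.
have Ixt : [set x; t] :&: [set z; t] = [set t].
  apply/setP=> y; rewrite !inE; case: (eqVneq y t) => [->|_]; first by rewrite !orbT.
  by rewrite !orbF; apply/negP=> /andP[/eqP->]; rewrite ne.
have Ix : [set x; z] :&: [set x; t] = [set x].
  apply/setP=> y; rewrite !inE; case: (eqVneq y x) => //= _.
  by apply/negP=> /andP[/eqP->]; rewrite ne.
have Iz : [set x; z] :&: [set z; t] = [set z].
  apply/setP=> y; rewrite !inE; case: (eqVneq y z) => [->|_]; first by rewrite orbT.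
  by rewrite orbF; apply/negP=> /andP[/eqP->]; rewrite !ne.
have C1 u1 v1 : u1 != v1 -> u1 \notin F -> v1 \notin F ->
    u1 |: [set x; t] \in H -> v1 |: [set z; t] \in H -> False.
  move=> uv uF vF h1 h2; apply: (sides_clash uv uF vF _ _ h1 h2 E2 F2 Ixt);
    by rewrite ?cnt2 ?ne // ?inE ?ne ?eqxx ?orbT.
have C2 u1 v1 : u1 != v1 -> u1 \notin F -> v1 \notin F ->
    u1 |: [set x; z] \in H -> v1 |: [set x; t] \in H -> False.
  move=> uv uF vF h1 h2; apply: (sides_clash uv uF vF _ _ h1 h2 E3 F3 Ix);
    by rewrite ?cnt2 ?ne // ?inE ?ne ?eqxx ?orbT.
have C3 u1 v1 : u1 != v1 -> u1 \notin F -> v1 \notin F ->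
    u1 |: [set x; z] \in H -> v1 |: [set z; t] \in H -> False.
  move=> uv uF vF h1 h2; apply: (sides_clash uv uF vF _ _ h1 h2 E2 F2 Iz);
    by rewrite ?cnt2 ?ne // ?inE ?ne ?eqxx ?orbT.
move=> w12 w1F w2F; have w21 : w2 != w1 by rewrite eq_sym.
rewrite !inE => /or3P[]/eqP-> /or3P[]/eqP-> h1 h2 //; exfalso.
- exact: (C1 w1 w2).
- exact: (C2 w2 w1).
- exact: (C1 w2 w1).
- exact: (C3 w2 w1).
- exact: (C2 w1 w2).
- exact: (C3 w1 w2).
Qed.

Let Pi := [set g : {set V} in H | ~~ (g \subset F) && has (fun pi : {set V} => pi \subset g) sides].

Let PiP g : g \in Pi -> exists w pi,
  [/\ w \in A, w \notin F, pi \in sides, w |: pi \in H & g = w |: pi].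
Proof.
rewrite inE => /and3P[gH /subsetPn[w wg wF] /hasP[pi piS pig]].
have piF : pi \subset F by apply: sidesF; rewrite mem_rcons inE piS orbT.
have pi2 : #|pi| = 2.
  by move: piS; rewrite !inE => /or3P[]/eqP->; rewrite cards2 ne.
have gE : g = w |: pi.
  apply/eqP; rewrite eq_sym eqEcard subUset sub1set wg pig (tH gH).1 cardsU1 pi2.
  by rewrite (contra _ wF) //; apply: (subsetP piF).
by exists w, pi; split; rewrite -?gE // (subsetP (tH gH).2).
Qed.

Let card_out : #|A :\: F| = #|A| - 5.
Proof. by rewrite cardsD (setIidPr FA) F5. Qed.

(** Either all these edges share one outside vertex, and there are at most three, or [same_side]
    puts them all over one side. *)
Let card_Pi : #|Pi| <= #|A| - 5.
Proof.
have [->|/set0Pn[g1 /PiP[w1 [pi1 [_ w1F s1 h1 _]]]]] := eqVneq Pi set0; first by rewrite cards0.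
have [/forall_inP all1|] := boolP [forall g in Pi, w1 \in g].
  apply: (@leq_trans 3); last by nlia.
  apply: leq_trans (card_size sides); rewrite -[leqRHS](@cardsE _ (mem sides)).
  apply: (@card_sub_imset _ _ (fun pi : {set V} => w1 |: pi)) => g gPi.
  have [w [pi [_ wF piS _ gE]]] := PiP gPi; exists pi; first by rewrite inE.
  rewrite gE; congr (_ |: _); have := all1 _ gPi; rewrite gE => /setU1P[->//|w1pi].
  have piF : pi \subset F by apply: sidesF; rewrite mem_rcons inE piS orbT.
  by rewrite (subsetP piF) in w1F.
rewrite negb_forall_in => /exists_inP[g2 g2Pi w1g2].
have [w2 [pi2 [_ w2F s2 h2 g2E]]] := PiP g2Pi.
have w12 : w1 != w2 by apply: contraNneq w1g2 => ->; rewrite g2E setU11.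
have p12 := same_side w12 w1F w2F s1 s2 h1 h2.
rewrite -card_out; apply: (@card_sub_imset _ _ (fun w => w |: pi1)) => g gPi.
have [w [pi [wA wF piS hH gE]]] := PiP gPi; exists w; first by rewrite in_setD wF.
rewrite gE; congr (_ |: _); have [ww|ww] := eqVneq w w1; last exact: same_side ww wF w1F piS s1 hH h1.
by rewrite p12; apply: (same_side _ wF w2F piS s2 hH h2); rewrite ww.
Qed.

Let HF := [set g in H | g \subset F].
Let HQ := [set w |: q | w in A :\: F].
Let Out := [set g in H | meet g F == 0].

Let split_H : H \subset HF :|: Pi :|: HQ :|: Out.
Proof.
apply/subsetP=> g gH; rewrite !in_setU.
have [gF|gF] := boolP (g \subset F); first by rewrite inE gH gF.
have [m0|mpos] := posnP (meet g F); first by rewrite [g \in Out]inE gH m0 eqxx !orbT.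
have [w [pi [wA wF]]] := crossing gH gF mpos.
rewrite mem_rcons inE => /orP[/eqP->|piS] gE.
  have wW : w \in A :\: F by rewrite in_setD wF.
  by rewrite gE (imset_f (fun w => w |: q) wW) !orbT.
rewrite [g \in Pi]inE gH gF; have -> : has (fun pi : {set V} => pi \subset g) sides.
  by apply/hasP; exists pi; rewrite // gE subsetUr.
by rewrite orbT.
Qed.

Let card_HQ : #|HQ| <= #|A| - 5.
Proof. by rewrite -card_out leq_imset_card. Qed.

(* If an edge outside [F] shares a vertex with a crossing edge, that one
   contains [q], and the edges inside [F] meet [q] in 0 or 2 vertices. *)
Let outer_attached w pi f : w \in f -> w \notin F -> pi \in rcons sides q ->
  w |: pi \in H -> f \in H -> meet f F = 0 ->
  pi = q /\ forall h, h \in H -> h \subset F -> meet h q != 1.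
Proof.
move=> wf wF piS hH fH m0; have piF := sidesF piS.
have [F1 F2 F3] := EF.
have fg : (w |: pi) :&: f = [set w].
  apply/setP=> y; rewrite !inE; case: eqP => [->|_] /=; first by rewrite wf.
  by apply/negP=> /andP[/(subsetP piF) yF yf]; rewrite (negbTE (meet0_notin m0 yf)) in yF.
have no1 h : h \in H -> h \subset F -> meet h pi != 1.
  move=> hH' hF; apply/negP=> /eqP mh.
  have wh : w \notin h by apply: contra wF; apply: (subsetP hF).
  have := forced_meet tH PH CH hH fH hH' fg wh; rewrite m_out // => /(_ mh).
  suff -> : meet h f = 0 by [].
  apply/eqP; rewrite -leqn0 -m0 meetC; apply: subset_leq_card.
  exact: setIS.
have pq : pi = q.
  move: piS no1; rewrite mem_rcons !inE => /or4P[]/eqP-> // no1.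
  - by have := no1 _ E2 F2; rewrite cnt2 ?ne // !inE !ne !eqxx.
  - by have := no1 _ E3 F3; rewrite cnt2 ?ne // !inE !ne !eqxx.
  - by have := no1 _ E2 F2; rewrite cnt2 ?ne // !inE !ne !eqxx.
by split=> // h; rewrite -pq; apply: no1.
Qed.

Let card_HF : #|HF| <= 10.
Proof.
have -> : 10 = 'C(#|F|, 3) by rewrite F5.
rewrite -cards_draws; apply: subset_leq_card.
by apply/subsetP=> g; rewrite !inE => /andP[gH ->]; rewrite (tH gH).1.
Qed.

(** If no edge disjoint from [F] reaches a crossing edge, all edges are inside or crossing, at most
    10 + 2 ([#|A|] - 5). Otherwise [outer_attached] leaves only four edges inside [F], and deleting
    [x], [z], [t] loses at most 4 + ([#|A|] - 5) edges. *)
Lemma twin_bound : #|H| <= maxn (2 * #|A|) (u3 + (#|A| - 1)).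
Proof.
rewrite leq_max.
have le4 (P Q R S : {set {set V}}) : #|P :|: Q :|: R :|: S| <= #|P| + #|Q| + #|R| + #|S|.
  have := (leq_card_setU (P :|: Q :|: R) S).1; have := (leq_card_setU (P :|: Q) R).1.
  by have := (leq_card_setU P Q).1; nlia.
have [[f [w [pi [fH m0 wf piS hH]]]]|natt] :
  (exists f w pi, [/\ f \in H, meet f F = 0, w \in f, pi \in rcons sides q & w |: pi \in H]) \/
  (forall f w pi, f \in H -> meet f F = 0 -> w \in f -> pi \in rcons sides q -> w |: pi \notin H).
- have [/existsP[f /existsP[w /existsP[pi /and5P[fH /eqP m0 wf piS hH]]]]|n] :=
    boolP [exists f : {set V}, exists w : V, exists pi : {set V},
      [&& f \in H, meet f F == 0, w \in f, pi \in rcons sides q & w |: pi \in H]].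
    by left; exists f, w, pi.
  right=> f w pi fH m0 wf piS; apply: contra n => hH.
  by apply/existsP; exists f; apply/existsP; exists w; apply/existsP; exists pi; rewrite fH m0 wf piS hH.
- have wF := meet0_notin m0 wf.
  have [_ HFq] := outer_attached wf wF piS hH fH m0.
  pose D := [set x; z; t].
  have DA : D \subset A := (tH E1).2.
  have D3 : #|D| = 3 := (tH E1).1.
  pose J := [set g in H | meet g D == 0].
  have JH : J \subset H by apply/subsetP=> g; rewrite inE => /andP[].
  have tJ : three_graph (A :\: D) J.
    move=> g; rewrite inE => /andP[gH /eqP mD]; have [g3 gA] := tH gH; split=> //.
    by apply/subsetP=> y yg; rewrite in_setD (meet0_notin mD yg) (subsetP gA).
  have cB : #|A :\: D| = #|A| - 3 by rewrite cardsD (setIidPr DA) D3.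
  have qD y : y \in F -> y \notin D -> y \in q.
    by rewrite in_set !inE => /or4P[/eqP->|/eqP->|/eqP->|/orP[]/eqP->]; rewrite ?eqxx ?orbT.
  have meetD g : g \in H -> meet g D != 0 -> g \in HF :|: Pi.
    move=> gH gD; have := subsetP split_H _ gH; rewrite !in_setU.
    have [//|no] := boolP ((g \in HF) || (g \in Pi)); case/orP=> [|gO].
      case/imsetP=> u; rewrite in_setD => /andP[uF _] gE; case/negP: gD.
      rewrite gE cards_eq0 -subset0; apply/subsetP=> y; rewrite in_setI => /andP[].
      case/setU1P=> [->|yq] yD.
        have [F1 _ _] := EF; by rewrite (subsetP F1) in uF.
      by move: yq yD; rewrite !inE => /orP[]/eqP->; rewrite !ne.
    case/negP: gD; move: gO; rewrite inE => /andP[_ /eqP mF].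
    by rewrite -leqn0 -mF; apply: subset_leq_card; apply: setIS; case: EF.
  (* An edge inside [F] with 0 or 2 vertices in [q] is [D] itself or [q] with one vertex of [D]. *)
  have HF4 : #|HF| <= 4.
    apply: (@leq_trans #|[set D; x |: q; z |: q; t |: q]|); last first.
      by rewrite -!setUA !cardsU1 cards1; do 3 case: (_ \notin _).
    apply: subset_leq_card; apply/subsetP=> g; rewrite inE => /andP[gH gF].
    have qc : #|q| = 2 by rewrite cards2 ne.
    have := HFq _ gH gF; case mg : (meet g q) => [|[|[|n]]] // _.
    - suff -> : g = D by rewrite !inE eqxx.
      apply/eqP; rewrite eqEcard D3 (tH gH).1 andbT; apply/subsetP=> y yg.
      by apply: contraT => yD; have := meet0_notin mg yg; rewrite qD // (subsetP gF).
    - have qg : q \subset g.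
        by apply/setIidPl/eqP; rewrite eqEcard subsetIl qc setIC mg.
      have /card_gt0P[y] : 0 < #|g :\: q| by rewrite cardsD (setIidPr qg) qc (tH gH).1.
      rewrite in_setD => /andP[yq yg].
      have gE : g = y |: q.
        apply/eqP; rewrite eq_sym eqEcard subUset sub1set yg qg (tH gH).1.
        by rewrite cardsU1 yq qc.
      have yD : y \in D by apply: contraT => yD; rewrite qD // (subsetP gF) in yq.
      by move: yD; rewrite !inE -orbA => /or3P[]/eqP yE; rewrite gE yE ?inE eqxx ?orbT.
    have := subset_leq_card (subsetIr g q); by rewrite mg qc.
  have HJ : #|H| <= 4 + (#|A| - 5) + #|J|.
    have sub : H \subset HF :|: Pi :|: J.
      apply/subsetP=> g gH; rewrite in_setU; have [gD|gD] := eqVneq (meet g D) 0.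
        by rewrite [g \in J]inE gH gD eqxx orbT.
      by rewrite meetD.
    have := subset_leq_card sub; have := (leq_card_setU (HF :|: Pi) J).1.
    have := (leq_card_setU HF Pi).1; have := card_Pi; nlia.
  (* The edges at [x] are [D], [x |: q] and members of [Pi]. The degree of [x] bounds that of every
     junction, so all degrees are at most [#|A| - 2], and a star or comet left in [J] is small. *)
  have dx : #|edges_at H x| <= #|A| - 3.
    have sub : edges_at H x \subset [set D; x |: q] :|: Pi.
      apply/subsetP=> g; rewrite inE => /andP[gH xg].
      have gD : meet g D != 0 by rewrite -lt0n; apply: (meet_gt0 xg); rewrite !inE eqxx.
      have := meetD _ gH gD; rewrite !in_setU => /orP[gHF|->]; last by rewrite orbT.
      move: gHF; rewrite inE => /andP[_ gF].
      have := HFq _ gH gF; have qc : #|q| = 2 by rewrite cards2 ne.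
      case mg : (meet g q) => [|[|[|n]]] // _.
      - suff -> : g = D by rewrite !inE eqxx.
        apply/eqP; rewrite eqEcard D3 (tH gH).1 andbT; apply/subsetP=> y yg.
        by apply: contraT => yD; have := meet0_notin mg yg; rewrite qD // (subsetP gF).
      - have qg : q \subset g.
          by apply/setIidPl/eqP; rewrite eqEcard subsetIl qc setIC mg.
        suff -> : g = x |: q by rewrite !inE eqxx orbT.
        apply/eqP; rewrite eq_sym eqEcard subUset sub1set xg qg (tH gH).1.
        by rewrite cardsU1 qc !inE !ne.
      have := subset_leq_card (subsetIr g q); by rewrite mg qc.
    have := subset_leq_card sub; have := (leq_card_setU [set D; x |: q] Pi).1.
    have := card_Pi; have : #|[set D; x |: q]| <= 2 by rewrite cards2; case: (_ != _).
    nlia.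
  have deg v : #|edges_at H v| <= #|A| - 2.
    have [/junctionP jv|/junctionP nj] := boolP [exists e in H, exists f in H, e :&: f == [set v]].
      by have := degx jv; nlia.
    by apply: (non_junction_degree tH nj); nlia.
  case: (IH cB tJ JH) => [[v Jv]|[K [v [KB K4 vK HK]]]|le].
  + have : #|J| <= #|edges_at H v|.
      apply: subset_leq_card; apply/subsetP=> e eJ.
      by rewrite inE Jv // (subsetP JH).
    have := deg v; nlia.
  + have K3 : #|K :\ v| = 3 by have := cardsD1 v K; rewrite vK K4 => -[].
    have : #|J| <= 1 + #|edges_at H v|.
      apply: (@leq_trans #|(K :\ v) |: edges_at H v|).
        apply: subset_leq_card; apply/subsetP=> e eJ; rewrite in_setU1 inE.
        have eH := subsetP JH _ eJ; rewrite eH.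
        have [ve|ve] := boolP (v \in e); first by rewrite orbT.
        case: (HK _ eJ) => eK.
          rewrite orbF eqEcard K3 (tH eH).1 leqnn andbT subsetD1 ve andbT //.
        have : v \in e :&: K by rewrite eK inE.
        by rewrite inE (negbTE ve).
      by rewrite cardsU1; case: (_ \notin _); nlia.
    have := deg v; nlia.
  + by apply/orP; right; nlia.
- have att w pi g : w \in g -> w \notin F -> pi \in rcons sides q -> w |: pi \in H -> g \in H ->
      0 < meet g F.
    move=> wg wF piS hH gH; rewrite lt0n; apply/negP=> /eqP m0.
    by case/negP: (natt _ _ _ gH m0 wg piS).
  have F0 : F != set0 by rewrite -card_gt0 F5.
  have edges := attached_edges tH cH FA F0 sidesF crossing att.
  have O0 : #|Out| = 0.
    apply: eq_card0 => g; rewrite !inE; apply/negP=> /andP[gH /eqP m0].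
    have g0 : 0 < #|g| by rewrite (tH gH).1.
    have [y yg] := card_gt0P g0; have yF := meet0_notin m0 yg.
    have [gF|[w [pi [_ wF piS gE]]]] := edges _ gH; first by rewrite (subsetP gF) in yF.
    have wg : w \in g by rewrite gE setU11.
    have : w |: pi \in H by rewrite -gE.
    by apply/negP; apply: natt gH m0 wg piS.
  apply/orP; left; have := subset_leq_card split_H; have := le4 HF Pi HQ Out.
  have := card_HF; have := card_Pi; have := card_HQ; nlia.
Qed.

End TwinPair.

(** * Classification of the large path-free 3-graphs *)

(* The third Turan number, less one at 12. *)
Definition third_bound m :=
  if m <= 11 then 3 * m - 8 else if m <= 12 then 31 else if m <= 13 then 35
  else if m <= 14 then 41 else 4 + 'C(m - 5, 2).

(** The first number: all triples up to six vertices, K_6 and an isolated vertex at seven, where a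
    star has only 15 edges, and the full star from eight on. *)
Definition first_bound m :=
  if m <= 6 then 'C(m, 3) else if m <= 7 then 20 else 'C(m - 1, 2).

Lemma bin2_shift c d k : 'C(c, 2) = d -> 'C(k + c, 2) = 'C(k, 2) + d + k * c.
Proof. by move=> <-; rewrite binD. Qed.

Lemma first_boundE m : 8 <= m -> first_bound m = 'C(m - 1, 2).
Proof. by move=> m8; rewrite /first_bound !ifN // -ltnNge; nlia. Qed.

Lemma third_boundE m : 15 <= m -> third_bound m = 4 + 'C(m - 5, 2).
Proof. by move=> m15; rewrite /third_bound !ifN // -ltnNge; nlia. Qed.

Lemma first_bound_ge m : 7 <= m ->
  [&& 'C(m - 1, 2) <= first_bound m, 4 + 'C(m - 4, 2) <= first_bound m,
      20 + first_bound (m - 6) <= first_bound m, 4 + 'C(m - 5, 2) <= first_bound m,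
      3 * m - 8 <= first_bound m & third_bound m <= first_bound m].
Proof.
move=> m7; have [m15|m15] := ltnP m 15.
  apply: (allP (_ : all (fun m => [&& 'C(m - 1, 2) <= first_bound m,
    4 + 'C(m - 4, 2) <= first_bound m, 20 + first_bound (m - 6) <= first_bound m,
    4 + 'C(m - 5, 2) <= first_bound m, 3 * m - 8 <= first_bound m &
    third_bound m <= first_bound m]) (iota 7 8))); first by vm_compute.
  by rewrite mem_iota m7.
rewrite third_boundE // !first_boundE //; try nlia.
have -> : m = m - 15 + 15 by rewrite subnK.
move: (m - 15) => k.
have -> : k + 15 - 1 = k + 14 by nlia.
have -> : k + 15 - 4 = k + 11 by nlia.
have -> : k + 15 - 6 - 1 = k + 8 by nlia.
have -> : k + 15 - 5 = k + 10 by nlia.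
rewrite (@bin2_shift 14 91) // (@bin2_shift 11 55) // (@bin2_shift 8 28) //.
rewrite (@bin2_shift 10 45) //; move: 'C(k, 2) => a.
by apply/and5P; split; try (apply/andP; split); nlia.
Qed.

Section Classification.
Variable V : finType.
Implicit Types (A B K : {set V}) (H : {set {set V}}) (e f g : {set V}) (v x c : V).

Definition K4_star_like A H := exists K c, [/\ K \subset A, #|K| = 4, c \notin K
  & forall e, e \in H -> e \subset K \/ meet e K = 0 /\ c \in e].

(** [G1_like] and [G2_like] do not confine the standard 3-graph to [A], so the bound in terms of [A]
    is recorded beside them. *)
Inductive classified A H : Prop :=
| ClassStar of star_like H
| ClassComet of comet_like A H
| ClassK6 of K6_like A H
| ClassK4Star of K4_star_like A H
| ClassG of #|H| <= 3 * #|A| - 8 & G1_like H \/ G2_like H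
| ClassSmall of #|H| < third_bound #|A|.

Definition inside H B : {set {set V}} := [set e in H | e \subset B].

Lemma card_inside A H B : three_graph A H -> #|inside H B| <= 'C(#|B|, 3).
Proof.
move=> tH; rewrite -cards_draws; apply: subset_leq_card; apply/subsetP=> e.
by rewrite !inE => /andP[/tH[-> _] ->].
Qed.

Lemma card_insideI A H K k : three_graph A H -> #|K| = k ->
  #|H :&: [set e : {set V} | e \subset K]| <= 'C(k, 3).
Proof.
move=> tH <-; apply: leq_trans (card_inside K tH).
by apply: subset_leq_card; apply/subsetP=> e; rewrite !inE.
Qed.

Lemma three_graph_inside A H B : three_graph A H -> three_graph B (inside H B).
Proof. by move=> tH e; rewrite inE => /andP[/tH[]]. Qed.

Lemma inside_sub H B : inside H B \subset H.
Proof. by apply/subsetP=> e; rewrite inE => /andP[]. Qed.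

Lemma card_star_like A H v (S : {set V}) : three_graph A H ->
  (forall e, e \in H -> v \in e /\ e :\ v \subset S) -> #|H| <= 'C(#|S|, 2).
Proof.
move=> tH Hv; have [cE pE] := edges_at_imset v tH.
have EH : edges_at H v = H.
  by apply/setP=> e; rewrite inE; case eH: (e \in H) => //=; case: (Hv _ eH).
rewrite EH in cE pE; rewrite -cE; apply: card_pairs_in => p pH.
by split; [case: (pE _ pH) | case/imsetP: pH => e /Hv[_ sS] ->].
Qed.

Lemma star_bound A H : three_graph A H -> star_like H -> #|H| <= 'C(#|A| - 1, 2).
Proof.
move=> tH [v Hv]; have [->|/set0Pn[e0 e0H]] := eqVneq H set0; first by rewrite cards0.
have vA : v \in A by apply: (subsetP (tH _ e0H).2); apply: Hv.
have -> : #|A| - 1 = #|A :\ v| by rewrite (cardsD1 v A) vA addKn.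
apply: (card_star_like (v := v) tH) => e eH; split; first exact: Hv.
exact: setSD (tH _ eH).2.
Qed.

Lemma comet_bound A H : three_graph A H -> comet_like A H -> #|H| <= 4 + 'C(#|A| - 4, 2).
Proof.
move=> tH [K [v [KA K4 vK HK]]].
have -> : #|A| - 4 = #|A :\: K| by rewrite cardsD (setIidPr KA) K4.
rewrite -(cardsID [set e : {set V} | e \subset K] H); apply: leq_add.
  exact: card_insideI tH K4.
apply: (card_star_like (v := v) (three_graphS (subsetDl _ _) tH)) => e.
rewrite !inE => /andP[eK eH]; case: (HK _ eH) => [eK'|eKv]; first by rewrite eK' in eK.
have /setIP[ve _] : v \in e :&: K by rewrite eKv inE.
split=> //; apply/subsetP=> y /setD1P[yv ye]; rewrite in_setD (subsetP (tH _ eH).2) // andbT.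
apply/negP=> yK; have : y \in e :&: K by rewrite inE ye.
by rewrite eKv inE (negbTE yv).
Qed.

Lemma K4_star_bound A H : three_graph A H -> K4_star_like A H ->
  #|H| <= 4 + 'C(#|A| - 5, 2).
Proof.
move=> tH [K [c [KA K4 cK HK]]].
rewrite -(cardsID [set e : {set V} | e \subset K] H); apply: leq_add.
  exact: card_insideI tH K4.
set H' := _ :\: _.
have H'H : H' \subset H := subsetDl _ _.
have out e : e \in H' -> meet e K = 0 /\ c \in e.
  rewrite !inE => /andP[eK eH]; case: (HK _ eH) => // eK'.
  by rewrite eK' in eK.
have [->|/set0Pn[e0 e0H]] := eqVneq H' set0; first by rewrite cards0.
have cA : c \in A by apply: (subsetP (tH _ (subsetP H'H _ e0H)).2); case: (out _ e0H).
have -> : #|A| - 5 = #|A :\: K :\ c|.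
  have := cardsD1 c (A :\: K); rewrite in_setD cK cA cardsD (setIidPr KA) K4; nlia.
apply: (card_star_like (v := c) (three_graphS H'H tH)) => e eH.
have [m0 ce] := out _ eH; split=> //; apply: setSD; apply/subsetP=> y ye.
by rewrite in_setD (meet0_notin m0 ye) (subsetP (tH _ (subsetP H'H _ eH)).2).
Qed.

Lemma K6_split A H K : three_graph A H -> K \subset A ->
  (forall e, e \in H -> e \subset K \/ meet e K = 0) ->
  #|H| = #|inside H K| + #|inside H (A :\: K)|.
Proof.
move=> tH KA HK; rewrite -(cardsID [set e : {set V} | e \subset K] H); congr (_ + _).
  by apply: eq_card => e; rewrite !inE.
apply: eq_card => e; rewrite !inE andbC; case eH: (e \in H) => //=.
case: (HK _ eH) => eK.
  rewrite eK /=; apply/esym/negbTE; apply/subsetPn.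
  have /card_gt0P[y ye] : 0 < #|e| by rewrite (tH _ eH).1.
  by exists y; rewrite // in_setD (subsetP eK).
have -> : (e \subset K) = false.
  apply/negbTE/subsetPn; have /card_gt0P[y ye] : 0 < #|e| by rewrite (tH _ eH).1.
  by exists y; rewrite // (meet0_notin eK).
apply/esym/subsetP=> y ye; rewrite in_setD (meet0_notin eK) //.
exact: (subsetP (tH _ eH).2).
Qed.

(** The first number is read off the classification. The inner induction serves the part beside a
    K_6, which is again path-free on six vertices fewer. *)
Lemma first_bound_of N :
  (forall A H, 7 <= #|A| <= N -> three_graph A H -> P_free H -> classified A H) ->
  forall A H, #|A| <= N -> three_graph A H -> P_free H -> #|H| <= first_bound #|A|.
Proof.
move=> IH A H; have [k le] := ubnP #|A|; elim: k A H le => // k IHk A H leA AN tH PH.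
have [A6|A7] := leqP #|A| 6.
  rewrite /first_bound A6; apply: leq_trans (card_inside A tH).
  by apply: subset_leq_card; apply/subsetP=> e eH; rewrite inE eH (tH _ eH).2.
have /and5P[n1 n2 n3 n4 /andP[n5 n6]] := first_bound_ge A7.
case: (IH A H _ tH PH) => [|s|s|s|s|s _|s]; rewrite ?A7 //.
- exact: leq_trans (star_bound tH s) n1.
- exact: leq_trans (comet_bound tH s) n2.
- case: s => K [KA K6 HK]; rewrite (K6_split tH KA HK); apply: leq_trans n3.
  have cR : #|A :\: K| = #|A| - 6 by rewrite cardsD (setIidPr KA) K6.
  apply: leq_add; first by have := card_inside K tH; rewrite K6.
  rewrite -cR; apply: (IHk _ _ _ _ (three_graph_inside tH) (P_freeS (inside_sub _ _) PH)); nlia.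
- exact: leq_trans (K4_star_bound tH s) n4.
- exact: leq_trans s n5.
- exact: leq_trans (ltnW s) n6.
Qed.

End Classification.

(** * Comparisons of the bounds: small values by computation, large ones by a shift *)

Lemma range_or_shift (p : pred nat) a b : all p (iota a b) ->
  (forall k, p (k + (a + b))) -> forall m, a <= m -> p m.
Proof.
move=> small large m am; have [lt|ge] := ltnP m (a + b).
  by apply: (allP small); rewrite mem_iota am.
by rewrite -(subnK ge).
Qed.

Lemma bin2_shiftB a c k : c <= a ->
  'C(k + a - c, 2) = 'C(k, 2) + 'C(a - c, 2) + k * (a - c).
Proof. by move=> ca; rewrite -addnBA // binD. Qed.

Lemma third_bound_shift k c : c <= 4 ->
  third_bound (k + 19 - c) = 4 + ('C(k, 2) + 'C(19 - c - 5, 2) + k * (19 - c - 5)).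
Proof.
move=> c4; rewrite third_boundE; last nlia.
by rewrite -addnBA ?bin2_shiftB //; nlia.
Qed.

Ltac bin_consts k :=
  move: 'C(k, 2) => ?;
  repeat match goal with |- context [binomial ?a 2] =>
    let v := eval vm_compute in (binomial a 2) in change (binomial a 2) with v end.

Lemma third_bound_step m : 7 <= m -> third_bound m < third_bound (m + 1).
Proof.
move: m; apply: (@range_or_shift (fun m => third_bound m < third_bound (m + 1)) 7 12); first by vm_compute.
move=> k; rewrite !third_boundE; try nlia.
rewrite -[7 + 12]/19 -addnA bin2_shiftB // (bin2_shiftB _ (a := 19 + 1)) //.
bin_consts k; nlia.
Qed.

Lemma third_bound_mono m n : 7 <= m <= n -> third_bound m <= third_bound n.
Proof.
case/andP=> m7 /subnK <-; elim: (n - m) => // k IHk.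
apply: leq_trans IHk (ltnW _); rewrite (_ : k.+1 + m = k + m + 1); last nlia.
by apply: third_bound_step; nlia.
Qed.

Lemma third_bound_lt m n : 7 <= m < n -> third_bound m < third_bound n.
Proof.
case/andP=> m7 mn; apply: leq_trans (third_bound_step m7) _.
by apply: third_bound_mono; nlia.
Qed.

(** For a part of three vertices, hence at most one edge, beside a comet, a K_4 with a star, or at
    most 3 ([m] - 3) - 8 edges. So 5 is 1 + 4; in [part4_numbers], likewise, 8 is 4 + 4 and 3 is 4 -
    1. *)
Lemma part3_numbers m : 10 <= m ->
  [&& 5 + 'C(m - 7, 2) < third_bound m, 5 + 'C(m - 8, 2) < third_bound m
    & 1 + (3 * (m - 3) - 8) < third_bound m].
Proof.
move: m; apply: (@range_or_shift (fun m => [&& _, _ & _]) 10 9); first by vm_compute.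
move=> k; rewrite -[10 + 9]/19 !bin2_shiftB // -[k + 19]subn0 third_bound_shift //.
bin_consts k; apply/and3P; split; nlia.
Qed.

Lemma part4_numbers m : 11 <= m ->
  [&& 8 + 'C(m - 8, 2) < third_bound m, 8 + 'C(m - 9, 2) < third_bound m,
    4 + (3 * (m - 4) - 8) < third_bound m & 3 + third_bound (m - 4) < third_bound m].
Proof.
move: m; apply: (@range_or_shift (fun m => [&& _, _, _ & _]) 11 8); first by vm_compute.
move=> k; rewrite -[11 + 8]/19 third_bound_shift // !bin2_shiftB // -[k + 19]subn0 third_bound_shift //.
bin_consts k; apply/and4P; split; nlia.
Qed.

Lemma part5_numbers m : 12 <= m -> 10 + first_bound (m - 5) < third_bound m.
Proof.
move: m; apply: (@range_or_shift (fun m => _ < third_bound m) 12 7); first by vm_compute.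
move=> k; rewrite -[12 + 7]/19 -[X in third_bound X]subn0 third_bound_shift // first_boundE; last nlia.
rewrite -subnDA bin2_shiftB //; bin_consts k; nlia.
Qed.

(** At [b = 7] the first number comes from K_6 and is checked apart. From 8 on, ['C(b + r - 5, 2)]
    is split at [b - 1], and the product [(b - 1) * (r - 4)] outweighs what ['C(r - 1, 2)] has over
    ['C(r - 4, 2)]. *)
Lemma part7_numbers b r : 7 <= b <= r ->
  first_bound b + first_bound r < third_bound (b + r).
Proof.
case/andP; rewrite leq_eqVlt => /predU1P[<-|b8] br.
  move: r br; apply: (@range_or_shift (fun r => _ < third_bound (7 + r)) 7 12); first by vm_compute.
  move=> k; rewrite -[7 + 12]/19 (first_boundE (m := k + 19)); last nlia.
  rewrite third_boundE; last nlia.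
  have -> : 7 + (k + 19) = k + 26 by nlia.
  rewrite !bin2_shiftB //; bin_consts k; rewrite /first_bound /=; nlia.
rewrite !first_boundE ?third_boundE; try nlia.
have -> : b + r - 5 = b - 1 + (r - 4) by nlia.
have -> : r - 1 = r - 4 + 3 by nlia.
have c3 : 'C(3, 2) = 3 by []. 
have : 7 * (r - 4) <= (b - 1) * (r - 4) by rewrite leq_mul2r; nlia.
by rewrite !binD c3; nlia.
Qed.

(* The improvement at 12 is due to two disjoint copies of K_6, each of which
   loses five edges when it is [C_free]. *)
Definition C_free_bound k := if k == 12 then 30 else third_bound k.

Lemma C_free_bound_numbers m : 9 <= m ->
  [&& third_bound m - 1 <= C_free_bound m, 15 + first_bound (m - 6) <= C_free_bound m + 5 * (m == 12),
    4 + 'C(m - 5, 2) <= C_free_bound m & 3 * m - 8 <= C_free_bound m].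
Proof.
move: m; apply: (@range_or_shift (fun m => [&& _, _, _ & _]) 9 10); first by vm_compute.
move=> k; rewrite (_ : 9 + 10 = 19) // /C_free_bound ifN; last nlia.
rewrite first_boundE; last nlia.
rewrite -subnDA !bin2_shiftB // -[X in third_bound X]subn0 third_bound_shift //.
bin_consts k; apply/and4P; split; nlia.
Qed.

(** The entries serve the strict case, kites, twins and triangles, in this order. The value 31 of
    [third_bound] at 12 is pinned down here: the first entry is 30 at [m = 12], and at [m = 14] it
    is 30 + 10 = 40, against 41, where 30 is [C_free_bound] at 12. *)
Lemma connected_numbers m : 12 <= m ->
  [&& maxn ('C(m - 5, 2) + 3) (C_free_bound (m - 2) + (m - 4)) < third_bound m,
    2 * m + 3 < third_bound m,
    maxn (2 * m) (C_free_bound (m - 3) + (m - 1)) < third_bound m & 3 * m - 8 < third_bound m].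
Proof.
move: m; apply: (@range_or_shift (fun m => [&& _, _, _ & _]) 12 7); first by vm_compute.
move=> k; rewrite (_ : 12 + 7 = 19) // /C_free_bound !ifN; try nlia.
rewrite !third_bound_shift // -[X in third_bound X]subn0 third_bound_shift //.
rewrite !bin2_shiftB //.
bin_consts k; apply/and4P; split; nlia.
Qed.

Lemma first_bound_small m : m < 7 -> first_bound m = 'C(m, 3).
Proof. by move=> m7; rewrite /first_bound -ltnS m7. Qed.

(** * Disconnected 3-graphs, by the size of the smaller part *)

Section Disconnected.
Variable V : finType.
Implicit Types (A B K R : {set V}) (H : {set {set V}}) (e f g : {set V}) (v x c : V).

Lemma closed_meet A H B : closed_in A H B ->
  forall e, e \in H -> e \subset B \/ meet e B = 0.
Proof.
move=> cB e eH; case: (cB _ eH) => [|eB]; [by left|right].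
apply/eqP; rewrite cards_eq0; apply/eqP/setP=> y; rewrite !inE.
by apply/negP=> /andP[/(subsetP eB)]; rewrite inE => /andP[/negbTE->].
Qed.

Lemma classified_more A A' H : A' \subset A -> 7 <= #|A'| -> classified A' H -> classified A H.
Proof.
move=> A'A A7; have le := subset_leq_card A'A.
case=> [s|[K [v [KA K4 vK HK]]]|[K [KA K6 HK]]|[K [v [KA K4 vK HK]]]|s GG|s].
- exact: ClassStar.
- by apply: ClassComet; exists K, v; split=> //; apply: subset_trans A'A.
- by apply: ClassK6; exists K; split=> //; apply: subset_trans A'A.
- by apply: ClassK4Star; exists K, v; split=> //; apply: subset_trans A'A.
- by apply: ClassG => //; nlia.
- by apply: ClassSmall; apply: leq_trans s _; apply: third_bound_mono; rewrite A7.
Qed.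

Lemma K6_like_part A H B : three_graph A H -> B \subset A -> closed_in A H B ->
  K6_like (A :\: B) (inside H (A :\: B)) -> K6_like A H.
Proof.
move=> tH BA cB [K [KR K6 HK]]; exists K; split=> //; first exact: subset_trans KR (subsetDl _ _).
move=> e eH; case: (cB _ eH) => eB; last by apply: HK; rewrite inE eH.
right; apply/eqP; rewrite cards_eq0; apply/eqP/setP=> y; rewrite !inE.
by apply/negP=> /andP[/(subsetP eB) yB /(subsetP KR)]; rewrite inE yB.
Qed.

Lemma closed_sym A H B : B \subset A -> closed_in A H B -> closed_in A H (A :\: B).
Proof.
move=> BA cB e eH; have -> : A :\: (A :\: B) = B.
  by rewrite setDDr setDv set0U; apply/setIidPr.
by case: (cB _ eH); auto.
Qed.

Section Split.
Variables (A B : {set V}) (H : {set {set V}}).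
Hypotheses (tH : three_graph A H) (PH : P_free H) (BA : B \subset A) (cB : closed_in A H B).
Hypothesis A7 : 7 <= #|A|.
Hypothesis IH : forall A' H', 7 <= #|A'| < #|A| -> three_graph A' H' -> P_free H' ->
  classified A' H'.

Let R := A :\: B.
Let H1 := inside H B.
Let H2 := inside H R.

Let cHH : #|H| = #|H1| + #|H2|.
Proof. exact: K6_split tH BA (closed_meet cB). Qed.

Let cR : #|R| = #|A| - #|B|.
Proof. by rewrite cardsD (setIidPr BA). Qed.

Let leBA : #|B| <= #|A|.
Proof. exact: subset_leq_card. Qed.

Let t2 : three_graph R H2.
Proof. exact: three_graph_inside tH. Qed.

Let P2 : P_free H2.
Proof. exact: P_freeS (inside_sub _ _) PH. Qed.

Let in_part e : e \in H -> e \in H1 \/ e \in H2.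
Proof. by move=> eH; case: (cB eH) => s; [left|right]; rewrite inE eH. Qed.

Let first (S : {set V}) H' : #|S| < #|A| -> three_graph S H' -> P_free H' -> #|H'| <= first_bound #|S|.
Proof.
move=> SA; apply: (@first_bound_of _ #|A|.-1); last by nlia.
by move=> A' H0 lA; apply: IH; nlia.
Qed.

(** On seven vertices the other six are the K_6; on more, [v] is dropped and the induction
    hypothesis applies. *)
Lemma isolated_vertex v : v \in A -> (forall e, e \in H -> v \notin e) -> classified A H.
Proof.
move=> vA iso; have cA := cardsD1 v A; rewrite vA in cA.
have tA : three_graph (A :\ v) H.
  move=> e eH; split; first exact: (tH eH).1.
  apply/subsetP=> y ye; rewrite in_setD1 (subsetP (tH eH).2) // andbT.
  by apply: contraNneq (iso _ eH) => <-.
have [A6|A6] := leqP #|A| 7.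
  apply: ClassK6; exists (A :\ v); split; [exact: subsetDl|nlia|].
  by move=> e /tA[_]; left.
apply: (@classified_more A (A :\ v)); [exact: subsetDl|nlia|].
by apply: IH => //; nlia.
Qed.

Lemma part_of_6 : #|B| = 6 -> classified A H.
Proof. by move=> B6; apply: ClassK6; exists B; split=> //; apply: closed_meet cB. Qed.

Lemma no_edge_part v : v \in B -> H1 = set0 -> classified A H.
Proof.
move=> vB h0; apply: (isolated_vertex (subsetP BA _ vB)) => e eH.
case: (in_part eH); first by rewrite h0 inE.
by rewrite inE => /andP[_ eR]; apply/negP=> /(subsetP eR); rewrite inE vB.
Qed.

Lemma part_small : 0 < #|B| <= 2 -> classified A H.
Proof.
case/andP=> /card_gt0P[v vB] B2; apply: (no_edge_part vB); apply/eqP.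
rewrite -cards_eq0 -leqn0; apply: leq_trans (card_inside B tH) _.
by rewrite leqn0 bin_small //; nlia.
Qed.

Let R_star : star_like H2 -> H2 != set0 -> exists c, c \in R /\ forall e, e \in H2 -> c \in e.
Proof.
move=> [c Hc] /set0Pn[e eH]; exists c; split=> //.
by apply: (subsetP (t2 eH).2); apply: Hc.
Qed.

Let small : #|H| < third_bound #|A| -> classified A H := @ClassSmall _ A H.

Let third_large : 7 <= #|A| -> 13 <= third_bound #|A|.
Proof. by move=> h; apply: (@third_bound_mono 7). Qed.

(** At most one edge beside the rest. A star with centre [c] on the rest makes a comet with K_4 on
    [c |: B]; a K_6 in the rest is a K_6 of the whole; all else is too small. *)
Lemma part_of_3 : #|B| = 3 -> classified A H.
Proof.
move=> B3; have le1 : #|H1| <= 1 by have := card_inside B tH; rewrite B3.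
have [R7|R6] := leqP 7 #|R|; last first.
  have l2 : #|H2| <= 'C(#|R|, 3).
    by rewrite -first_bound_small //; apply: first => //; nlia.
  have [A9|A9] := eqVneq #|R| 6.
    apply: ClassK6; exists R; split=> //; first exact: subsetDl.
    exact: closed_meet (closed_sym BA cB).
  apply: small; rewrite cHH; have [A7'|A8] : #|A| = 7 \/ #|A| = 8 by nlia.
    rewrite A7'; apply: leq_ltn_trans (leq_add le1 l2) _.
    by have -> : #|R| = 4 by nlia.
  rewrite A8; apply: leq_ltn_trans (leq_add le1 l2) _.
  by have -> : #|R| = 5 by nlia.
have A10 : 10 <= #|A| by nlia.
have /and3P[n1 n2 n3] := part3_numbers A10.
have := IH _ t2 P2; case=> [|s|s|s|s|s _|s]; first by nlia.
- have [h0|hn] := eqVneq H2 set0.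
    by apply: small; rewrite cHH h0 cards0; have := third_large A7; nlia.
  have [c [cR' Hc]] := R_star s hn; have [cA cB'] := setDP cR'.
  apply: ClassComet; exists (c |: B), c; split.
  + by rewrite subUset sub1set cA.
  + by rewrite cardsU1 cB' B3.
  + exact: setU11.
  + move=> e /in_part[]; rewrite inE => /andP[eH es].
      by left; apply: subset_trans es (subsetUr _ _).
    have ce : c \in e by apply: Hc; rewrite inE eH.
    right; apply/setP=> y; rewrite !inE; have [->|_] := eqVneq y c; first by rewrite ce.
    by apply/negP=> /andP[/(subsetP es)]; rewrite inE => /andP[/negbTE->].
- apply: small; have := comet_bound t2 s; rewrite cHH.
  by rewrite (_ : #|A| - 7 = #|R| - 4) in n1; nlia.
- by apply: ClassK6; apply: K6_like_part s.
- apply: small; have := K4_star_bound t2 s; rewrite cHH.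
  by rewrite (_ : #|A| - 8 = #|R| - 5) in n2; nlia.
- by apply: small; rewrite cHH; rewrite cR B3 in s; nlia.
- apply: small; rewrite cHH.
  have : third_bound #|R| < third_bound #|A| by apply: third_bound_lt; nlia.
  by nlia.
Qed.

(** As for three vertices, except that a star on the rest now gives [K4_star_like]. *)
Lemma part_of_4 : #|B| = 4 -> 4 <= #|R| -> classified A H.
Proof.
move=> B4 R4; have le1 : #|H1| <= 4 by have := card_inside B tH; rewrite B4.
have [R7|R6] := leqP 7 #|R|; last first.
  have l2 : #|H2| <= 'C(#|R|, 3).
    by rewrite -first_bound_small //; apply: first => //; nlia.
  have [A9|A9] := eqVneq #|R| 6.
    apply: ClassK6; exists R; split=> //; first exact: subsetDl.
    exact: closed_meet (closed_sym BA cB).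
  apply: small; rewrite cHH; have [A7'|A8] : #|A| = 8 \/ #|A| = 9 by nlia.
    rewrite A7'; apply: leq_ltn_trans (leq_add le1 l2) _.
    by have -> : #|R| = 4 by nlia.
  rewrite A8; apply: leq_ltn_trans (leq_add le1 l2) _.
  by have -> : #|R| = 5 by nlia.
have A11 : 11 <= #|A| by nlia.
have /and4P[n1 n2 n3 n4] := part4_numbers A11.
have := IH _ t2 P2; case=> [|s|s|s|s|s _|s]; first by nlia.
- have [h0|hn] := eqVneq H2 set0.
    by apply: small; rewrite cHH h0 cards0; have := third_large A7; nlia.
  have [c [cR' Hc]] := R_star s hn; have [cA cB'] := setDP cR'.
  apply: ClassK4Star; exists B, c; split=> // e /in_part[]; rewrite inE => /andP[eH es].
    by left.
  have ce : c \in e by apply: Hc; rewrite inE eH.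
  right; split=> //; apply/eqP; rewrite cards_eq0; apply/eqP/setP=> y; rewrite !inE.
  by apply/negP=> /andP[/(subsetP es)]; rewrite inE => /andP[/negbTE->].
- apply: small; have := comet_bound t2 s; rewrite cHH.
  by rewrite (_ : #|A| - 8 = #|R| - 4) in n1; nlia.
- by apply: ClassK6; apply: K6_like_part s.
- apply: small; have := K4_star_bound t2 s; rewrite cHH.
  by rewrite (_ : #|A| - 9 = #|R| - 5) in n2; nlia.
- by apply: small; rewrite cHH; rewrite cR B4 in s; nlia.
- by apply: small; rewrite cHH; rewrite cR B4 in s; nlia.
Qed.

(** Counting suffices on ten vertices, with 10 + 10 edges against 22, and from twelve on. On eleven
    vertices the other part has six and is the K_6. *)
Lemma part_of_5 : #|B| = 5 -> 5 <= #|R| -> classified A H.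
Proof.
move=> B5 R5; have le1 : #|H1| <= 10 by have := card_inside B tH; rewrite B5.
have le2 : #|H2| <= first_bound #|R| by apply: first => //; nlia.
have [A12|A11] := leqP 12 #|A|.
  apply: small; have := part5_numbers A12; rewrite cHH; rewrite cR B5 in le2; nlia.
have [A10|A10] := eqVneq #|A| 10.
  apply: small; rewrite cHH A10; apply: leq_ltn_trans (leq_add le1 le2) _.
  by have -> : #|R| = 5 by nlia.
apply: ClassK6; exists R; split; [exact: subsetDl|nlia|].
exact: closed_meet (closed_sym BA cB).
Qed.

Lemma part_large : 7 <= #|B| <= #|R| -> classified A H.
Proof.
move=> BR; apply: small; have := part7_numbers BR.
have -> : #|B| + #|R| = #|A| by nlia.
have := first _ t2 P2; have t1 := three_graph_inside (B := B) tH.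
have := first _ t1 (P_freeS (inside_sub _ _) PH); rewrite cHH.
move=> f1 f2; have {}f1 := f1 ltac:(nlia); have {}f2 := f2 ltac:(nlia).
by rewrite -/H1 in f1; nlia.
Qed.

Lemma disconnected_case : 0 < #|B| <= #|R| -> classified A H.
Proof.
case/andP=> B0 BR; have [B2|B2] := leqP #|B| 2; first by apply: part_small; rewrite B0.
have [B7|B7] := leqP 7 #|B|; first by apply: part_large; rewrite B7.
case E: #|B| B2 B7 BR => [|[|[|[|[|[|[|]]]]]]] //.
- by move=> *; apply: part_of_3.
- by move=> *; apply: part_of_4.
- by move=> *; apply: part_of_5.
- by move=> *; apply: part_of_6.
Qed.
End Split.

Lemma disconnected A B H : three_graph A H -> P_free H -> B \subset A -> closed_in A H B ->
  B != set0 -> B != A -> 7 <= #|A| ->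
  (forall A' H', 7 <= #|A'| < #|A| -> three_graph A' H' -> P_free H' -> classified A' H') ->
  classified A H.
Proof.
move=> tH PH BA cB B0 BnA A7 IH.
have RB : A :\: (A :\: B) = B by rewrite setDDr setDv set0U; apply/setIidPr.
have [le|lt] := leqP #|B| #|A :\: B|.
  by apply: (disconnected_case tH PH BA cB A7 IH); rewrite card_gt0 B0.
apply: (disconnected_case tH PH (subsetDl A B) (closed_sym BA cB) A7 IH).
rewrite RB (ltnW lt) andbT card_gt0 setD_eq0; apply: contra BnA => AB.
by rewrite eqEsubset BA.
Qed.
End Disconnected.

Lemma edge_complete (V : finType) (x y : V) (e : {set V}) :
  #|e| = 3 -> x \in e -> y \in e -> x != y ->
  exists w, [/\ e = [set x; y; w], x != w & y != w].
Proof.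
move=> e3 xe ye xy; have [w eE /andP[wx wy]] := edge_third e3 xy xe ye.
by exists w; split; rewrite // eq_sym.
Qed.

(** * Connected 3-graphs on at least twelve vertices *)

Section ConnectedStep.
Variables (V : finType) (A : {set V}) (H : {set {set V}}).
Implicit Types (e f g B : {set V}) (v x : V).
Hypotheses (tH : three_graph A H) (PH : P_free H) (cH : connected_in A H) (A12 : 12 <= #|A|).
Hypothesis IH : forall B (H' : {set {set V}}), 7 <= #|B| < #|A| -> three_graph B H' -> P_free H' ->
  classified B H'.

(** Six vertices carry at most 15 edges without triangles, so among the classes only stars and
    comets can exceed the bound. On twelve vertices both halves have six, whence 15 + 15. *)
Lemma C_free_smaller B (H' : {set {set V}}) : 9 <= #|B| < #|A| -> three_graph B H' -> P_free H' -> C_free H' ->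
  [\/ star_like H', comet_like B H' | #|H'| <= C_free_bound #|B|].
Proof.
case/andP=> B9 BA tH' PH' CH'; have /and4P[n1 n2 n3 n4] := C_free_bound_numbers B9.
case: (IH _ tH' PH') => [|s|s|s|s|s _|s]; first by nlia.
- exact: Or31.
- exact: Or32.
- apply: Or33; case: s => K [KB K6 HK]; rewrite (K6_split tH' KB HK).
  have le1 : #|inside H' K| <= 15 := card_C_free6 tH' CH' K6.
  have cR : #|B :\: K| = #|B| - 6 by rewrite cardsD (setIidPr KB) K6.
  have [E|nE] := eqVneq #|B| 12.
    have K6' : #|B :\: K| = 6 by nlia.
    have := card_C_free6 tH' CH' K6'; rewrite -/(inside _ _) E.
    by move=> le2; apply: leq_trans (leq_add le1 le2) _.
  rewrite (negbTE nE) muln0 addn0 in n2; apply: leq_trans n2; apply: leq_add => //.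
  rewrite -cR; apply: (@first_bound_of _ #|A|.-1).
  + by move=> A' H0 lA; apply: IH; nlia.
  + by nlia.
  + exact: three_graph_inside tH'.
  + exact: P_freeS (inside_sub _ _) PH'.
- by apply: Or33; apply: leq_trans (K4_star_bound tH' s) n3.
- by apply: Or33; apply: leq_trans s n4.
- by apply: Or33; nlia.
Qed.

Section CFree.
Hypothesis CH : C_free H.
Variable x : V.
Hypothesis jx : junction H x.
Hypothesis degx : forall v, junction H v -> #|edges_at H v| <= #|edges_at H x|.

Let IHk k B (H' : {set {set V}}) : k <= 3 -> #|B| = #|A| - k -> 0 < k -> three_graph B H' -> H' \subset H ->
  [\/ star_like H', comet_like B H' | #|H'| <= C_free_bound (#|A| - k)].
Proof.
move=> k3 cB k0 tB sub; rewrite -cB; apply: C_free_smaller => //; last exact: C_freeS CH.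
  by nlia.
exact: P_freeS PH.
Qed.

Let numbers := connected_numbers A12.

Lemma C_free_strict :
  (forall e g, e \in H -> g \in H -> x \in e -> x \notin g -> meet e g != 1) ->
  [\/ star_like H, comet_like A H | #|H| < third_bound #|A|].
Proof.
move=> strict; case/and4P: numbers => n1 _ _ _.
have [s|s|s] := strict_case tH cH A12 jx strict degx (fun B H' cB => @IHk 2 B H' isT cB isT).
- exact: Or31.
- exact: Or32.
- by apply: Or33; apply: leq_ltn_trans s n1.
Qed.

Lemma twin_small z t q1 q2 : uniq [:: x; z; t; q1; q2] -> [set x; z; t] \in H ->
  [set x; q1; q2] \in H -> [set z; q1; q2] \in H -> #|H| < third_bound #|A|.
Proof.
move=> us E1 E2 E3; case/and4P: numbers => _ _ n _; apply: leq_ltn_trans n.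
exact: (twin_bound tH PH CH cH A12 us E1 E2 E3 degx (fun B H' cB => @IHk 3 B H' isT cB isT)).
Qed.

Lemma kite_small a b c d w : uniq [:: a; b; c; x; d; w] -> [set x; a; c] \in H ->
  [set x; a; b] \in H -> [set x; b; d] \in H -> [set a; c; w] \in H -> #|H| < third_bound #|A|.
Proof.
move=> us E1 E2 E3 E4; case/and4P: numbers => _ n _ _; apply: leq_ltn_trans n.
apply: (kite_bound tH PH CH cH us E1 E2 E3 E4); nlia.
Qed.
(** If no edge avoiding [x] meets an edge at [x] in one vertex, the strict case applies. Otherwise
    [e = xab] and some [g] meet in [a]. An edge meeting [e] only in [x] gives twins by
    [forced_meet]. If there is none, the junction comes from edges [xac] and [xbd], and [g] contains
    [c]; its third vertex is [d], which gives twins, or a new one, which gives a kite. *)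
Lemma C_free_case : [\/ star_like H, comet_like A H | #|H| < third_bound #|A|].
Proof.
have [/existsP[e /existsP[g /and5P[eH gH xe xg /eqP eg1]]]|nex] :=
  boolP [exists e : {set V}, exists g : {set V},
    [&& e \in H, g \in H, x \in e, x \notin g & meet e g == 1]]; last first.
  apply: C_free_strict => e g eH gH xe xg; apply/negP=> eg; case/negP: nex.
  by apply/existsP; exists e; apply/existsP; exists g; apply/and5P.
apply: Or33; have [a ega] := meet1P eg1.
have /setIP[ae ag] : a \in e :&: g by rewrite ega inE.
have xa : x != a by apply: contraNneq xg => ->.
have [b [eE bx ba]] := edge_complete (tH eH).1 xe ae xa.
have be : b \in e by rewrite eE !inE eqxx orbT.
have bg : b \notin g.
  apply/negP=> bg; have : b \in e :&: g by rewrite inE be.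
  by rewrite ega inE eq_sym (negbTE ba).
have [/existsP[f /andP[fH /eqP efx]]|nof] :=
  boolP [exists f : {set V}, (f \in H) && (e :&: f == [set x])].
  have gf := forced_meet tH PH CH eH fH gH efx xg (etrans (meetC _ _) eg1).
  have [q1 [q2 [q12 gfq]]] := meet2P gf.
  have /setIP[q1g q1f] : q1 \in g :&: f by rewrite gfq !inE eqxx.
  have /setIP[q2g q2f] : q2 \in g :&: f by rewrite gfq !inE eqxx orbT.
  have [xq1 xq2] : x != q1 /\ x != q2 by split; apply: contraNneq xg => ->.
  have /setIP[_ xf] : x \in e :&: f by rewrite efx inE.
  have notin q : q \in f -> x != q -> q \notin e.
    move=> qf xq; apply/negP=> qe; have : q \in e :&: f by rewrite inE qe.
    by rewrite efx inE eq_sym (negbTE xq).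
  have [q1e q2e] := (notin _ q1f xq1, notin _ q2f xq2).
  have [aq1 aq2] : a != q1 /\ a != q2.
    by split; [apply: contraNneq q1e | apply: contraNneq q2e] => <-.
  have [bq1 bq2] : b != q1 /\ b != q2.
    by split; [apply: contraNneq q1e | apply: contraNneq q2e] => <-.
  (* The twins are [x] and [a], with the pair [q1], [q2]. *)
  apply: (@twin_small a b q1 q2).
  - by rewrite /= !inE !negb_or xa bx xq1 xq2 ba aq1 aq2 bq1 bq2 q12.
  - by rewrite -eE.
  - by rewrite -(set3_eq xq1 xq2 q12 (tH fH).1).
  - by rewrite -(set3_eq aq1 aq2 q12 (tH gH).1).
have meets f : f \in H -> x \in f -> (a \in f) || (b \in f).
  move=> fH xf; apply: contraR nof; rewrite negb_or => /andP[af bf].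
  apply/existsP; exists f; rewrite fH; apply/eqP/setP=> y; rewrite eE !inE.
  have [->|_] := eqVneq y x; first by rewrite xf.
  have [->|_] /= := eqVneq y a; first exact: negbTE.
  by have [->|] := eqVneq y b; first exact: negbTE.
have [f1 [f2 [f1H f2H f12 af1]]] :
    exists f1 f2, [/\ f1 \in H, f2 \in H, f1 :&: f2 = [set x] & a \in f1].
  have [f1 [f2 [f1H f2H f12]]] := jx.
  have /setIP[xf1 xf2] : x \in f1 :&: f2 by rewrite f12 inE.
  have [af1|af1] := boolP (a \in f1); first by exists f1, f2.
  have bf1 := meets _ f1H xf1; rewrite (negbTE af1) /= in bf1.
  exists f2, f1; split; rewrite // 1?setIC //.
  have := meets _ f2H xf2; case bf2: (b \in f2); last by rewrite orbF.
  have : b \in f1 :&: f2 by rewrite inE bf1.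
  by rewrite f12 inE eq_sym (negbTE bx).
have only y : y \in f1 -> y \in f2 -> y = x.
  by move=> y1 y2; apply/set1P; rewrite -f12 inE y1.
have /setIP[xf1 xf2] : x \in f1 :&: f2 by rewrite f12 inE.
have af2 : a \notin f2 by apply/negP=> /(only _ af1)/esym/eqP; rewrite (negbTE xa).
have bf2 : b \in f2 by have := meets _ f2H xf2; rewrite (negbTE af2).
have bf1 : b \notin f1 by apply/negP=> /only/(_ bf2)/esym/eqP; rewrite (negbTE bx).
have [c [f1E cx ca]] := edge_complete (tH f1H).1 xf1 af1 xa.
have [d [f2E dx db]] := edge_complete (tH f2H).1 xf2 bf2 bx.
have cf1 : c \in f1 by rewrite f1E !inE eqxx orbT.
have df2 : d \in f2 by rewrite f2E !inE eqxx orbT.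
have cd : c != d by apply: contraNneq cx => cd; rewrite eq_sym; apply/eqP/only; rewrite // cd.
have bc : b != c by apply: contraNneq bf1 => ->.
have ad : a != d by apply: contraNneq af2 => ->.
(* Otherwise [g] meets [f1] only in [a] and would have to meet [f2] twice, but neither [x] nor [b]
   is in [g]. *)
have cg : c \in g.
  apply: contraT => ncg.
  have g1 : meet g f1 = 1.
    by rewrite meetC f1E meet_set3 // (negbTE xg) ag (negbTE ncg).
  have := forced_meet tH PH CH f1H f2H gH f12 xg g1.
  by rewrite meetC f2E meet_set3 // (negbTE xg) (negbTE bg); case: (d \in g).
have [w [gE wa wc]] := edge_complete (tH gH).1 ag cg ca.
have wg : w \in g by rewrite gE !inE eqxx orbT.
have xw : x != w by apply: contraNneq xg => ->.
have bw : b != w by apply: contraNneq bg => ->.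
have [wd|dw] := eqVneq w d.
  (* The twins are [x] and [d], with the pair [a], [c]. *)
  apply: (@twin_small d b a c).
  - by rewrite /= !inE !negb_or dx bx xa cx (eq_sym d) db (eq_sym d a) ad (eq_sym d c) cd (eq_sym b a) ba bc ca.
  - by rewrite (_ : [set x; d; b] = f2) // f2E; apply/setP=> y; rewrite !inE orbAC.
  - by rewrite -f1E.
  - by rewrite (_ : [set d; a; c] = g) // gE wd; apply/setP=> y; rewrite !inE -orbA orbC.
apply: (@kite_small a b c d w).
- by rewrite /= !inE !negb_or ba ca (eq_sym a x) xa ad wa bc (eq_sym b x) bx db bw (eq_sym c x) cx cd wc dx xw eq_sym dw.
- by rewrite -f1E.
- by rewrite -eE.
- by rewrite -f2E.
- by rewrite -gE.
Qed.
End CFree.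

End ConnectedStep.

Lemma third_bound_linear m : 7 <= m -> 3 * m - 8 <= third_bound m.
Proof.
move=> m7; have [m12|m11] := leqP 12 m.
  by case/and4P: (connected_numbers m12) => _ _ _ /ltnW.
by rewrite /third_bound ifT.
Qed.

Lemma connected_or_split (V : finType) (A : {set V}) (H : {set {set V}}) :
  connected_in A H \/ exists B : {set V}, [/\ B \subset A, B != set0, B != A & closed_in A H B].
Proof.
have [/existsP[B /and4P[BA B0 BnA /forall_inP cB]]|nex] :=
  boolP [exists B : {set V}, [&& B \subset A, B != set0, B != A &
    [forall e in H, (e \subset B) || (e \subset A :\: B)]]].
  by right; exists B; split=> // e /cB /orP.
left=> B BA B0 cB; apply/eqP; apply: contraR nex => BnA.
apply/existsP; exists B; rewrite BA B0 BnA; apply/forall_inP=> e /cB eB.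
exact/orP.
Qed.

(** * The induction for the classification *)

Section Main.
Variable V : finType.
Implicit Types (A B : {set V}) (H : {set {set V}}).

Theorem classification A H : 7 <= #|A| -> three_graph A H -> P_free H -> classified A H.
Proof.
have [k le] := ubnP #|A|; elim: k A H le => // k IHk A H le A7 tH PH.
have IH B (H' : {set {set V}}) : 7 <= #|B| < #|A| -> three_graph B H' -> P_free H' ->
    classified B H'.
  by move=> /andP[B7 BA]; apply: IHk => //; apply: leq_trans BA _.
have tl := third_bound_linear A7.
have [cH|[B [BA B0 BnA cB]]] := connected_or_split A H; last first.
  exact: (disconnected tH PH BA cB B0 BnA A7).
have [/forall_inP iH|nI] := boolP [forall e in H, forall f in H, 0 < meet e f].
  have iH' : intersecting H by move=> e f eH; move: f; apply/forall_inP/iH.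
  have [s|[s [g|g|g]]] := intersecting_cases tH iH' A7.
  - exact: ClassStar.
  - by apply: ClassG => //; left.
  - by apply: ClassG => //; right.
  - by apply: ClassSmall; apply: leq_trans g tl.
have nI' : ~ intersecting H.
  by move=> iH; case/negP: nI; apply/forall_inP=> e eH; apply/forall_inP=> f; apply: iH.
have [a [b [c [d [e [f [us abc bcd def sA]]]]]]] := chain_labels tH PH cH nI'.
have [A12|A11] := leqP 12 #|A|; last first.
  have [|s|s|s] := small_chain tH PH us sA abc bcd def; first by rewrite A7.
  - by apply: ClassSmall; apply: leq_trans s tl.
  - exact: ClassComet.
  - exact: ClassK6.
have [CH|[p [q [r [p' [q' [r' [us' e1 e2 e3]]]]]]]] := C_free_or_triangle tH.
  (* The edges [bcd] and [def] of the chain make [d] a junction, so one of maximum degree exists. *)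
  have jd : [exists e in H, exists f in H, e :&: f == [set d]].
    apply/exists_inP; exists [set b; c; d] => //; apply/exists_inP; exists [set d; e; f] => //.
    move: us; rewrite /= !inE !negb_or => us; apply/eqP/setP=> y; rewrite !inE.
    have [->|yd] := eqVneq y d; first by rewrite !orbT.
    rewrite orbF; apply/negbTE/negP=> /andP[/orP[]/eqP->].
      by case/and5P: us => _ /and4P[_ _ be bf] _ _ _; rewrite (negbTE be) (negbTE bf).
    by case/and5P: us => _ _ /and3P[_ ce cf] _ _; rewrite (negbTE ce) (negbTE cf).
  have [x /junctionP jx degx] := @arg_maxnP _ d
    (fun x => [exists e in H, exists f in H, e :&: f == [set x]]) (fun x => #|edges_at H x|) jd.
  have [|s|s|s] := C_free_case tH PH cH A12 IH CH jx.
  - by move=> v /junctionP; apply: degx.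
  - exact: ClassStar.
  - exact: ClassComet.
  - exact: ClassSmall.
(* On seven vertices all other classes have at most 13 edges: [third_bound 7] is 3 * 7 - 8, and a
   K_4 with a star has at most 5. *)
have b7 B (H' : {set {set V}}) : #|B| = 7 -> three_graph B H' -> P_free H' ->
    [\/ star_like H', comet_like B H', K6_like B H' | #|H'| <= 13].
  move=> B7 tH' PH'; case: (IH _ _ _ tH' PH') => [|s|s|s|s|s _|s]; first by rewrite B7; nlia.
  - exact: Or41.
  - exact: Or42.
  - exact: Or43.
  - by apply: Or44; have := K4_star_bound tH' s; rewrite B7 => h; apply: leq_trans h _.
  - by apply: Or44; rewrite B7 in s.
  - by apply: Or44; rewrite B7 in s; apply: ltnW.
apply: ClassSmall; case/and4P: (connected_numbers A12) => _ _ _; apply: leq_ltn_trans.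
exact: (triangle_bound tH PH cH us' e1 e2 e3 b7 A7).
Qed.
End Main.

(** * Turan numbers of higher order *)

Section Embeddings.

Definition embeds (V W : finType) (E : {set {set V}}) (Y : {set {set W}}) :=
  exists2 f : V -> W, injective f & forall e : {set V}, e \in E -> f @: e \in Y.

Lemma containsP (V W : finType) (E : {set {set V}}) (Y : {set {set W}}) :
  reflect (embeds E Y) (contains (Hypergraph Y) (Hypergraph E)).
Proof.
apply: (iffP existsP) => [[f /andP[/injectiveP fI /forall_inP fE]]|[f fI fE]].
  by exists f.
exists [ffun v => f v]; apply/andP; split.
  by apply/injectiveP=> u v; rewrite /= !ffunE => /fI.
apply/forall_inP=> e eE /=; rewrite (eq_imset (g := f)); first exact: fE.
by move=> v; rewrite ffunE.
Qed.

Lemma embeds_trans (U V W : finType) (D : {set {set U}}) (E : {set {set V}})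
  (F : {set {set W}}) : embeds D E -> embeds E F -> embeds D F.
Proof.
move=> [f fI fE] [g gI gE]; exists (g \o f); first exact: inj_comp.
by move=> e eD; rewrite imset_comp gE // fE.
Qed.

Lemma embeds_card (V W : finType) (E : {set {set V}}) (Y : {set {set W}}) :
  embeds E Y -> #|E| <= #|Y|.
Proof.
move=> [f fI fE]; rewrite -(card_imset (mem E) (imset_inj fI)).
by apply: subset_leq_card; apply/subsetP=> _ /imsetP[e eE ->]; apply: fE.
Qed.

(** Injectivity between vertex sets of equal size gives a bijection; the image of the edges fills
    [Y] because [Y] has no more edges than [E]. *)
Lemma embeds_iso (V W : finType) (E : {set {set V}}) (Y : {set {set W}}) :
  #|V| = #|W| -> embeds E Y -> #|Y| <= #|E| -> isomorphic (Hypergraph E) (Hypergraph Y).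
Proof.
move=> VW [f fI fE] le; exists f; first by apply: inj_card_bij; rewrite // VW.
have EY : [set f @: (e : {set V}) | e in E] = Y.
  apply/eqP; rewrite eqEcard card_imset ?le ?andbT; last exact: imset_inj.
  by apply/subsetP=> _ /imsetP[e eE ->]; apply: fE.
move=> e /=; rewrite -[in RHS]EY; apply/idP/imsetP => [eE|[e' e'E /(imset_inj fI)->//]].
by exists e.
Qed.

Lemma iso_embeds (V W : finType) (E : {set {set V}}) (Y : {set {set W}}) :
  isomorphic (Hypergraph E) (Hypergraph Y) -> embeds E Y.
Proof. by move=> [f /= fB fE]; exists f; [exact: bij_inj | move=> e; rewrite fE]. Qed.

Lemma iso_sym (F G : hypergraph) : isomorphic F G -> isomorphic G F.
Proof.
move=> [f [g fK gK] fE]; exists g; first by exists f.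
by move=> e; rewrite fE -imset_comp (eq_imset (g := id)) ?imset_id.
Qed.

Lemma iso_trans (F G H : hypergraph) : isomorphic F G -> isomorphic G H -> isomorphic F H.
Proof.
move=> [f fB fE] [g gB gE]; exists (g \o f); first exact: bij_comp.
by move=> e; rewrite fE gE imset_comp.
Qed.

Lemma embeds_path_free (V W : finType) (E : {set {set V}}) (Y : {set {set W}}) :
  embeds E Y -> P_free Y -> P_free E.
Proof.
move=> [f fI fE] PY e g h eE gE hE eg he hg.
have fm (s t : {set V}) : meet (f @: s) (f @: t) = meet s t.
  by rewrite -(card_imset (mem (s :&: t)) fI) imsetI //; apply: in2W.
by apply: (PY (f @: e) (f @: g) (f @: h)); rewrite ?fE ?fm.
Qed.

(** Both lists are completed to enumerations of their types, which are matched position by position.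
    Embeddings into the standard 3-graphs are obtained by prescribing values in this way. *)
Lemma injection_with (V W : finType) (s : seq V) (t : seq W) (w0 : W) :
  #|V| = #|W| -> uniq s -> uniq t -> size s = size t ->
  exists2 f : V -> W, injective f & map f s = t.
Proof.
move=> VW us ut st.
pose ext (T : finType) (l : seq T) := l ++ [seq x <- enum T | x \notin l].
have ext_uniq (T : finType) (l : seq T) : uniq l -> uniq (ext T l).
  move=> ul; rewrite cat_uniq ul filter_uniq ?enum_uniq // andbT.
  by apply/hasPn=> x; rewrite mem_filter => /andP[].
have ext_mem (T : finType) (l : seq T) x : x \in ext T l.
  by rewrite mem_cat mem_filter mem_enum andbT orbN.
have ext_size (T : finType) (l : seq T) : uniq l -> size (ext T l) = #|T|.
  move=> ul; rewrite -(card_uniqP (ext_uniq _ _ ul)); apply: eq_card => x.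
  by rewrite ext_mem.
exists (fun v => nth w0 (ext W t) (index v (ext V s))).
  move=> u v /eqP; rewrite nth_uniq ?ext_uniq ?ext_size //;
    try by rewrite -VW -(ext_size _ s) // index_mem ext_mem.
  by move=> /eqP /(congr1 (nth u (ext V s))); rewrite !nth_index.
apply: (@eq_from_nth _ w0); rewrite size_map // => i lti.
have [v0 _|] := pickP (mem s); last first.
  by case: s us st lti {ext_uniq ext_size} => [|x s'] // _ _ _ /(_ x); rewrite /= inE eqxx.
rewrite (nth_map v0) // index_cat mem_nth // index_uniq // nth_cat -st lti //.
Qed.

End Embeddings.

(** * The loose path by intersection sizes and by embedding *)

Section LoosePath.
Variables (V : finType) (E : {set {set V}}).

Lemma three_graphT : reflect (three_graph [set: V] E) (is_3graph E).
Proof.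
apply: (iffP forall_inP) => tE e eE; last exact/eqP/(tE _ eE).1.
by split; [exact/eqP/tE | exact: subsetT].
Qed.

Lemma loose_path_free : is_3graph E ->
  reflect (P_free E) (~~ contains (Hypergraph E) loose_path).
Proof.
move=> /three_graphT tE; apply: (iffP idP) => [nc e f g eE fE gE ef ge gf|Pf].
  case/negP: nc.
  have [c ec] := meet1P ge; have [d gd] := meet1P gf.
  have /setIP[cg ce] : c \in g :&: e by rewrite ec inE.
  have /setIP[dg df] : d \in g :&: f by rewrite gd inE.
  have cf := meet0_notin ef ce.
  have cd : c != d by apply: contraNneq cf => ->.
  have := cardsD1 c e; rewrite ce (tE _ eE).1 => -[/esym/eqP/cards2P[a [b [ab eab]]]].
  have := cardsD1 d f; rewrite df (tE _ fE).1 => -[/esym/eqP/cards2P[u [v [uv fuv]]]].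
  have [w gw] : exists w, g :\ d :\ c = [set w].
    apply/cards1P; have := cardsD1 c (g :\ d); have := cardsD1 d g.
    by rewrite in_setD1 cd cg dg (tE _ gE).1; nlia.
  have [[ac ae] [bc be]] : (a != c /\ a \in e) /\ (b != c /\ b \in e).
    by split; apply/andP; rewrite -in_setD1 eab !inE eqxx ?orbT.
  have [[ud uf] [vd vf]] : (u != d /\ u \in f) /\ (v != d /\ v \in f).
    by split; apply/andP; rewrite -in_setD1 fuv !inE eqxx ?orbT.
  have /and3P[wc wd wg] : [&& w != c, w != d & w \in g].
    by have := set11 w; rewrite -gw !inE.
  have disj x y : x \in e -> y \in f -> x != y.
    by move=> xe yf; apply: contraTneq yf => <-; exact: meet0_notin ef xe.
  have wne x : x \in e -> w != x.
    move=> xe; apply: contraNneq wc => wx.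
    by rewrite -in_set1 -ec inE wg wx.
  have wnf x : x \in f -> w != x.
    move=> xf; apply: contraNneq wd => wx.
    by rewrite -in_set1 -gd inE wg wx.
  (* The order along the path: joints [c] and [d] at positions 2 and 4, with [w] between them. *)
  pose s := [:: a; b; c; w; d; u; v].
  have us : uniq s.
    have d3 x : x \in e -> [/\ x != d, x != u & x != v] by move=> xe; split; apply: disj.
    have [[[ad au av] [bd bu bv]] [_ cu cv]] := (d3 _ ae, d3 _ be, d3 _ ce).
    rewrite /= !inE !negb_or ab ac bc cd uv ad au av bd bu bv cu cv wd (wnf _ uf) (wnf _ vf).
    by rewrite (eq_sym a w) (eq_sym b w) (eq_sym c w) !wne // (eq_sym d) ud (eq_sym d) vd.
  have inj : injective (fun i : 'I_7 => nth a s i).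
    by move=> i j /eqP; rewrite nth_uniq // => /eqP/val_inj.
  apply/existsP; exists [ffun i : 'I_7 => nth a s i]; apply/andP; split.
    by apply/injectiveP=> i j; rewrite /= !ffunE => /inj.
  have img (i j k : nat) : i < 7 -> j < 7 -> k < 7 ->
      [ffun i : 'I_7 => nth a s i] @: [set inord i; inord j; inord k] =
      [set nth a s i; nth a s j; nth a s k].
    move=> i7 j7 k7; rewrite imsetU imsetU1 !imset_set1 !ffunE !inordK //.
  apply/forall_inP=> h; rewrite /loose_path /= !inE -orbA => /or3P[]/eqP->; rewrite img //=.
  - suff <- : e = [set a; b; c] by [].
    by rewrite -(setD1K ce) eab setUC.
  - suff <- : g = [set c; w; d] by [].
    rewrite -(setD1K dg) -(setD1K (_ : c \in g :\ d)) ?in_setD1 ?cd // gw.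
    by rewrite setUC -setUA.
  - suff <- : f = [set d; u; v] by [].
    by rewrite -(setD1K df) fuv setUA.
apply/negP=> /existsP[f /andP[/injectiveP fI /forall_inP fE]].
pose u (k : nat) : 'I_7 := inord k.
have ne i j : i < 7 -> j < 7 -> i != j -> f (u i) != f (u j).
  move=> i7 j7; apply: contraNneq => /fI /(congr1 val).
  by rewrite /= !inordK // => ->.
have img i j k : f @: [set u i; u j; u k] = [set f (u i); f (u j); f (u k)].
  by rewrite imsetU imsetU1 !imset_set1.
have e1 := fE [set u 0; u 1; u 2] (ltac:(by rewrite /= !inE eqxx)).
have e2 := fE [set u 2; u 3; u 4] (ltac:(by rewrite /= !inE eqxx orbT)).
have e3 := fE [set u 4; u 5; u 6] (ltac:(by rewrite /= !inE eqxx !orbT)).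
rewrite !img in e1 e2 e3.
apply: (Pf _ _ _ e1 e3 e2); rewrite meet_set3 ?ne // !inE;
  by rewrite ?eqxx !(negbTE (ne _ _ _ _ _)) ?orbT.
Qed.
End LoosePath.

(** * The recursion for the orders *)

Section Levels.
Variable n : nat.
Notation graph := {set {set 'I_n}}.
Implicit Types (E Y Z : graph) (Ys Zs : seq graph) (A : {set graph}).

Definition good E := three_graph setT E /\ P_free E.

(** [A] contains all labelled copies of its members; for embeddings into [A] the short list [Ys]
    does the same service. *)
Definition represents A Ys :=
  (forall E, E \in A -> exists2 Y, Y \in Ys & embeds E Y) /\
  (forall Y, Y \in Ys -> Y \in A).

Lemma admissibleP A Ys E : represents A Ys ->
  E \in admissible loose_path A <-> good E /\ forall Y, Y \in Ys -> ~ embeds E Y.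
Proof.
move=> [AY YA]; rewrite inE; split.
  case/and3P=> tE fE /forall_inP nE; split.
    by split; [exact/three_graphT | exact/loose_path_free].
  by move=> Y /YA /nE /negP nc /containsP.
move=> [[tE PE] nE]; have tE' : is_3graph E by apply/three_graphT.
rewrite tE' (introT (loose_path_free tE')) //=; apply/forall_inP=> E' /AY[Y YYs E'Y].
by apply/negP=> /containsP EE'; apply: (nE Y YYs); apply: embeds_trans E'Y.
Qed.

Lemma level A Ys Zs m : represents A Ys -> Zs != [::] ->
  (forall Z, Z \in Zs -> good Z /\ #|Z| = m) ->
  (forall Z Y, Z \in Zs -> Y \in Ys -> ~ embeds Z Y) ->
  (forall E, good E -> m <= #|E| -> exists2 Y, Y \in Ys ++ Zs & embeds E Y) ->
  [/\ max_size loose_path A = m,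
      forall E, E \in max_admissible loose_path A <->
        exists2 Z, Z \in Zs & isomorphic (Hypergraph E) (Hypergraph Z)
    & represents (A :|: max_admissible loose_path A) (Ys ++ Zs)].
Proof.
move=> AY Zs0 goodZ nZY cover.
have admZ Z : Z \in Zs -> Z \in admissible loose_path A.
  move=> ZZs; apply/(admissibleP _ AY); split; first exact: (goodZ _ ZZs).1.
  by move=> Y; apply: nZY.
have large E : E \in admissible loose_path A -> m <= #|E| ->
    exists2 Z, Z \in Zs & embeds E Z.
  move=> /(admissibleP _ AY)[gE nE] /(cover _ gE)[Y]; rewrite mem_cat.
  by case/orP=> [/nE //|YZs EY]; exists Y.
have maxm : max_size loose_path A = m.
  apply/eqP; rewrite eqn_leq; apply/andP; split.
    apply/bigmax_leqP=> E /large; case: (leqP #|E| m) => // lt /(_ (ltnW lt))[Z /goodZ[_ Zm]].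
    by move/embeds_card; rewrite Zm leqNgt lt.
  case: Zs Zs0 goodZ admZ {nZY cover large} => // Z s _ goodZ admZ.
  have [_ <-] := goodZ Z (mem_head _ _).
  by apply: (bigmax_sup Z) => //; exact: admZ (mem_head _ _).
have maxP E : E \in max_admissible loose_path A <->
    exists2 Z, Z \in Zs & isomorphic (Hypergraph E) (Hypergraph Z).
  rewrite inE maxm; split.
    case/andP=> admE /eqP Em; have [|Z ZZs EZ] := large _ admE; first by rewrite Em.
    by exists Z => //; apply: embeds_iso; rewrite // Em (goodZ _ ZZs).2.
  case=> Z ZZs EZ; have [[tZ PZ] Zm] := goodZ _ ZZs; have eEZ := iso_embeds EZ.
  have eZE := iso_embeds (iso_sym EZ); apply/andP; split; last first.
    by rewrite -Zm eqn_leq !embeds_card.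
  apply/(admissibleP _ AY); split=> [|Y YYs EY]; last first.
    by apply: (nZY Z Y ZZs YYs); apply: embeds_trans EY.
  split; last exact: embeds_path_free PZ.
  have [f fI fE] := eEZ; move=> e eE; split; last exact: subsetT.
  by rewrite -(card_imset (mem e) fI); exact: (tZ _ (fE _ eE)).1.
split=> //; case: AY => AY YA; split=> [E|Y].
  rewrite in_setU => /orP[/AY[Y YYs EY]|/maxP[Z ZZs /iso_embeds EZ]].
    by exists Y; rewrite // mem_cat YYs.
  by exists Z; rewrite // mem_cat ZZs orbT.
rewrite mem_cat in_setU => /orP[/YA->//|YZs]; apply/orP; right; apply/maxP.
by exists Y => //; exists id; [exists id | move=> e; rewrite imset_id].
Qed.

Definition level_list Ys m := Ys != [::] /\ forall Y, Y \in Ys -> good Y /\ #|Y| = m.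

(** A single cover from [m3] edges on is enough: for larger 3-graphs the later lists drop out, as
    their members have too few edges. *)
Lemma third_level (Y1 Y2 Y3 : seq graph) m1 m2 m3 : m3 < m2 -> m2 < m1 ->
  level_list Y1 m1 -> level_list Y2 m2 -> level_list Y3 m3 ->
  (forall Z Y, Z \in Y2 -> Y \in Y1 -> ~ embeds Z Y) ->
  (forall Z Y, Z \in Y3 -> Y \in Y1 ++ Y2 -> ~ embeds Z Y) ->
  (forall E, good E -> m3 <= #|E| -> exists2 Y, Y \in Y1 ++ Y2 ++ Y3 & embeds E Y) ->
  ex loose_path n 3 = m3 /\ forall E, E \in Ex loose_path n 3 <->
    exists2 Z, Z \in Y3 & isomorphic (Hypergraph E) (Hypergraph Z).
Proof.
move=> lt32 lt21 [Y10 g1] [Y20 g2] [Y30 g3] n21 n3 cover.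
have cover2 E : good E -> m2 <= #|E| -> exists2 Y, Y \in Y1 ++ Y2 & embeds E Y.
  move=> gE le; have [|Y] := cover E gE; first by nlia.
  rewrite catA mem_cat => /orP[|/g3[_ Ym] /embeds_card]; first by exists Y.
  by rewrite Ym; nlia.
have cover1 E : good E -> m1 <= #|E| -> exists2 Y, Y \in Y1 & embeds E Y.
  move=> gE le; have [|Y] := cover2 E gE; first by nlia.
  rewrite mem_cat => /orP[|/g2[_ Ym] /embeds_card]; first by exists Y.
  by rewrite Ym; nlia.
have rep0 : represents (set0 : {set graph}) [::] by split=> // E; rewrite inE.
have [_ _ rep1] := level rep0 Y10 g1 (fun _ _ _ (h : false) => ltac:(done)) cover1.
have [_ _ rep2] := level rep1 Y20 g2 n21 cover2.
have [e3 E3 _] := level rep2 Y30 g3 n3 (fun E gE le => ltac:(rewrite -catA; exact: cover)).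
by split.
Qed.
End Levels.

(** * The standard 3-graphs and their sizes *)

Section Cards.
Variable V : finType.
Implicit Types (A B K L S e f g h : {set V}) (H : {set {set V}}) (c v w x y z : V).

(** Models on a single vertex type: with four vertices in [K], one of them [c], this is Co(n). For
    [c] outside [K], [clique_star] is the disjoint union of a complete 3-graph and a full star. *)
Definition comet K c := complete_on K :|: star_on c (c |: ~: K).
Definition clique_star K c := complete_on K :|: star_on c (~: K).
Definition cliques K L := complete_on K :|: complete_on L.

Lemma card_complete_on A : #|complete_on A| = 'C(#|A|, 3).
Proof. by rewrite -cards_draws; apply: eq_card => e; rewrite !inE andbC. Qed.

Lemma card_star_on c A : c \in A -> #|star_on c A| = 'C(#|A| - 1, 2).
Proof.
move=> cA; have -> : #|A| - 1 = #|A :\ c| by rewrite (cardsD1 c A) cA addKn.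
rewrite -cards_draws.
have -> : star_on c A = [set c |: p | p in [set p : {set V} | p \subset A :\ c & #|p| == 2]].
  apply/setP=> e; apply/idP/imsetP => [|[p]]; rewrite !inE.
    case/andP=> /andP[/eqP e3 eA] ce; exists (e :\ c); last by rewrite setD1K.
    by rewrite inE setSD //=; have := cardsD1 c e; rewrite ce e3 add1n => -[<-].
  rewrite subsetD1 => /andP[/andP[pA cp] /eqP p2] ->; rewrite cardsU1 cp p2 setU11 andbT /=.
  by rewrite subUset sub1set cA.
rewrite card_in_imset // => p q; rewrite !inE !subsetD1.
case/andP=> /andP[_ cp] _ /andP[/andP[_ cq] _] /(congr1 (fun s => s :\ c)).
by rewrite !setU1K.
Qed.

Lemma disjoint_complete A B : #|A :&: B| < 3 -> complete_on A :&: complete_on B = set0.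
Proof.
move=> lt; apply/setP=> e; rewrite !inE; apply/negP.
case/andP=> /andP[/eqP e3 eA] /andP[_ eB]; have : e \subset A :&: B by rewrite subsetI eA.
by move/subset_leq_card; rewrite e3 leqNgt lt.
Qed.

Lemma star_on_sub c A : star_on c A \subset complete_on A.
Proof. by apply/subsetP=> e; rewrite inE => /andP[]. Qed.

Lemma card_setUI0 (P Q P' Q' : {set {set V}}) : P \subset P' -> Q \subset Q' ->
  P' :&: Q' = set0 -> #|P :|: Q| = #|P| + #|Q|.
Proof.
move=> PP QQ PQ; rewrite cardsU; have -> : P :&: Q = set0.
  by apply/eqP; rewrite -subset0 -PQ setISS.
by rewrite cards0 subn0.
Qed.

Lemma card_comet K c : c \in K -> #|comet K c| = 'C(#|K|, 3) + 'C(#|V| - #|K|, 2).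
Proof.
move=> cK; rewrite (card_setUI0 (subxx _) (star_on_sub _ _)); last first.
  apply: disjoint_complete; rewrite setIUr setICr setU0.
  by rewrite (leq_ltn_trans (subset_leq_card (subsetIr _ _))) // cards1.
rewrite card_complete_on card_star_on ?setU11 // cardsU1 inE cK add1n subn1.
by rewrite -(cardsC K) addKn.
Qed.

Lemma card_clique_star K c : c \notin K ->
  #|clique_star K c| = 'C(#|K|, 3) + 'C(#|V| - #|K| - 1, 2).
Proof.
move=> cK; rewrite (card_setUI0 (subxx _) (star_on_sub _ _)); last first.
  by apply: disjoint_complete; rewrite setICr cards0.
by rewrite card_complete_on card_star_on ?inE // -(cardsC K) addKn.
Qed.

Lemma card_cliques K L : [disjoint K & L] -> #|cliques K L| = 'C(#|K|, 3) + 'C(#|L|, 3).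
Proof.
move=> dKL; rewrite (card_setUI0 (subxx _) (subxx _)) ?card_complete_on //.
by apply: disjoint_complete; rewrite (eqP (_ : K :&: L == set0)) ?cards0 // setI_eq0.
Qed.

(** The edges at [v] that meet the triple are a full star without a star on [n - 3] vertices, which
    leaves 3 n - 9; the triple itself is one more. *)
Lemma card_G1_edges x y z v : uniq [:: x; y; z; v] -> #|G1_edges x y z v| = 3 * #|V| - 8.
Proof.
move=> us; pose T := [set x; y; z].
have T3 : #|T| = 3 by move: us; rewrite /= !inE !negb_or => /and3P[/and3P[xy xz _] /andP[yz _] _]; exact: card_set3.
have vT : v \notin T.
  move: us; rewrite /= !inE !negb_or => /and4P[/and3P[_ _ xv] /andP[_ yv] zv _].
  by rewrite !(eq_sym v) xv yv zv.
rewrite /G1_edges cardsU1 -/T inE (negbTE vT) andbF /=.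
have -> : [set h : {set V} | [&& #|h| == 3, v \in h & h :&: T != set0]] =
    star_on v setT :\: star_on v (~: T).
  apply/setP=> h; rewrite !inE subsetT -disjoints_subset -setI_eq0.
  by case: (_ == 3); case: (v \in h); rewrite ?andbF ?andbT ?orbF.
rewrite cardsD (setIidPr _); last first.
  by apply/subsetP=> h; rewrite !inE subsetT => /andP[/andP[-> _] ->].
rewrite (card_star_on (in_setT v)) card_star_on ?in_setC // cardsT -(cardsC T) T3.
have : 0 < #|~: T| by apply/card_gt0P; exists v; rewrite in_setC.
case: #|_| => // k _; rewrite (_ : 3 + k.+1 - 1 = k + 3); last nlia.
rewrite subn1 /= binD; have -> : 'C(3, 2) = 3 by []; nlia.
Qed.

(** An edge with two vertices in the triple is given by the vertex it omits there and by its vertex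
    outside: 3 (n - 3) edges. *)
Lemma card_G2_edges x y z : uniq [:: x; y; z] -> #|G2_edges x y z| = 3 * #|V| - 8.
Proof.
move=> us; pose T := [set x; y; z].
have T3 : #|T| = 3 by move: us; rewrite /= !inE !negb_or => /and3P[/andP[xy xz] yz _]; exact: card_set3.
rewrite /G2_edges cardsU1 -/T inE setIid T3 /=.
have -> : [set h : {set V} | (#|h| == 3) && (#|h :&: T| == 2)] =
    [set p.2 |: (T :\ p.1) | p in setX T (~: T)].
  apply/setP=> h; apply/idP/imsetP => [|[[t w] /setXP[/= tT wT] ->]].
    rewrite inE => /andP[/eqP h3 /eqP hT]; have := cardsID T h; rewrite h3 hT.
    move=> hD; have /cards1P[w hw] : #|h :\: T| == 1 by nlia.
    have := cardsID h T; rewrite T3 setIC hT => hD'.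
    have /cards1P[t ht] : #|T :\: h| == 1 by nlia.
    have /setDP[tT th] : t \in T :\: h by rewrite ht set11.
    have /setDP[wh wT] : w \in h :\: T by rewrite hw set11.
    exists (t, w); first by rewrite in_setX tT inE.
    rewrite /= -(setID h T) hw setUC; congr (_ :|: _); rewrite -ht setDDr setDv set0U.
    exact: setIC.
  rewrite in_setC in wT; rewrite in_set cardsU1 in_setD1 (negbTE wT) andbF.
  have := cardsD1 t T; rewrite tT T3 add1n => -[E]; rewrite -E /= setIUl.
  rewrite (setIidPl (subsetDl _ _)) (eqP (_ : [set w] :&: T == set0)) ?set0U -?E //.
  by rewrite setI_eq0 disjoints1.
rewrite card_in_imset; first by rewrite cardsX -(cardsC T) T3; nlia.
move=> [t w] [t' w'] /setXP[/= tT wT] /setXP[/= t'T w'T] E.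
rewrite in_setC in wT; rewrite in_setC in w'T.
have ww : w = w'.
  have := setU11 w (T :\ t); rewrite E in_setU1 in_setD1 (negbTE wT) andbF orbF.
  by move/eqP.
congr pair; last by [].
apply/eqP/negPn/negP=> tt'.
have : t \in w' |: (T :\ t') by rewrite in_setU1 in_setD1 tt' tT orbT.
by rewrite -E in_setU1 in_setD1 eqxx orbF => /eqP tw; rewrite -tw tT in wT.
Qed.
End Cards.

(** * Embedding a classified 3-graph into its standard model *)

Section IntoBases.
Variables (V W : finType) (E : {set {set V}}).
Hypotheses (VW : #|V| = #|W|) (tE : three_graph setT E).

Let E3 e : e \in E -> #|e| = 3. Proof. by move/tE => []. Qed.

Let fK_image (f : V -> W) (K : {set V}) (K0 : {set W}) :
  injective f -> map f (enum K) = enum K0 -> f @: K = K0.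
Proof.
move=> fI fK; apply/setP=> y; rewrite -[in RHS]mem_enum -fK; apply/imsetP/mapP => -[x xK ->];
  by exists x; rewrite // ?mem_enum // -mem_enum.
Qed.

Lemma embeds_star c : star_like E -> embeds E (star_on (c : W) setT).
Proof.
move=> [v Hv]; have [f fI [fv]] := @injection_with V W [:: v] [:: c] c VW isT isT (erefl _).
exists f => // e eE; rewrite !inE subsetT card_imset // E3 //= -fv.
by rewrite mem_imset // Hv.
Qed.

Lemma embeds_cliques (K L : {set V}) (K0 L0 : {set W}) :
  [disjoint K & L] -> [disjoint K0 & L0] -> #|K| = #|K0| -> #|L| = #|L0| ->
  (forall e, e \in E -> e \subset K \/ e \subset L) -> embeds E (cliques K0 L0).
Proof.
move=> dKL dKL0 cK cL HE.
(* The empty 3-graph is treated apart, since [W] might then have no element to serve as default. *)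
have [E0|/set0Pn[e0 e0E]] := eqVneq E set0.
  have [f fI _] : exists2 f : V -> W, injective f & True.
    have [w _|W0] := pickP (@predT W).
      by have [f fI _] := @injection_with V W [::] [::] w VW isT isT (erefl _); exists f.
    have V0 (v : V) : False.
      have : 0 < #|V| by apply/card_gt0P; exists v.
      by rewrite VW => /card_gt0P[w _]; have := W0 w.
    by exists (fun v => False_rect W (V0 v)) => // v; case: (V0 v).
  by exists f => // e; rewrite E0 inE.
have [w _] : exists w : W, True.
  have : 0 < #|V| by have /card_gt0P[v _] : 0 < #|e0|; [rewrite E3 | apply/card_gt0P; exists v].
  by rewrite VW => /card_gt0P[w _]; exists w.
have unq (T : finType) (S S' : {set T}) : [disjoint S & S'] -> uniq (enum S ++ enum S').
  move=> d; rewrite cat_uniq !enum_uniq andbT /=; apply/hasPn=> x; rewrite /= !mem_enum.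
  by move=> xS'; rewrite (disjointFl d xS').
have [f fI] := @injection_with V W (enum K ++ enum L) (enum K0 ++ enum L0) w VW
  (unq _ _ _ dKL) (unq _ _ _ dKL0) (ltac:(by rewrite !size_cat -!cardE cK cL)).
rewrite map_cat => /eqP; rewrite eqseq_cat; last by rewrite size_map -!cardE.
case/andP=> /eqP /(fK_image fI) fK /eqP /(fK_image fI) fL.
exists f => // e eE; rewrite !inE card_imset // E3 //=.
by case: (HE _ eE) => s; rewrite -?fK -?fL ?(imsetS f s) ?orbT.
Qed.

Let point_set (K : {set V}) (K0 : {set W}) v c : #|K| = #|K0| ->
  (v \in K) = (c \in K0) -> exists f : V -> W, [/\ injective f, f v = c & f @: K = K0].
Proof.
move=> cK vc; have cK1 := cardsD1 v K; have cK2 := cardsD1 c K0.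
have u1 : uniq (v :: enum (K :\ v)) by rewrite /= enum_uniq mem_enum !inE eqxx.
have u2 : uniq (c :: enum (K0 :\ c)) by rewrite /= enum_uniq mem_enum !inE eqxx.
have sz : size (v :: enum (K :\ v)) = size (c :: enum (K0 :\ c)).
  by rewrite /= -!cardE; nlia.
have [f fI fE] := injection_with c VW u1 u2 sz.
case: fE => fv /(fK_image fI) fK; exists f; split=> //.
have [vK|vK] := boolP (v \in K); last first.
  have cK0 : c \notin K0 by rewrite -vc.
  have SD (T : finType) (S : {set T}) x : x \notin S -> S :\ x = S.
    by move=> xS; apply/setP=> y; rewrite !inE; case: eqVneq => // ->; apply/esym/negbTE.
  by rewrite -(SD _ _ _ vK) fK SD.
by rewrite -(setD1K vK) imsetU1 fK fv setD1K // -vc.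
Qed.

Let meet_image (f : V -> W) (e K : {set V}) : injective f -> f @: e :&: f @: K = f @: (e :&: K).
Proof. by move=> fI; rewrite imsetI //; apply: in2W. Qed.

Lemma embeds_comet (K0 : {set W}) c : #|K0| = 4 -> c \in K0 -> comet_like setT E ->
  embeds E (comet K0 c).
Proof.
move=> c4 cK0 [K [v [_ K4 vK HK]]].
have [f [fI fv fK]] := @point_set K K0 v c (etrans K4 (esym c4)) (etrans vK (esym cK0)).
exists f => // e eE; rewrite !inE card_imset // E3 //=.
case: (HK _ eE) => s; first by rewrite -fK imsetS.
have fe : f @: e :&: K0 = [set c] by rewrite -fK meet_image // s imset_set1 fv.
apply/orP; right; have /setIP[-> _] : c \in f @: e :&: K0 by rewrite fe set11.
rewrite andbT; apply/subsetP=> y ye; rewrite in_setU1 in_setC.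
have [//|yc] := eqVneq y c; apply/negP=> yK; have : y \in f @: e :&: K0 by rewrite inE ye.
by rewrite fe inE (negbTE yc).
Qed.

Lemma embeds_clique_star (K : {set V}) (K0 : {set W}) v c : #|K| = #|K0| ->
  v \notin K -> c \notin K0 ->
  (forall e, e \in E -> e \subset K \/ meet e K = 0 /\ v \in e) -> embeds E (clique_star K0 c).
Proof.
move=> cK vK cK0 HK.
have [f [fI fv fK]] := @point_set K K0 v c cK (etrans (negbTE vK) (esym (negbTE cK0))).
exists f => // e eE; rewrite !inE card_imset // E3 //=.
case: (HK _ eE) => [s|[s ve]]; first by rewrite -fK imsetS.
have -> : c \in f @: e by rewrite -fv mem_imset.
apply/orP; right; rewrite andbT -disjoints_subset -setI_eq0 -fK meet_image //.
by move/eqP: s; rewrite cards_eq0 => /eqP->; rewrite imset0.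
Qed.

Lemma embeds_G1 (x y z v : W) : uniq [:: x; y; z; v] -> G1_like E ->
  embeds E (G1_edges x y z v).
Proof.
move=> us [x' [y' [z' [v' [us' sub]]]]].
have [f fI [fx fy fz fv]] := injection_with x VW us' us (erefl _).
have fT : f @: [set x'; y'; z'] = [set x; y; z].
  by rewrite imsetU imsetU1 !imset_set1 fx fy fz.
exists f => // e eE; have := subsetP sub _ eE; rewrite !in_setU1 => /orP[/eqP->|].
  by rewrite fT eqxx.
rewrite !in_set => /and3P[e3 ve eT]; rewrite card_imset // e3 -fv mem_imset // ve /=.
rewrite -fT meet_image //; apply/orP; right.
by rewrite -card_gt0 card_imset // card_gt0.
Qed.

Lemma embeds_G2 (x y z : W) : uniq [:: x; y; z] -> G2_like E ->
  embeds E (G2_edges x y z).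
Proof.
move=> us [x' [y' [z' [us' sub]]]].
have [f fI [fx fy fz]] := injection_with x VW us' us (erefl _).
have fT : f @: [set x'; y'; z'] = [set x; y; z].
  by rewrite imsetU imsetU1 !imset_set1 fx fy fz.
exists f => // e eE; have := subsetP sub _ eE; rewrite !in_setU1 => /orP[/eqP->|].
  by rewrite fT eqxx.
rewrite !in_set => /andP[e3 eT]; rewrite card_imset // e3 /=.
by rewrite -fT meet_image // card_imset // eT orbT.
Qed.
End IntoBases.

(** * The standard 3-graphs avoid the loose path *)

Section PathFree.
Variable V : finType.
Implicit Types (A B K L S e f g h : {set V}) (H : {set {set V}}) (c v w x y z : V).

Lemma intersecting_path_free H : intersecting H -> P_free H.
Proof. by move=> iH e f g eH fH _ ef; have := iH _ _ eH fH; rewrite ef. Qed.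

Lemma star_like_path_free H : star_like H -> P_free H.
Proof.
move=> [v Hv]; apply: intersecting_path_free => e f /Hv ve /Hv vf.
exact: meet_gt0 ve vf.
Qed.

(** Of two disjoint edges, one avoids [v] and is therefore [K :\ v]. An edge inside [K] meets it at
    least twice, and any other edge not at all. *)
Lemma comet_like_path_free A H : three_graph A H -> comet_like A H -> P_free H.
Proof.
move=> tH [K [v [_ K4 vK HK]]].
have main e f g : e \in H -> f \in H -> g \in H -> v \notin e -> meet e f = 0 ->
    meet g e = 1 -> meet g f = 1 -> False.
  move=> eH fH gH ve ef ge gf.
  have eK : e \subset K.
    case: (HK _ eH) => // eKv; case/negP: ve.
    by have /setIP[] : v \in e :&: K by rewrite eKv inE.
  have eE : e = K :\ v.
    apply/eqP; rewrite eqEcard subsetD1 eK ve (tH _ eH).1.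
    by have := cardsD1 v K; rewrite vK K4; nlia.
  case: (HK _ gH) => [gK|gKv].
    have : #|e :|: g| <= 4 by rewrite -K4 subset_leq_card // subUset eK.
    by rewrite cardsU meetC ge (tH _ eH).1 (tH _ gH).1.
  have [y [yg ye]] : exists y, y \in g /\ y \in e by apply: meet_gt0P; rewrite ge.
  have : y \in g :&: K by rewrite inE yg (subsetP eK).
  by rewrite gKv inE => /eqP yv; rewrite -yv ye in ve.
move=> e f g eH fH gH ef ge gf; have [ve|ve] := boolP (v \in e).
  by apply: (main f e g); rewrite ?(meet0_notin ef) // meetC.
exact: (main e f g).
Qed.

(* Edges that meet lie in the same part of a closed decomposition. *)
Lemma closed_path_free H K : (forall e, e \in H -> e \subset K \/ meet e K = 0) ->
  P_free (inside H K) -> P_free (inside H (~: K)) -> P_free H.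
Proof.
move=> HK P1 P2 e f g eH fH gH ef ge gf.
have out h : h \in H -> meet h K = 0 -> h \in inside H (~: K).
  by move=> hH m0; rewrite inE hH -disjoints_subset -setI_eq0 -cards_eq0 m0.
have same h : h \in H -> 0 < meet g h -> (h \subset K /\ g \subset K) \/
    (meet h K = 0 /\ meet g K = 0).
  move=> hH /meet_gt0P[y [yg yh]].
  have [hK|hK] := HK _ hH; have [gK|gK] := HK _ gH; try by [left|right].
    by move: (meet0_notin gK yg); rewrite (subsetP hK).
  by move: (meet0_notin hK yh); rewrite (subsetP gK).
have [|[eK gK]|[eK gK]] := same e eH; first by rewrite ge.
  have [|[fK _]|[_ gK']] := same f fH; first by rewrite gf.
    by apply: (P1 e f g); rewrite ?inE ?eH ?fH ?gH.
  have : #|g| = 0 by rewrite -gK' (setIidPl gK).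
  by move/eqP; rewrite cards_eq0 => /eqP g0; rewrite g0 set0I cards0 in ge.
have [|[_ gK']|[fK _]] := same f fH; first by rewrite gf.
  have : #|g| = 0 by rewrite -gK (setIidPl gK').
  by move/eqP; rewrite cards_eq0 => /eqP g0; rewrite g0 set0I cards0 in ge.
by apply: (P2 e f g); rewrite ?out.
Qed.

(** Two disjoint edges fill the six vertices, so a third edge lies in their union and cannot have
    just one vertex in each. *)
Lemma small_path_free A H K : three_graph A H -> #|K| <= 6 ->
  (forall e, e \in H -> e \subset K) -> P_free H.
Proof.
move=> tH K6 HK e f g eH fH gH ef ge gf.
have efK : #|e :|: f| <= #|K| by rewrite subset_leq_card // subUset !HK.
have cef : #|e :|: f| = 6 by rewrite cardsU ef (tH _ eH).1 (tH _ fH).1.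
have E : e :|: f = K.
  by apply/eqP; rewrite eqEcard subUset !HK // cef.
have : meet g (e :|: f) = 3 by rewrite (setIidPl _) ?(tH _ gH).1 // E HK.
by rewrite setIUr cardsU ge gf; nlia.
Qed.
End PathFree.

(** * Properties that tell the standard 3-graphs apart *)

Section Bases.
Variable V : finType.
Implicit Types (A B K L S T e h : {set V}) (H E Y : {set {set V}}) (c v w x y z : V).

Lemma edge_through c y S : c \in S -> y \in S -> 3 <= #|S| ->
  exists e, [/\ #|e| = 3, e \subset S, c \in e & y \in e].
Proof.
move=> cS yS S3.
have main z : z \in S -> c != z -> exists e, [/\ #|e| = 3, e \subset S, c \in e & z \in e].
  move=> zS cz; have : 0 < #|S :\ c :\ z|.
    by have := cardsD1 c S; have := cardsD1 z (S :\ c); rewrite in_setD1 (eq_sym z) cz cS zS; nlia.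
  case/card_gt0P=> w; rewrite !in_setD1 => /and3P[wz wc wS]; exists [set c; z; w].
  rewrite card_set3 // 1?eq_sym // !inE !eqxx orbT; split=> //.
  by apply/subsetP=> t; rewrite !inE => /orP[/orP[]|] /eqP->.
have [<-|] := eqVneq c y; last exact: main.
have : 0 < #|S :\ c| by have := cardsD1 c S; rewrite cS; nlia.
case/card_gt0P=> z; rewrite in_setD1 => /andP[zc zS].
by have [|e [e3 eS ce _]] := main z zS; [rewrite eq_sym | exists e].
Qed.

Lemma edge_in S v : v \notin S -> 3 <= #|S| -> exists e, [/\ #|e| = 3, e \subset S & v \notin e].
Proof.
move=> vS S3; have /card_gt0P[y yS] : 0 < #|S| by nlia.
have [e [e3 eS _ _]] := edge_through yS yS S3; exists e; split=> //.
by apply: contra vS => /(subsetP eS).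
Qed.

Section Monotone.
Variables E Y : {set {set V}}.
Hypothesis EY : embeds E Y.

(** This and the similar lemmas pass a property down along an embedding, so a 3-graph without the
    property does not embed. *)
Lemma star_like_embeds : star_like Y -> star_like E.
Proof.
case: EY => f fI fE [v Hv]; have [g fK gK] := injF_bij fI; exists (g v) => e /fE /Hv.
by rewrite -[in v \in _](gK v) mem_imset.
Qed.

Let pre (f : V -> V) K : injective f -> f @: (f @^-1: K) = K.
Proof.
move=> fI; have [g fK gK] := injF_bij fI; apply/setP=> y; apply/imsetP/idP.
  by case=> x; rewrite inE => xK ->.
by move=> yK; exists (g y); rewrite ?inE gK.
Qed.

Let pre_sub (f : V -> V) e K : injective f -> (e \subset f @^-1: K) = (f @: e \subset K).
Proof. by rewrite sub_imset_pre. Qed.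

Let pre_card (f : V -> V) K : injective f -> #|f @^-1: K| = #|K|.
Proof. by move=> fI; rewrite -[in RHS](pre K fI) card_imset. Qed.

Let pre_meet (f : V -> V) e K : injective f -> f @: (e :&: f @^-1: K) = f @: e :&: K.
Proof. by move=> fI; rewrite imsetI ?pre //; apply: in2W. Qed.

Lemma comet_like_embeds : comet_like setT Y -> comet_like setT E.
Proof.
case: EY => f fI fE [K [v [_ K4 vK HK]]]; have [g fK gK] := injF_bij fI.
exists (f @^-1: K), (g v); rewrite subsetT pre_card // inE gK; split=> // e eE.
case: (HK _ (fE _ eE)) => s; [left|right]; first by rewrite pre_sub.
by apply: (imset_inj fI); rewrite pre_meet // s imset_set1 gK.
Qed.

Lemma K6_like_embeds : K6_like setT Y -> K6_like setT E.
Proof.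
case: EY => f fI fE [K [_ K6 HK]].
exists (f @^-1: K); rewrite subsetT pre_card //; split=> // e eE.
case: (HK _ (fE _ eE)) => s; [left|right]; first by rewrite pre_sub.
by rewrite -s -pre_meet // card_imset.
Qed.

(** Tells K_6 with a star from two disjoint K_6, of second order on thirteen vertices. *)
Definition two_parts_like H := exists K L,
  [/\ [disjoint K & L], #|K| <= 6, #|L| <= 6 & forall e, e \in H -> e \subset K \/ e \subset L].

Lemma two_parts_like_embeds : two_parts_like Y -> two_parts_like E.
Proof.
case: EY => f fI fE [K [L [dKL K6 L6 HK]]].
exists (f @^-1: K), (f @^-1: L); rewrite !pre_card //; split=> //.
  apply/pred0P=> x /=; rewrite !inE; apply/negP=> /andP[xK].
  by rewrite (disjointFr dKL xK).
by move=> e eE; case: (HK _ (fE _ eE)) => s; [left|right]; rewrite pre_sub.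
Qed.

(** Holds in G_1, where only the triple avoids [v], but not in G_2. *)
Definition almost_star_like H := exists v, forall e f, e \in H -> f \in H ->
  v \notin e -> v \notin f -> e = f.

Lemma almost_star_like_embeds : almost_star_like Y -> almost_star_like E.
Proof.
case: EY => f fI fE [v Hv]; have [g fK gK] := injF_bij fI; exists (g v) => e h eE hE ve vh.
by apply: (imset_inj fI); apply: Hv; rewrite ?fE // -(gK v) mem_imset.
Qed.

Lemma intersecting_embeds : intersecting Y -> intersecting E.
Proof.
case: EY => f fI fE iY e h eE hE; have := iY _ _ (fE _ eE) (fE _ hE).
by rewrite -imsetI ?card_imset //; apply: in2W.
Qed.
End Monotone.

Lemma three_graph_base H : (forall e, e \in H -> #|e| = 3) -> three_graph setT H.
Proof. by move=> H3 e eH; rewrite H3. Qed.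

Lemma three_graph_star c A : three_graph setT (star_on c A).
Proof. by apply: three_graph_base => e; rewrite !inE => /andP[/andP[/eqP]]. Qed.

Lemma three_graph_comet K c : three_graph setT (comet K c).
Proof.
apply: three_graph_base => e; rewrite !inE.
by case/orP=> [/andP[/eqP]|/andP[/andP[/eqP]]].
Qed.

Lemma three_graph_clique_star K c : three_graph setT (clique_star K c).
Proof.
apply: three_graph_base => e; rewrite !inE.
by case/orP=> [/andP[/eqP]|/andP[/andP[/eqP]]].
Qed.

Lemma three_graph_cliques K L : three_graph setT (cliques K L).
Proof.
apply: three_graph_base => e; rewrite !inE.
by case/orP=> /andP[/eqP].
Qed.

Lemma three_graph_G1 x y z v : uniq [:: x; y; z] -> three_graph setT (G1_edges x y z v).
Proof.
rewrite /= !inE negb_or => /and3P[/andP[xy xz] yz _].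
apply: three_graph_base => e; rewrite !inE => /orP[/eqP->|/and3P[/eqP]//].
exact: card_set3.
Qed.

Lemma three_graph_G2 x y z : uniq [:: x; y; z] -> three_graph setT (G2_edges x y z).
Proof.
rewrite /= !inE negb_or => /and3P[/andP[xy xz] yz _].
apply: three_graph_base => e; rewrite !inE => /orP[/eqP->|/andP[/eqP]//].
exact: card_set3.
Qed.

Lemma star_like_star c A : star_like (star_on c A).
Proof. by exists c => e; rewrite inE => /andP[]. Qed.

Lemma comet_like_comet K c : #|K| = 4 -> c \in K -> comet_like setT (comet K c).
Proof.
move=> K4 cK; exists K, c; split=> // e; rewrite !inE => /orP[/andP[_]|]; first by left.
case/andP=> /andP[_ eS] ce; right; apply/setP=> y; rewrite !inE.
have [->|yc] := eqVneq y c; first by rewrite ce.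
by apply/negP=> /andP[/(subsetP eS)]; rewrite !inE (negbTE yc) => /negbTE->.
Qed.

Lemma meet0_compl e K : e \subset ~: K -> meet e K = 0.
Proof. by rewrite -disjoints_subset -setI_eq0 => /eqP->; rewrite cards0. Qed.

Lemma K6_like_cliques K L : #|K| = 6 -> L \subset ~: K -> K6_like setT (cliques K L).
Proof.
move=> K6 LK; exists K; split=> // e; rewrite !inE => /orP[]/andP[_ s]; first by left.
by right; apply: meet0_compl (subset_trans s LK).
Qed.

Lemma two_parts_like_cliques K L : [disjoint K & L] -> #|K| = 6 -> #|L| = 6 ->
  two_parts_like (cliques K L).
Proof.
move=> d K6 L6; exists K, L; rewrite K6 L6; split=> // e.
by rewrite !inE => /orP[]/andP[_]; auto.
Qed.

Lemma intersecting_G1 x y z v : uniq [:: x; y; z] -> intersecting (G1_edges x y z v).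
Proof.
move=> us e f; set T := [set x; y; z].
have T3 : #|T| = 3 by move: us; rewrite /= !inE negb_or => /and3P[/andP[xy xz] yz _]; exact: card_set3.
rewrite !in_setU1 ![_ \in [set h | _]]in_set -/T => /orP[/eqP->|/and3P[_ ve eT]] /orP[/eqP->|/and3P[_ vf fT]].
- by rewrite setIid T3.
- by rewrite card_gt0 setIC.
- by rewrite card_gt0.
- exact: meet_gt0 ve vf.
Qed.

Lemma intersecting_G2 x y z : uniq [:: x; y; z] -> intersecting (G2_edges x y z).
Proof.
move=> us e f; set T := [set x; y; z].
have T3 : #|T| = 3 by move: us; rewrite /= !inE negb_or => /and3P[/andP[xy xz] yz _]; exact: card_set3.
have two h : h \in G2_edges x y z -> 2 <= #|h :&: T|.
  by rewrite in_setU1 in_set -/T => /orP[/eqP->|/andP[_ /eqP->]]; rewrite ?setIid ?T3.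
move=> /two e2 /two f2.
have : #|(e :&: T) :|: (f :&: T)| <= 3 by rewrite -T3 subset_leq_card // subUset !subsetIr.
rewrite cardsU -setIIl => le; have : 0 < #|e :&: f :&: T| by nlia.
by case/card_gt0P=> u /setIP[/setIP[ue uf] _]; apply: meet_gt0 ue uf.
Qed.

Lemma path_free_comet K c : #|K| = 4 -> c \in K -> P_free (comet K c).
Proof.
move=> K4 cK; apply: (comet_like_path_free (@three_graph_comet K c)).
exact: comet_like_comet.
Qed.

Let inside_free H K : three_graph setT H -> #|K| <= 6 -> P_free (inside H K).
Proof.
move=> tH K6; apply: (small_path_free (three_graphS (inside_sub H K) tH) K6) => e.
by rewrite inE => /andP[].
Qed.

Lemma path_free_clique_star K c : #|K| <= 6 -> P_free (clique_star K c).
Proof.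
move=> K6; apply: (@closed_path_free _ _ K).
- move=> e; rewrite !inE => /orP[/andP[_]|/andP[/andP[_ s _]]]; first by left.
  by right; apply: meet0_compl.
- exact: inside_free (@three_graph_clique_star K c) K6.
- apply: star_like_path_free; exists c => e; rewrite !inE -andbA => /andP[/orP[|]].
    move=> /andP[/eqP e3 eK] eCK; have := meet0_compl eCK.
    by rewrite (setIidPl eK) e3.
  by case/and3P.
Qed.

Lemma path_free_cliques K L : #|K| <= 6 -> #|L| <= 6 -> [disjoint K & L] ->
  P_free (cliques K L).
Proof.
move=> K6 L6; rewrite disjoint_sym disjoints_subset => LK.
apply: (@closed_path_free _ _ K).
- move=> e; rewrite !inE => /orP[]/andP[_ s]; first by left.
  by right; apply: meet0_compl (subset_trans s LK).
- exact: inside_free (@three_graph_cliques K L) K6.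
- apply: (small_path_free (A := setT) (K := L)) => // [|e].
    exact: three_graphS (inside_sub _ _) (@three_graph_cliques K L).
  rewrite !inE => /andP[/orP[]/andP[/eqP e3 s] // eCK].
  by have := meet0_compl eCK; rewrite (setIidPl s) e3.
Qed.

Lemma clique_not_star_like H K : complete_on K \subset H -> 4 <= #|K| -> ~ star_like H.
Proof.
move=> sub K4 [v Hv].
have vK : v \notin K :\ v by rewrite !inE eqxx.
have K3 : 3 <= #|K :\ v| by have := cardsD1 v K; case: (v \in K); nlia.
have [e [e3 eK ve]] := edge_in vK K3.
have : e \in H by apply: (subsetP sub); rewrite !inE e3 (subset_trans eK) // subsetDl.
by move/Hv; rewrite (negbTE ve).
Qed.

(** A hub puts all vertices into one component, which excludes a K_6 and a separate rest on seven or
    more vertices. *)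
Definition hub H c := forall y, y != c -> exists e, [/\ e \in H, c \in e & y \in e].

Lemma hub_not_K6_like H c : 7 <= #|V| -> hub H c -> ~ K6_like setT H.
Proof.
move=> V7 hubc [K [_ K6 HK]].
have opposite y : (c \in K) != (y \in K) -> False.
  move=> cy; have [|e [eH ce ye]] := hubc y; first by apply: contraNneq cy => ->.
  case: (HK _ eH) => s; first by move: cy; rewrite !(subsetP s).
  by move: cy; rewrite !(negbTE (meet0_notin s _)).
have [cK|cK] := boolP (c \in K).
  have /card_gt0P[y] : 0 < #|~: K| by have := cardsC K; rewrite K6; nlia.
  by rewrite inE => yK; apply: (opposite y); rewrite cK (negbTE yK).
have /card_gt0P[y yK] : 0 < #|K| by rewrite K6.
by apply: (opposite y); rewrite yK (negbTE cK).
Qed.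

Lemma star_hub c : 3 <= #|V| -> hub (star_on c setT) c.
Proof.
move=> V3 y yc; have [|e [e3 eS ce ye]] := @edge_through c y setT (in_setT _) (in_setT _).
  by rewrite cardsT.
by exists e; rewrite !inE e3 ce subsetT.
Qed.

Lemma comet_hub K c : 3 <= #|K| -> 2 <= #|~: K| -> c \in K -> hub (comet K c) c.
Proof.
move=> K3 CK2 cK y yc; have [yK|yK] := boolP (y \in K).
  by have [e [e3 eS ce ye]] := edge_through cK yK K3; exists e; rewrite !inE e3 eS.
have [||e [e3 eS ce ye]] := @edge_through c y (c |: ~: K) (setU11 _ _).
- by rewrite !inE yK orbT.
- by rewrite cardsU1 inE cK add1n ltnS.
by exists e; rewrite !inE e3 eS ce orbT.
Qed.

Lemma G1_hub x y z v : 3 <= #|V| -> uniq [:: x; y; z; v] -> hub (G1_edges x y z v) v.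
Proof.
move=> V3 us w wv.
have [wT|wT] := boolP (w \in [set x; y; z]).
  have [|e [e3 _ ve we]] := @edge_through v w setT (in_setT _) (in_setT _).
    by rewrite cardsT.
  exists e; split=> //; rewrite in_setU1 in_set e3 ve /=; apply/orP; right.
  by apply/set0Pn; exists w; rewrite in_setI we.
exists [set v; w; x]; split; try by rewrite !inE eqxx ?orbT.
have [xv wx] : x != v /\ w != x.
  by move: us wT; rewrite /= !inE !negb_or => /and4P[/and3P[_ _ ->] _ _ _] /andP[/andP[-> _] _].
have [vx vw] : v != x /\ v != w by rewrite eq_sym xv eq_sym.
rewrite in_setU1 in_set card_set3 // !inE !eqxx /=; apply/orP; right.
by apply/set0Pn; exists x; rewrite !inE eqxx !orbT.
Qed.

Let outside T n : 3 + n <= #|V| -> #|T| = 3 -> n <= #|~: T|.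
Proof. by move=> Vn T3; have := cardsC T; rewrite T3; nlia. Qed.

Lemma G2_edge x y z p q w : uniq [:: x; y; z] -> p != q -> p \in [set x; y; z] ->
  q \in [set x; y; z] -> w \notin [set x; y; z] -> [set p; q; w] \in G2_edges x y z.
Proof.
move=> us pq pT qT wT; rewrite in_setU1 in_set.
have [pw qw] : p != w /\ q != w by split; apply: contraNneq wT => <-.
by rewrite card_set3 // meet_set3 // pT qT (negbTE wT) orbT.
Qed.

Lemma G2_hub x y z : 4 <= #|V| -> uniq [:: x; y; z] -> hub (G2_edges x y z) x.
Proof.
move=> V4 us w wx.
have T3 : #|[set x; y; z]| = 3.
  by move: us; rewrite /= !inE negb_or => /and3P[/andP[xy xz] yz _]; exact: card_set3.
have xT : x \in [set x; y; z] by rewrite !inE eqxx.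
have [wT|wT] := boolP (w \in [set x; y; z]).
  have /card_gt0P[t] := @outside _ 1 V4 T3; rewrite inE => tT.
  exists [set x; w; t]; split; try by rewrite !inE eqxx ?orbT.
  by apply: G2_edge; rewrite // eq_sym.
exists [set x; y; w]; split; try by rewrite !inE eqxx ?orbT.
apply: G2_edge; rewrite // ?inE ?eqxx ?orbT //.
by move: us; rewrite /= !inE negb_or => /and3P[/andP[]].
Qed.

Lemma pair_avoiding x y z u : uniq [:: x; y; z] -> exists p q,
  [/\ p != q, p \in [set x; y; z], q \in [set x; y; z], p != u & q != u].
Proof.
rewrite /= !inE negb_or => /and3P[/andP[xy xz] yz _].
have [ux|ux] := eqVneq x u; first by exists y, z; split; rewrite -?ux ?inE ?eqxx ?orbT // eq_sym.
have [uy|uy] := eqVneq y u; first by exists x, z; split; rewrite -?uy ?inE ?eqxx ?orbT // eq_sym.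
by exists x, y; rewrite !inE !eqxx ?orbT.
Qed.

(** Some pair of the triple avoids [u], and at least two outside vertices other than [u] complete it
    to edges. *)
Lemma G2_not_almost_star x y z : 6 <= #|V| -> uniq [:: x; y; z] ->
  ~ almost_star_like (G2_edges x y z).
Proof.
move=> V6 us [u Hu]; have [p [q [pq pT qT pu qu]]] := pair_avoiding u us.
have T3 : #|[set x; y; z]| = 3.
  by move: us; rewrite /= !inE negb_or => /and3P[/andP[xy xz] yz _]; exact: card_set3.
have C3 := @outside _ 3 V6 T3.
have C2 : 2 <= #|(~: [set x; y; z]) :\ u|.
  by have := cardsD1 u (~: [set x; y; z]); case: (u \in _); nlia.
have /card_gt1P[w1 [w2 [w1C w2C w12]]] := C2.
have [w1u w1T] := setD1P w1C; have [w2u w2T] := setD1P w2C.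
rewrite inE in w1T; rewrite inE in w2T.
have := Hu [set p; q; w1] [set p; q; w2] (G2_edge us pq pT qT w1T) (G2_edge us pq pT qT w2T).
rewrite !inE !negb_or !(eq_sym u) pu qu w1u w2u => /(_ isT isT) E.
have : w1 \in [set p; q; w2] by rewrite -E !inE eqxx orbT.
rewrite !inE (negbTE w12) orbF => /orP[]/eqP w1E; by rewrite w1E ?pT ?qT in w1T.
Qed.

Lemma G2_not_star_like x y z : 6 <= #|V| -> uniq [:: x; y; z] -> ~ star_like (G2_edges x y z).
Proof.
move=> V6 us [v Hv]; apply: (G2_not_almost_star V6 us); exists v => e f eG _.
by rewrite Hv.
Qed.

Lemma almost_star_like_G1 x y z v : almost_star_like (G1_edges x y z v).
Proof.
exists v => e f; rewrite !in_setU1 !in_set.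
move=> /orP[/eqP->|/and3P[_ -> _]//] /orP[/eqP->//|/and3P[_ -> _]//].
Qed.

Lemma G1_not_star_like x y z v : uniq [:: x; y; z; v] -> ~ star_like (G1_edges x y z v).
Proof.
move=> us [u Hu]; have us3 : uniq [:: x; y; z].
  by apply: subseq_uniq us; rewrite (prefix_subseq [:: x; y; z] [:: v]).
have [p [q [pq pT qT pu qu]]] := pair_avoiding u us3.
have T3 : [set x; y; z] \in G1_edges x y z v by rewrite setU11.
have vT : v \notin [set x; y; z].
  move: us; rewrite /= !inE !negb_or !(eq_sym v) => /and4P[/and3P[_ _ ->] /andP[_ ->] -> _] //.
have [uv|uv] := eqVneq u v; first by have := Hu _ T3; rewrite uv (negbTE vT).
have [pv qv] : p != v /\ q != v by split; apply: contraNneq vT => <-.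
have : [set p; q; v] \in G1_edges x y z v.
  rewrite in_setU1 in_set card_set3 // !inE !eqxx !orbT /=; apply/orP; right.
  by apply/set0Pn; exists p; rewrite !inE eqxx; move: pT; rewrite !inE.
by move/Hu; rewrite !inE !(eq_sym u) (negbTE pu) (negbTE qu) eq_sym (negbTE uv).
Qed.

Lemma comet_not_intersecting K c : #|K| = 4 -> 2 <= #|~: K| -> c \in K ->
  ~ intersecting (comet K c).
Proof.
move=> K4 C2 cK int.
have Kc : K :\ c \in comet K c.
  by rewrite !inE subsetDl andbT; have := cardsD1 c K; rewrite cK K4 add1n => -[<-].
have cC : c \in c |: ~: K := setU11 _ _.
have [|e [e3 eS ce _]] := edge_through cC cC; first by rewrite cardsU1 inE cK add1n ltnS.
have : e \in comet K c by rewrite !inE e3 eS ce orbT.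
move=> eC; have := int _ _ Kc eC; apply/negP; rewrite -leqNgt leqn0 cards_eq0.
apply/eqP/setP=> y; rewrite !inE; apply/negP=> /andP[/andP[yc yK] /(subsetP eS)].
by rewrite !inE (negbTE yc) yK.
Qed.

Section CliqueStar.
Variables (K : {set V}) (c : V).
Hypotheses (K4 : 4 <= #|K|) (C7 : 7 <= #|~: K|) (cK : c \notin K).

Let cC : c \in ~: K. Proof. by rewrite inE. Qed.

Let C3 : 3 <= #|~: K|. Proof. by nlia. Qed.

(** Edges avoiding the centre [v] lie in the K_4 of the comet. If [v] is in [K], they cover the
    complement of [K]; otherwise they cover [K], and [v] is a fifth vertex. *)
Lemma clique_star_not_comet_like : ~ comet_like setT (clique_star K c).
Proof.
move=> [K' [v [_ K'4 vK' HK']]].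
have avoid e : e \in clique_star K c -> v \notin e -> e \subset K'.
  move=> /HK'[//|s]; have /setIP[-> //] : v \in e :&: K' by rewrite s set11.
have [vK|vK] := boolP (v \in K).
  have sub : ~: K \subset K'.
    apply/subsetP=> y yC; have [e [e3 eS ce ye]] := edge_through cC yC C3.
    apply: (subsetP (avoid e _ _) _ ye); first by rewrite !inE e3 eS ce orbT.
    by apply/negP=> /(subsetP eS); rewrite inE vK.
  by have := subset_leq_card sub; rewrite K'4; nlia.
have sub : v |: K \subset K'.
  rewrite subUset sub1set vK'; apply/subsetP=> y yK.
  have [|e [e3 eS ye _]] := edge_through yK yK; first by nlia.
  apply: (subsetP (avoid e _ _) _ ye); first by rewrite !inE e3 eS.
  by apply: contra vK => /(subsetP eS).
by have := subset_leq_card sub; rewrite K'4 cardsU1 vK; nlia.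
Qed.

(** Every vertex outside [K] shares an edge with [c], so one of the two sets would contain the seven
    or more vertices of the star. *)
Lemma clique_star_not_two_parts : ~ two_parts_like (clique_star K c).
Proof.
have main (M L : {set V}) : [disjoint M & L] -> #|M| <= 6 -> c \in M ->
    (forall e, e \in clique_star K c -> e \subset M \/ e \subset L) -> False.
  move=> d M6 cM HM; have : ~: K \subset M.
    apply/subsetP=> y yC; have [e [e3 eS ce ye]] := edge_through cC yC C3.
    have [|eM|eL] := HM e; [by rewrite !inE e3 eS ce orbT| exact: (subsetP eM)|].
    by have := disjointFr d cM; rewrite (subsetP eL).
  by move/subset_leq_card; nlia.
move=> [M [L [d M6 L6 HM]]].
have [e [e3 eS ce _]] := edge_through cC cC C3.
have [|eM|eL] := HM e; first by rewrite !inE e3 eS ce orbT.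
  by apply: (main M L) => //; apply: (subsetP eM).
apply: (main L M) => //; [by rewrite disjoint_sym | exact: (subsetP eL)|].
by move=> f /HM[]; auto.
Qed.
End CliqueStar.
End Bases.

Lemma card_ord_lt n a : a <= n -> #|[set i : 'I_n | i < a]| = a.
Proof.
move=> an; have -> : [set i : 'I_n | i < a] = [set widen_ord an i | i in [set: 'I_a]].
  apply/setP=> i; rewrite inE; apply/idP/imsetP => [ia|[j _ ->]]; last exact: (ltn_ord j).
  by exists (Ordinal ia); rewrite ?inE //; apply: val_inj.
rewrite card_imset; first by rewrite cardsT card_ord.
by move=> i j /(congr1 val) ij; apply: val_inj.
Qed.

(** * The standard 3-graphs on numbered vertices *)

Section Standard.
Variable k : nat.
Notation n := k.+1.
Hypothesis n7 : 7 <= n.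
Notation V := 'I_n.
Notation graph := {set {set V}}.
Implicit Types (E H : graph) (Ys : seq graph).

Let u (i : nat) : V := inord i.
Definition initial a : {set V} := [set i : V | i < a].

Definition std_star : graph := star_on ord0 setT.
Definition std_comet : graph := comet (initial 4) ord0.
Definition std_cliques : graph := cliques (initial 6) (~: initial 6).
Definition std_two_K6 : graph := cliques (initial 6) (initial 12 :\: initial 6).
Definition std_K6_star : graph := clique_star (initial 6) (u 6).
Definition std_K4_star : graph := clique_star (initial 4) (u 4).
Definition std_G1 : graph := G1_edges (u 0) (u 1) (u 2) (u 3).
Definition std_G2 : graph := G2_edges (u 0) (u 1) (u 2).

Let cT : #|[set: V]| = n.
Proof. by rewrite cardsT card_ord. Qed.

Let uniq_G : uniq [:: u 0; u 1; u 2; u 3].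
Proof.
have ne i j : i < 7 -> j < 7 -> i != j -> u i != u j.
  move=> i7 j7; apply: contraNneq => /(congr1 val).
  by rewrite /= !inordK ?(leq_trans _ n7) // => ->.
by rewrite /= !inE !negb_or !ne.
Qed.

Let uniq_G2 : uniq [:: u 0; u 1; u 2].
Proof. by apply: subseq_uniq uniq_G; rewrite (prefix_subseq [:: u 0; u 1; u 2] [:: u 3]). Qed.

Let cI a : a <= n -> #|initial a| = a.
Proof. exact: card_ord_lt. Qed.

Let cI4 : #|initial 4| = 4. Proof. by apply: cI; nlia. Qed.
Let cI6 : #|initial 6| = 6. Proof. by apply: cI; nlia. Qed.

Let cI6C : #|~: initial 6| = n - 6.
Proof. by have := cardsC (initial 6); rewrite cI6 card_ord; nlia. Qed.

Let cI4C : #|~: initial 4| = n - 4.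
Proof. by have := cardsC (initial 4); rewrite cI4 card_ord; nlia. Qed.

Let ord0_in : ord0 \in initial 4. Proof. by rewrite inE. Qed.
Let u6_out : u 6 \notin initial 6. Proof. by rewrite inE /= inordK. Qed.
Let u4_out : u 4 \notin initial 4. Proof. by rewrite inE /= inordK //; nlia. Qed.

Let disj6 : [disjoint initial 6 & ~: initial 6].
Proof. by rewrite disjoints_subset setCK. Qed.

Let disj12 : [disjoint initial 6 & initial 12 :\: initial 6].
Proof. by rewrite disjoint_sym disjoints_subset; apply/subsetP=> i; rewrite !inE => /andP[]. Qed.

Let cI12 : 12 <= n -> #|initial 12 :\: initial 6| = 6.
Proof.
move=> n12; rewrite cardsD (setIidPr _) ?cI6 ?cI //; apply/subsetP=> i; rewrite !inE.
by move=> i6; apply: ltn_trans i6 _.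
Qed.

Lemma good_star : good std_star.
Proof.
by split; [exact: three_graph_star | apply: star_like_path_free; exact: star_like_star].
Qed.

Lemma good_comet : good std_comet.
Proof. by split; [exact: three_graph_comet | exact: path_free_comet]. Qed.

Lemma good_cliques : n <= 12 -> good std_cliques.
Proof.
move=> n12; split; [exact: three_graph_cliques | apply: path_free_cliques => //].
  by rewrite cI6.
by rewrite cI6C; nlia.
Qed.

Lemma good_two_K6 : 12 <= n -> good std_two_K6.
Proof.
move=> n12; split; [exact: three_graph_cliques | apply: path_free_cliques => //].
  by rewrite cI6.
by rewrite cI12.
Qed.

Lemma good_K6_star : good std_K6_star.
Proof. by split; [exact: three_graph_clique_star | apply: path_free_clique_star; rewrite cI6]. Qed.

Lemma good_K4_star : good std_K4_star.
Proof. by split; [exact: three_graph_clique_star | apply: path_free_clique_star; rewrite cI4]. Qed.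

Lemma good_G1 : good std_G1.
Proof.
split; first exact: three_graph_G1.
by apply: intersecting_path_free; exact: intersecting_G1.
Qed.

Lemma good_G2 : good std_G2.
Proof.
split; first exact: three_graph_G2.
by apply: intersecting_path_free; exact: intersecting_G2.
Qed.

Lemma card_std_star : #|std_star| = 'C(n - 1, 2).
Proof. by rewrite card_star_on ?inE // cT. Qed.

Lemma card_std_comet : #|std_comet| = 4 + 'C(n - 4, 2).
Proof. by rewrite card_comet // cI4 card_ord. Qed.

Lemma card_std_cliques : #|std_cliques| = 20 + 'C(n - 6, 3).
Proof. by rewrite card_cliques // cI6 cI6C. Qed.

Lemma card_std_two_K6 : 12 <= n -> #|std_two_K6| = 40.
Proof. by move=> n12; rewrite card_cliques // cI6 cI12. Qed.

Lemma card_std_K6_star : #|std_K6_star| = 20 + 'C(n - 7, 2).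
Proof. by rewrite card_clique_star // cI6 card_ord -subnDA. Qed.

Lemma card_std_K4_star : #|std_K4_star| = 4 + 'C(n - 5, 2).
Proof. by rewrite card_clique_star // cI4 card_ord -subnDA. Qed.

Lemma card_std_G1 : #|std_G1| = 3 * n - 8.
Proof. by rewrite card_G1_edges // card_ord. Qed.

Lemma card_std_G2 : #|std_G2| = 3 * n - 8.
Proof. by rewrite card_G2_edges // card_ord. Qed.

(** The assumption on [m] removes [ClassSmall]. The bound for G_1 and G_2 is kept, since it discards
    them where [m] exceeds 3 n - 8. *)
Lemma cover E m : good E -> third_bound n <= m -> m <= #|E| ->
  [\/ embeds E std_star, embeds E std_comet, K6_like setT E
    | embeds E std_K4_star \/ #|E| <= 3 * n - 8 /\ (embeds E std_G1 \/ embeds E std_G2)].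
Proof.
move=> [tE PE] tm mE; have := classification (A := setT) _ tE PE; rewrite cT.
case=> // [s|s|s|[K [c [_ K4 cK HK]]]|s GG|s].
- by apply: Or41; exact: embeds_star.
- by apply: Or42; exact: embeds_comet.
- exact: Or43.
- by apply: Or44; left; apply: (embeds_clique_star _ tE (K := K) (v := c)); rewrite // cI4.
- apply: Or44; right; split; first by rewrite cT in s.
  by case: GG => g; [left; exact: embeds_G1 | right; exact: embeds_G2].
- by rewrite cT ltnNge (leq_trans tm mE) in s.
Qed.

Lemma K6_like_embeds_cliques E : good E -> K6_like setT E -> embeds E std_cliques.
Proof.
move=> [tE PE] [K [_ K6 HK]]; apply: (embeds_cliques _ tE (K := K) (L := ~: K)) => //.
- by rewrite disjoints_subset setCK.
- by rewrite K6 cI6.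
- by have := cardsC K; rewrite K6 card_ord cI6C; nlia.
move=> e eE; case: (HK _ eE) => s; [by left | right].
by rewrite -disjoints_subset -setI_eq0 -cards_eq0 s.
Qed.

(** From thirteen vertices on, the part beside the K_6 has at least seven and is classified in turn.
    A star there gives K_6 with a star, a second K_6 splits off, and the other classes yield the
    maximum. *)
Lemma K6_like_refined E : 13 <= n -> good E -> K6_like setT E ->
  [\/ embeds E std_K6_star,
      exists2 K : {set V}, #|K| = 6 & exists2 K' : {set V}, K' \subset ~: K /\ #|K'| = 6 &
        forall e, e \in E -> [\/ e \subset K, e \subset K' | e \subset ~: (K :|: K')]
    | #|E| <= 20 + maxn (4 + 'C(n - 10, 2)) (maxn (4 + 'C(n - 11, 2))
              (maxn (3 * (n - 6) - 8) (third_bound (n - 6) - 1)))].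
Proof.
move=> n13 [tE PE] [K [KT K6 HK]].
have cC : #|~: K| = n - 6 by have := cardsC K; rewrite K6 card_ord; nlia.
have CT : [set: V] :\: K = ~: K by rewrite setTD.
have split_E := K6_split tE KT HK; rewrite CT in split_E.
have le20 : #|inside E K| <= 20 by have := card_inside K tE; rewrite K6.
have tR := three_graph_inside (B := ~: K) tE.
have PR := P_freeS (inside_sub E (~: K)) PE.
have inR e : e \in E -> meet e K = 0 -> e \in inside E (~: K).
  by move=> eE m0; rewrite inE eE -disjoints_subset -setI_eq0 -cards_eq0 m0.
case: (classification _ tR PR) => [|s|s|[K' [K'C K'6 HK']]|s|s _|s]; first by nlia.
- apply: Or31.
  have [c cK Hc] : exists2 c, c \notin K & forall e, e \in inside E (~: K) -> c \in e.
    case: s => c Hc; have [R0|/set0Pn[e eR]] := eqVneq (inside E (~: K)) set0.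
      have /card_gt0P[y yC] : 0 < #|~: K| by rewrite cC; nlia.
      by exists y => [|e]; [rewrite inE in yC | rewrite R0 inE].
    by exists c => //; have := subsetP (tR _ eR).2 _ (Hc _ eR); rewrite inE.
  apply: (embeds_clique_star _ tE (K := K) (v := c)) => //; first by rewrite K6 cI6.
  move=> e eE; case: (HK _ eE) => s'; [by left | right; split=> //].
  by apply: Hc; apply: inR.
- apply: Or33; rewrite split_E; apply: leq_add => //.
  by have := comet_bound tR s; rewrite cC -subnDA leq_max => ->.
- apply: Or32; exists K => //; exists K' => // e eE.
  case: (HK _ eE) => s; first by apply: Or31.
  case: (HK' _ (inR _ eE s)) => s'; first by apply: Or32.
  apply: Or33; rewrite -disjoints_subset -setI_eq0 setIUr -cards_eq0.
  by move/eqP: s; move/eqP: s'; rewrite !cards_eq0 => /eqP-> /eqP->; rewrite setU0 eqxx.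
- apply: Or33; rewrite split_E; apply: leq_add => //.
  by have := K4_star_bound tR s; rewrite cC -subnDA !leq_max => ->; rewrite orbT.
- by apply: Or33; rewrite split_E; apply: leq_add => //; rewrite cC in s; rewrite !leq_max s !orbT.
- apply: Or33; rewrite split_E; apply: leq_add => //; rewrite cC in s; rewrite !leq_max.
  by apply/orP; right; apply/orP; right; apply/orP; right; nlia.
Qed.

Lemma K6_like_13 E : n = 13 -> good E -> K6_like setT E -> 35 <= #|E| ->
  embeds E std_K6_star \/ embeds E std_two_K6.
Proof.
move=> n13 gE s E35; have n13' : 13 <= n by rewrite n13.
have [e|[K K6 [K' [K'C K'6] HE]]|e] := K6_like_refined n13' gE s; first by left.
  have cU : #|~: (K :|: K')| <= 1.
    have d : [disjoint K & K'] by rewrite disjoint_sym disjoints_subset.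
    have := cardsC (K :|: K'); have := leq_card_setU K K'; rewrite d => -[_ /eqP->].
    by rewrite K6 K'6 card_ord; nlia.
  right; apply: (embeds_cliques _ gE.1 (K := K) (L := K')) => //.
  - by rewrite disjoint_sym disjoints_subset.
  - by rewrite K6 cI6.
  - by rewrite K'6 cI12 // n13.
  move=> e eE; case: (HE _ eE) => s'; [by left|by right|].
  by have := leq_trans (subset_leq_card s') cU; rewrite (gE.1 _ eE).1.
(* The maximum is 13 here, and 20 + 13 < 35. *)
by exfalso; have := leq_trans E35 e; rewrite n13.
Qed.

(** Two copies of K_6 have 40 edges, one too few, and the maximum in [K6_like_refined] is 16. *)
Lemma K6_like_14 E : n = 14 -> good E -> K6_like setT E -> 41 <= #|E| ->
  embeds E std_K6_star.
Proof.
move=> n14 gE s E41; have n13' : 13 <= n by rewrite n14.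
have [//|[K K6 [K' [K'C K'6] HE]]|e] := K6_like_refined n13' gE s; last first.
  by exfalso; have := leq_trans E41 e; rewrite n14.
have cU : #|~: (K :|: K')| <= 2.
  have d : [disjoint K & K'] by rewrite disjoint_sym disjoints_subset.
  have := cardsC (K :|: K'); have := leq_card_setU K K'; rewrite d => -[_ /eqP->].
  by rewrite K6 K'6 card_ord; nlia.
have sub : E \subset cliques K K'.
  apply/subsetP=> e eE; rewrite !inE (gE.1 _ eE).1 /=; case: (HE _ eE) => s'; rewrite ?s' ?orbT //.
  by have := leq_trans (subset_leq_card s') cU; rewrite (gE.1 _ eE).1.
have := leq_trans E41 (subset_leq_card sub); rewrite card_cliques ?K6 ?K'6 //.
by rewrite disjoint_sym disjoints_subset.
Qed.

(** From here on K_6 with a star loses to K_4 with a star, at first by 48 to 49. *)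
Lemma K6_like_bound E : 15 <= n -> good E -> K6_like setT E -> #|E| < third_bound n.
Proof.
move=> n15 [tE PE] [K [KT K6 HK]]; rewrite (K6_split tE KT HK).
have le20 : #|inside E K| <= 20 by have := card_inside K tE; rewrite K6.
have cC : #|setT :\: K| = n - 6 by rewrite cardsD (setIidPr KT) cT K6.
have le : #|inside E (setT :\: K)| <= first_bound (n - 6).
  rewrite -cC; apply: (@first_bound_of _ n) (three_graph_inside tE) (P_freeS (inside_sub _ _) PE).
    by move=> A H /andP[A7 _]; exact: classification.
  by rewrite cC; nlia.
apply: leq_ltn_trans (leq_add le20 le) _.
rewrite first_boundE ?third_boundE //; last nlia.
rewrite (_ : n - 6 - 1 = n - 15 + 8); last nlia.
rewrite (_ : n - 5 = n - 15 + 10); last nlia.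
by rewrite (@bin2_shift 8 28) // (@bin2_shift 10 45) //; nlia.
Qed.

Let V7 : 7 <= #|V|. Proof. by rewrite card_ord. Qed.

Lemma cliques_not_star : ~ embeds std_cliques std_star.
Proof.
move=> /star_like_embeds/(_ (star_like_star _ _)).
by apply: (@clique_not_star_like _ _ (initial 6)); rewrite ?subsetUl // cI6.
Qed.

Lemma two_K6_not_star : ~ embeds std_two_K6 std_star.
Proof.
move=> /star_like_embeds/(_ (star_like_star _ _)).
by apply: (@clique_not_star_like _ _ (initial 6)); rewrite ?subsetUl // cI6.
Qed.

Lemma comet_not_star : ~ embeds std_comet std_star.
Proof.
move=> /star_like_embeds/(_ (star_like_star _ _)).
by apply: (@clique_not_star_like _ _ (initial 4)); rewrite ?subsetUl // cI4.
Qed.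

Lemma K6_star_not_star : ~ embeds std_K6_star std_star.
Proof.
move=> /star_like_embeds/(_ (star_like_star _ _)).
by apply: (@clique_not_star_like _ _ (initial 6)); rewrite ?subsetUl // cI6.
Qed.

Lemma K4_star_not_star : ~ embeds std_K4_star std_star.
Proof.
move=> /star_like_embeds/(_ (star_like_star _ _)).
by apply: (@clique_not_star_like _ _ (initial 4)); rewrite ?subsetUl // cI4.
Qed.

Lemma G1_not_star : ~ embeds std_G1 std_star.
Proof. move=> /star_like_embeds/(_ (star_like_star _ _)); exact: G1_not_star_like. Qed.

Lemma G2_not_star : ~ embeds std_G2 std_star.
Proof.
move=> /star_like_embeds/(_ (star_like_star _ _)); by apply: G2_not_star_like => //; rewrite card_ord; nlia.
Qed.

Let cliques_K6 : K6_like setT std_cliques.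
Proof. exact: K6_like_cliques. Qed.

Lemma star_not_cliques : ~ embeds std_star std_cliques.
Proof.
move=> /K6_like_embeds/(_ cliques_K6); apply: (@hub_not_K6_like _ _ ord0) => //.
by apply: star_hub; rewrite card_ord; nlia.
Qed.

Lemma comet_not_cliques : ~ embeds std_comet std_cliques.
Proof.
move=> /K6_like_embeds/(_ cliques_K6); apply: (@hub_not_K6_like _ _ ord0) => //.
by apply: comet_hub => //; rewrite ?cI4 ?cI4C //; nlia.
Qed.

Lemma G1_not_cliques : ~ embeds std_G1 std_cliques.
Proof.
move=> /K6_like_embeds/(_ cliques_K6); apply: (@hub_not_K6_like _ _ (u 3)) => //.
by apply: G1_hub => //; rewrite card_ord; nlia.
Qed.

Lemma G2_not_cliques : ~ embeds std_G2 std_cliques.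
Proof.
move=> /K6_like_embeds/(_ cliques_K6); apply: (@hub_not_K6_like _ _ (u 0)) => //.
by apply: G2_hub => //; rewrite card_ord; nlia.
Qed.

Let comet_comet : comet_like setT std_comet.
Proof. exact: comet_like_comet. Qed.

Lemma K6_star_not_comet : 13 <= n -> ~ embeds std_K6_star std_comet.
Proof.
move=> n13 /comet_like_embeds/(_ comet_comet).
by apply: clique_star_not_comet_like; rewrite ?cI6 ?cI6C //; nlia.
Qed.

Lemma K4_star_not_comet : 13 <= n -> ~ embeds std_K4_star std_comet.
Proof.
move=> n13 /comet_like_embeds/(_ comet_comet).
by apply: clique_star_not_comet_like; rewrite ?cI4 ?cI4C //; nlia.
Qed.

Lemma K6_star_not_two_K6 : 13 <= n -> ~ embeds std_K6_star std_two_K6.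
Proof.
move=> n13 /two_parts_like_embeds H; have n12 : 12 <= n by nlia.
have := H (two_parts_like_cliques disj12 cI6 (cI12 n12)).
by apply: clique_star_not_two_parts; rewrite ?cI6 ?cI6C //; nlia.
Qed.

Lemma G1_G2_not_iso : ~ isomorphic (Hypergraph std_G1) (Hypergraph std_G2).
Proof.
move=> /iso_sym /iso_embeds /almost_star_like_embeds/(_ (almost_star_like_G1 _ _ _ _)).
by apply: G2_not_almost_star => //; rewrite card_ord; nlia.
Qed.

Let comet_meets : ~ intersecting std_comet.
Proof. by apply: comet_not_intersecting; rewrite ?cI4C //; nlia. Qed.

Lemma G1_comet_not_iso : ~ isomorphic (Hypergraph std_G1) (Hypergraph std_comet).
Proof.
move=> /iso_sym /iso_embeds /intersecting_embeds; move/(_ (intersecting_G1 uniq_G2)).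
exact: comet_meets.
Qed.

Lemma G2_comet_not_iso : ~ isomorphic (Hypergraph std_G2) (Hypergraph std_comet).
Proof.
move=> /iso_sym /iso_embeds /intersecting_embeds; move/(_ (intersecting_G2 uniq_G2)).
exact: comet_meets.
Qed.
End Standard.

Lemma iso_refl (F : hypergraph) : isomorphic F F.
Proof. by exists id; [exists id | move=> e; rewrite imset_id]. Qed.

(** * The third order for each range of n *)

Section Final.
Variable k : nat.
Notation n := k.+1.
Hypothesis n7 : 7 <= n.
Notation graph := {set {set 'I_n}}.
Implicit Types (E H : graph) (Ys : seq graph).

Let cE := (card_std_star k, card_std_comet n7, card_std_cliques n7, card_std_K6_star n7,
  card_std_K4_star n7, card_std_G1 n7, card_std_G2 n7).

Lemma level_list1 (Y : graph) m : good Y -> #|Y| = m -> level_list [:: Y] m.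
Proof. by move=> gY cY; split=> // Z; rewrite inE => /eqP->. Qed.

Lemma level_list2 (Y Z : graph) m : good Y -> good Z -> #|Y| = m -> #|Z| = m ->
  level_list [:: Y; Z] m.
Proof. by move=> gY gZ cY cZ; split=> // X; rewrite !inE => /orP[]/eqP->. Qed.

Lemma level_list3 (X Y Z : graph) m : good X -> good Y -> good Z ->
  #|X| = m -> #|Y| = m -> #|Z| = m -> level_list [:: X; Y; Z] m.
Proof. by move=> gX gY gZ cX cY cZ; split=> // U; rewrite !inE => /or3P[]/eqP->. Qed.

Lemma family_isI (A : {set graph}) (Ys : seq graph) (L : seq hypergraph) :
  (forall E, E \in A <-> exists2 Z, Z \in Ys & isomorphic (Hypergraph E) (Hypergraph Z)) ->
  (forall F, List.In F L -> exists2 Z, Z \in Ys & isomorphic (Hypergraph Z) F) ->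
  (forall Z, Z \in Ys -> exists2 F, List.In F L & isomorphic (Hypergraph Z) F) ->
  List.ForallOrdPairs (fun F G => ~ isomorphic F G) L -> family_is A L.
Proof.
move=> AY LY YL pairs; split=> //.
  move=> E; rewrite AY; split=> [[Z /YL[F FL ZF] EZ]|[F /LY[Z ZY ZF] EF]].
    by exists F => //; apply: iso_trans ZF.
  by exists Z => //; apply: iso_trans EF (iso_sym ZF).
move=> F /LY[Z ZY ZF]; exists Z => //; apply/AY; exists Z => //; exact: iso_refl.
Qed.

Let mem1 (Y : graph) (Z : graph) : Z \in [:: Y] -> Z = Y.
Proof. by rewrite inE => /eqP. Qed.

(** Only here K_6 with an isolated vertex comes first, with 20 edges, and the star second, with
    15. *)
Lemma third_7 : n = 7 -> ex loose_path n 3 = 3 * n - 8 /\ forall E, E \in Ex loose_path n 3 <->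
    exists2 Z, Z \in [:: std_G1 k; std_G2 k] & isomorphic (Hypergraph E) (Hypergraph Z).
Proof.
move=> e7; have E13 : 3 * n - 8 = 13 by rewrite e7.
apply: (@third_level _ [:: std_cliques k] [:: std_star k] _ 20 15); rewrite ?E13 //.
- by apply: level_list1; [apply: good_cliques; nlia | rewrite cE e7].
- by apply: level_list1; [exact: good_star | rewrite cE e7].
- by apply: level_list2; rewrite ?cE //; [exact: good_G1 | exact: good_G2].
- by move=> Z Y /mem1-> /mem1->; apply: star_not_cliques.
- move=> Z Y; rewrite !inE => /orP[]/eqP-> /orP[]/eqP->.
  + exact: G1_not_cliques.
  + exact: G1_not_star.
  + exact: G2_not_cliques.
  + exact: G2_not_star.
move=> E gE le; have [|s|s|s|[s|[_ [s|s]]]] := cover n7 gE _ le; first by rewrite e7.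
- by exists (std_star k); rewrite // !inE eqxx ?orbT.
- by exfalso; have := leq_trans le (embeds_card s); rewrite cE e7.
- by exists (std_cliques k); rewrite ?inE ?eqxx //; apply: K6_like_embeds_cliques.
- by exfalso; have := leq_trans le (embeds_card s); rewrite cE e7.
- by exists (std_G1 k); rewrite // !inE eqxx ?orbT.
- by exists (std_G2 k); rewrite // !inE eqxx ?orbT.
Qed.

Lemma numbers_8_10 m : 8 <= m <= 10 ->
  [&& 3 * m - 8 < 20 + 'C(m - 6, 3), 20 + 'C(m - 6, 3) < 'C(m - 1, 2),
    third_bound m <= 3 * m - 8, 4 + 'C(m - 4, 2) < 3 * m - 8 & 4 + 'C(m - 5, 2) < 3 * m - 8].
Proof.
move=> m810; apply: (allP (_ : all (fun m => [&& 3 * m - 8 < 20 + 'C(m - 6, 3),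
  20 + 'C(m - 6, 3) < 'C(m - 1, 2), third_bound m <= 3 * m - 8,
  4 + 'C(m - 4, 2) < 3 * m - 8 & 4 + 'C(m - 5, 2) < 3 * m - 8]) (iota 8 3))).
  by vm_compute.
by rewrite mem_iota; nlia.
Qed.

Lemma third_8_10 : 8 <= n <= 10 ->
  ex loose_path n 3 = 3 * n - 8 /\ forall E, E \in Ex loose_path n 3 <->
    exists2 Z, Z \in [:: std_G1 k; std_G2 k] & isomorphic (Hypergraph E) (Hypergraph Z).
Proof.
move=> h; have /and5P[lt32 lt21 tb nco nk4] := numbers_8_10 h.
apply: (third_level (Y1 := [:: std_star k]) (Y2 := [:: std_cliques k]) lt32 lt21).
- by apply: level_list1; [exact: good_star | rewrite cE].
- by apply: level_list1; [apply: good_cliques; nlia | rewrite cE].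
- by apply: level_list2; rewrite ?cE //; [exact: good_G1 | exact: good_G2].
- by move=> Z Y /mem1-> /mem1->; apply: cliques_not_star.
- move=> Z Y; rewrite !inE => /orP[]/eqP-> /orP[]/eqP->.
  + exact: G1_not_star.
  + exact: G1_not_cliques.
  + exact: G2_not_star.
  + exact: G2_not_cliques.
move=> E gE le; have [s|s|s|[s|[_ [s|s]]]] := cover n7 gE tb le.
- by exists (std_star k); rewrite // !inE eqxx ?orbT.
- by exfalso; have := leq_trans le (embeds_card s); rewrite cE leqNgt nco.
- by exists (std_cliques k); rewrite ?inE ?eqxx ?orbT //; apply: K6_like_embeds_cliques.
- by exfalso; have := leq_trans le (embeds_card s); rewrite cE leqNgt nk4.
- by exists (std_G1 k); rewrite // !inE eqxx ?orbT.
- by exists (std_G2 k); rewrite // !inE eqxx ?orbT.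
Qed.

(** The comet draws level: 4 + 21 = 3 * 11 - 8. *)
Lemma third_11 : n = 11 -> ex loose_path n 3 = 25 /\ forall E, E \in Ex loose_path n 3 <->
    exists2 Z, Z \in [:: std_G1 k; std_G2 k; std_comet k] & isomorphic (Hypergraph E) (Hypergraph Z).
Proof.
move=> e11; have tb : third_bound n <= 25 by rewrite e11.
apply: (@third_level _ [:: std_star k] [:: std_cliques k] _ 45 30) => //.
- by apply: level_list1; [exact: good_star | rewrite cE e11].
- by apply: level_list1; [apply: good_cliques; nlia | rewrite cE e11].
- by apply: level_list3; rewrite ?cE ?e11 //; [exact: good_G1 | exact: good_G2 | exact: good_comet].
- by move=> Z Y /mem1-> /mem1->; apply: cliques_not_star.
- move=> Z Y; rewrite !inE => /or3P[]/eqP-> /orP[]/eqP->.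
  + exact: G1_not_star.
  + exact: G1_not_cliques.
  + exact: G2_not_star.
  + exact: G2_not_cliques.
  + exact: comet_not_star.
  + exact: comet_not_cliques.
move=> E gE le; have [s|s|s|[s|[_ [s|s]]]] := cover n7 gE tb le.
- by exists (std_star k); rewrite // !inE eqxx ?orbT.
- by exists (std_comet k); rewrite // !inE eqxx ?orbT.
- by exists (std_cliques k); rewrite ?inE ?eqxx ?orbT //; apply: K6_like_embeds_cliques.
- by exfalso; have := leq_trans le (embeds_card s); rewrite cE e11.
- by exists (std_G1 k); rewrite // !inE eqxx ?orbT.
- by exists (std_G2 k); rewrite // !inE eqxx ?orbT.
Qed.

Lemma third_12 : n = 12 -> ex loose_path n 3 = 32 /\ forall E, E \in Ex loose_path n 3 <->
    exists2 Z, Z \in [:: std_comet k] & isomorphic (Hypergraph E) (Hypergraph Z).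
Proof.
move=> e12; have tb : third_bound n <= 32 by rewrite e12.
apply: (@third_level _ [:: std_star k] [:: std_cliques k] _ 55 40) => //.
- by apply: level_list1; [exact: good_star | rewrite cE e12].
- by apply: level_list1; [apply: good_cliques; nlia | rewrite cE e12].
- by apply: level_list1; [exact: good_comet | rewrite cE e12].
- by move=> Z Y /mem1-> /mem1->; apply: cliques_not_star.
- move=> Z Y /mem1->; rewrite !inE => /orP[]/eqP->; [exact: comet_not_star | exact: comet_not_cliques].
move=> E gE le; have [s|s|s|[s|[s _]]] := cover n7 gE tb le.
- by exists (std_star k); rewrite // !inE eqxx ?orbT.
- by exists (std_comet k); rewrite // !inE eqxx ?orbT.
- by exists (std_cliques k); rewrite ?inE ?eqxx ?orbT //; apply: K6_like_embeds_cliques.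
- by exfalso; have := leq_trans le (embeds_card s); rewrite cE e12.
- by exfalso; have := leq_trans le s; rewrite e12.
Qed.

(** Two members share the second order, with 40 edges each: the comet, and two copies of K_6 with a
    vertex left over. *)
Lemma third_13 : n = 13 -> ex loose_path n 3 = 35 /\ forall E, E \in Ex loose_path n 3 <->
    exists2 Z, Z \in [:: std_K6_star k] & isomorphic (Hypergraph E) (Hypergraph Z).
Proof.
move=> e13; have tb : third_bound n <= 35 by rewrite e13.
apply: (@third_level _ [:: std_star k] [:: std_two_K6 k; std_comet k] _ 66 40) => //.
- by apply: level_list1; [exact: good_star | rewrite cE e13].
- apply: level_list2; [by apply: good_two_K6; nlia | exact: good_comet | |by rewrite cE e13].
  by apply: card_std_two_K6; nlia.
- by apply: level_list1; [exact: good_K6_star | rewrite cE e13].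
- move=> Z Y; rewrite !inE => /orP[]/eqP-> /eqP->; [exact: two_K6_not_star | exact: comet_not_star].
- move=> Z Y /mem1->; rewrite !inE => /or3P[]/eqP->.
  + exact: K6_star_not_star.
  + by apply: K6_star_not_two_K6; nlia.
  + by apply: K6_star_not_comet; nlia.
move=> E gE le; have [s|s|s|[s|[s _]]] := cover n7 gE tb le.
- by exists (std_star k); rewrite // !inE eqxx ?orbT.
- by exists (std_comet k); rewrite // !inE eqxx ?orbT.
- have [e|e] := K6_like_13 n7 e13 gE s le.
    by exists (std_K6_star k); rewrite // !inE eqxx ?orbT.
  by exists (std_two_K6 k); rewrite // !inE eqxx ?orbT.
- by exfalso; have := leq_trans le (embeds_card s); rewrite cE e13.
- by exfalso; have := leq_trans le s; rewrite e13.
Qed.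

Lemma third_14 : n = 14 -> ex loose_path n 3 = 41 /\ forall E, E \in Ex loose_path n 3 <->
    exists2 Z, Z \in [:: std_K6_star k] & isomorphic (Hypergraph E) (Hypergraph Z).
Proof.
move=> e14; have tb : third_bound n <= 41 by rewrite e14.
apply: (@third_level _ [:: std_star k] [:: std_comet k] _ 78 49) => //.
- by apply: level_list1; [exact: good_star | rewrite cE e14].
- by apply: level_list1; [exact: good_comet | rewrite cE e14].
- by apply: level_list1; [exact: good_K6_star | rewrite cE e14].
- by move=> Z Y /mem1-> /mem1->; apply: comet_not_star.
- move=> Z Y /mem1->; rewrite !inE => /orP[]/eqP->; first exact: K6_star_not_star.
  by apply: K6_star_not_comet; nlia.
move=> E gE le; have [s|s|s|[s|[s _]]] := cover n7 gE tb le.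
- by exists (std_star k); rewrite // !inE eqxx ?orbT.
- by exists (std_comet k); rewrite // !inE eqxx ?orbT.
- by exists (std_K6_star k); [rewrite !inE eqxx ?orbT | apply: K6_like_14].
- by exfalso; have := leq_trans le (embeds_card s); rewrite cE e14.
- by exfalso; have := leq_trans le s; rewrite e14.
Qed.

Lemma third_15 : 15 <= n ->
  ex loose_path n 3 = 4 + 'C(n - 5, 2) /\ forall E, E \in Ex loose_path n 3 <->
    exists2 Z, Z \in [:: std_K4_star k] & isomorphic (Hypergraph E) (Hypergraph Z).
Proof.
move=> n15; have tb : third_bound n <= 4 + 'C(n - 5, 2) by rewrite third_boundE.
have bin_lt a b : 1 < b < a -> 'C(b, 2) < 'C(a, 2).
  case/andP=> b1 ba; rewrite -(subnKC ba) binD binS bin1.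
  by move: (_ * _) 'C(_ - _, 2) => x y; nlia.
apply: (@third_level _ [:: std_star k] [:: std_comet k] _ ('C(n - 1, 2)) (4 + 'C(n - 4, 2))).
- by rewrite ltn_add2l; apply: bin_lt; nlia.
- have -> : n - 1 = n - 4 + 3 by nlia.
  by rewrite binD; have -> : 'C(3, 2) = 3 by []; nlia.
- by apply: level_list1; [exact: good_star | rewrite cE].
- by apply: level_list1; [exact: good_comet | rewrite cE].
- by apply: level_list1; [exact: good_K4_star | rewrite cE].
- by move=> Z Y /mem1-> /mem1->; apply: comet_not_star.
- move=> Z Y /mem1->; rewrite !inE => /orP[]/eqP->; first exact: K4_star_not_star.
  by apply: K4_star_not_comet; nlia.
move=> E gE le; have [s|s|s|[s|[s _]]] := cover n7 gE tb le.
- by exists (std_star k); rewrite // !inE eqxx ?orbT.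
- by exists (std_comet k); rewrite // !inE eqxx ?orbT.
- by have := K6_like_bound n7 n15 gE s; rewrite third_boundE // ltnNge le.
- by exists (std_K4_star k); rewrite // !inE eqxx ?orbT.
- have n12 : 12 <= n by nlia.
  have /and4P[_ _ _ lt] := connected_numbers n12; rewrite third_boundE // in lt.
  by have := leq_ltn_trans (leq_trans le s) lt; rewrite ltnn.
Qed.
End Final.

(** The disjoint union embeds into the [clique_star], and the numbers of edges agree, so
    [embeds_iso] applies. *)
Lemma iso_disjoint_union (k a : nat) (K0 : {set 'I_k.+1}) (c : 'I_k.+1) :
  #|K0| = a -> c \notin K0 ->
  isomorphic (Hypergraph (clique_star K0 c)) (disjoint_union (K a) (Star (k.+1 - a))).
Proof.
move=> K0a cK0; have aK : a < k.+1.
  have : 0 < #|~: K0| by apply/card_gt0P; exists c; rewrite inE.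
  by have := cardsC K0; rewrite K0a card_ord; nlia.
apply: iso_sym; rewrite /disjoint_union; set D := _ :|: _; set W := (_ + _)%type in D *.
have WE : #|{: W}| = #|'I_k.+1| by rewrite card_sum !card_ord; nlia.
pose L : {set W} := [set inl x | x in [set: 'I_a]].
have inl_inj : injective (fun x : 'I_a => inl x : W) by move=> x y [].
have inr_inj : injective (fun x : 'I_(k.+1 - a).-1.+1 => inr x : W) by move=> x y [].
have tD : three_graph setT D.
  move=> e; rewrite subsetT in_setU => /orP[]/imsetP[e' + ->].
    by rewrite inE => /andP[/eqP e3 _]; rewrite card_imset.
  by rewrite !inE => /andP[/andP[/eqP e3 _] _]; rewrite card_imset.
apply: embeds_iso => //.
  apply: (embeds_clique_star WE tD (K := L) (v := inr ord0)) => //.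
  - by rewrite card_imset // cardsT card_ord K0a.
  - by apply/imsetP=> -[].
  move=> e; rewrite in_setU => /orP[]/imsetP[e' + ->] => [_|].
    by left; apply: imsetS; apply: subsetT.
  rewrite !inE => /andP[_ ce]; right; split; last by rewrite mem_imset.
  apply/eqP; rewrite cards_eq0; apply/eqP/setP=> y; rewrite in_setI in_set0.
  by apply/negP=> /andP[/imsetP[x _ ->] /imsetP[]].
rewrite card_clique_star // K0a card_ord cardsU (_ : _ :&: _ = set0); last first.
  apply/setP=> e; rewrite in_setI in_set0; apply/negP=> /andP[/imsetP[e' + ->]].
  rewrite inE => /andP[/eqP e3 _] /imsetP[e'' _ E].
  have /card_gt0P[x xe] : 0 < #|e'| by rewrite e3.
  have : inl x \in [set (inl y : W) | y in e'] by rewrite mem_imset.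
  by rewrite E => /imsetP[].
rewrite cards0 subn0 !card_imset; try exact: imset_inj.
rewrite card_complete_on card_star_on ?inE // !cardsT !card_ord.
by rewrite !subn1.
Qed.

Lemma std_cometE (k : nat) : isomorphic (Hypergraph (std_comet k)) (Co k.+1).
Proof.
rewrite /Co /std_comet /comet; set S := [set i | (i == ord0) || _].
suff -> : S = ord0 |: ~: initial k 4 by apply: iso_refl.
by apply/setP=> i; rewrite !inE -leqNgt.
Qed.

Lemma family_G (k : nat) (A : {set {set {set 'I_k.+1}}}) : 7 <= k.+1 ->
  (forall E, E \in A <-> exists2 Z, Z \in [:: std_G1 k; std_G2 k] &
     isomorphic (Hypergraph E) (Hypergraph Z)) -> family_is A [:: G1 k.+1; G2 k.+1].
Proof.
move=> n7 AE; apply: (family_isI AE) => [F [<-|[<-|//]]|Z|].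
- by exists (std_G1 k); [rewrite !inE eqxx | exact: iso_refl].
- by exists (std_G2 k); [rewrite !inE eqxx orbT | exact: iso_refl].
- rewrite !inE => /orP[]/eqP->.
    by exists (G1 k.+1); [left | exact: iso_refl].
  by exists (G2 k.+1); [right; left | exact: iso_refl].
by do !constructor; exact: G1_G2_not_iso.
Qed.

Lemma family_G_Co (k : nat) (A : {set {set {set 'I_k.+1}}}) : 7 <= k.+1 ->
  (forall E, E \in A <-> exists2 Z, Z \in [:: std_G1 k; std_G2 k; std_comet k] &
     isomorphic (Hypergraph E) (Hypergraph Z)) ->
  family_is A [:: G1 k.+1; G2 k.+1; Co k.+1].
Proof.
move=> n7 AE; apply: (family_isI AE) => [F [<-|[<-|[<-|//]]]|Z|].
- by exists (std_G1 k); [rewrite !inE eqxx | exact: iso_refl].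
- by exists (std_G2 k); [rewrite !inE eqxx orbT | exact: iso_refl].
- by exists (std_comet k); [rewrite !inE eqxx !orbT | exact: std_cometE].
- rewrite !inE => /or3P[]/eqP->.
  + by exists (G1 k.+1); [left | exact: iso_refl].
  + by exists (G2 k.+1); [right; left | exact: iso_refl].
  + by exists (Co k.+1); [right; right; left | exact: std_cometE].
have not_Co F : ~ isomorphic F (Hypergraph (std_comet k)) -> ~ isomorphic F (Co k.+1).
  by move=> nF iF; apply: nF; apply: iso_trans iF (iso_sym (std_cometE k)).
constructor; first constructor; last constructor.
- exact: G1_G2_not_iso.
- by constructor=> //; apply: not_Co; exact: G1_comet_not_iso.
- by constructor=> //; apply: not_Co; exact: G2_comet_not_iso.
- by do !constructor.
Qed.

Lemma family_single (k : nat) (A : {set {set {set 'I_k.+1}}}) (Z : {set {set 'I_k.+1}}) F :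
  (forall E, E \in A <-> exists2 Y, Y \in [:: Z] & isomorphic (Hypergraph E) (Hypergraph Y)) ->
  isomorphic (Hypergraph Z) F -> family_is A [:: F].
Proof.
move=> AE ZF; apply: (family_isI AE) => [G [<-|//]|Y|].
- by exists Z; rewrite ?inE.
- by rewrite inE => /eqP->; exists F => //; left.
by do !constructor.
Qed.

Theorem theorem9 (n : nat) (hn : 7 <= n) :
  [/\ n <= 10 ->
        ex loose_path n 3 = 3 * n - 8 /\
        family_is (Ex loose_path n 3) [:: G1 n; G2 n],
      n = 11 ->
        ex loose_path n 3 = 25 /\
        family_is (Ex loose_path n 3) [:: G1 n; G2 n; Co n],
      n = 12 ->
        ex loose_path n 3 = 32 /\
        family_is (Ex loose_path n 3) [:: Co n],
      13 <= n <= 14 ->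
        ex loose_path n 3 = 20 + 'C(n - 7, 2) /\
        family_is (Ex loose_path n 3) [:: disjoint_union (K 6) (Star (n - 6))]
    & 15 <= n ->
        ex loose_path n 3 = 4 + 'C(n - 5, 2) /\
        family_is (Ex loose_path n 3) [:: disjoint_union (K 4) (Star (n - 4))]].
Proof.
case: n hn => // k n7.
have K6S : isomorphic (Hypergraph (std_K6_star k)) (disjoint_union (K 6) (Star (k.+1 - 6))).
  by apply: iso_disjoint_union; [apply: card_ord_lt; nlia | rewrite inE /= inordK].
have K4S : isomorphic (Hypergraph (std_K4_star k)) (disjoint_union (K 4) (Star (k.+1 - 4))).
  by apply: iso_disjoint_union; [apply: card_ord_lt; nlia | rewrite inE /= inordK //; nlia].
split.
- move=> n10; have [e7|n8] : k.+1 = 7 \/ 8 <= k.+1 <= 10 by nlia.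
    by have [-> E] := third_7 n7 e7; split=> //; exact: family_G.
  by have [-> E] := third_8_10 n7 n8; split=> //; exact: family_G.
- by move=> e; have [-> E] := third_11 n7 e; split=> //; exact: family_G_Co.
- by move=> e; have [-> E] := third_12 n7 e; split=> //; apply: (family_single E); exact: std_cometE.
- case/andP=> n13 n14; have [e|e] : k.+1 = 13 \/ k.+1 = 14 by nlia.
    by have [-> E] := third_13 n7 e; split; [rewrite e | exact: family_single E K6S].
  by have [-> E] := third_14 n7 e; split; [rewrite e | exact: family_single E K6S].
by move=> n15; have [-> E] := third_15 n7 n15; split=> //; exact: family_single E K4S.
Qed.
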